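(* Let $A$ be an $n\times n$ real expansive matrix. Suppose that $\{\psi^1,\ldots,\psi^L\}\subset L^2(\mathbb{R}^n)$ and $\{\psi^1_*,\ldots,\psi^L_*\}\subset L^2(\mathbb{R}^n)$ is a pair of biorthogonal Riesz wavelets, that is, the systems $\{D_{A^j}T_k\psi^l:j\in\mathbb{Z},k\in\mathbb{Z}^n,l=1,\ldots,L\}$ and $\{D_{A^j}T_k\psi^l_*:j\in\mathbb{Z},k\in\mathbb{Z}^n,l=1,\ldots,L\}$ are Riesz bases of $L^2(\mathbb{R}^n)$ satisfying $$\langle D_{A^j}T_k\psi^l,D_{A^{j'}}T_{k'}\psi^{l'}_*\rangle=\delta_{j,j'}\delta_{k,k'}\delta_{l,l'}\qquad j,j'\in\mathbb{Z},\ k,k'\in\mathbb{Z}^n,\ l,l'=1,\ldots,L.$$ Assume that: (i) there exists $\eta>1$ such that each $\psi^l$ and each $\psi^l_*$ belongs to $L^2((1+\rho_A)^\eta)$; and (ii) the spaces of negative dilates $$V_0=\overline{\operatorname{span}}\{D_{A^j}T_k\psi^l:j<0,k\in\mathbb{Z}^n,l=1,\ldots,L\},\qquad V_0^*=\overline{\operatorname{span}}\{D_{A^j}T_k\psi^l_*:j<0,k\in\mathbb{Z}^n,l=1,\ldots,L\}$$ are shift invariant. Then $A$ is a rational matrix (all its entries are rational). In particular, the assumptions are met, and hence $A$ is rational, when there exists an orthonormal wavelet $\{\psi^1,\ldots,\psi^L\}\subset L^2(\mathbb{R}^n)$ for the dilation $A$ and lattice $\mathbb{Z}^n$ (i.e.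 $\{D_{A^j}T_k\psi^l:j\in\mathbb{Z},k\in\mathbb{Z}^n,l=1,\ldots,L\}$ is an orthonormal basis of $L^2(\mathbb{R}^n)$) such that for some $\eta>1$ we have $\psi^l\in L^2((1+\rho_A)^\eta)$ for all $l=1,\ldots,L$, and the space $V_0$ of negative dilates is shift invariant.
   Context: A real $n\times n$ matrix $A$ is expansive if all its eigenvalues $\lambda$ satisfy $|\lambda|>1$. $T_yf(x)=f(x-y)$; $D_Pf(x)=|\det P|^{1/2}f(Px)$. A closed subspace $V\subset L^2(\mathbb{R}^n)$ is shift invariant if $T_k(V)\subset V$ for all $k\in\mathbb{Z}^n$. For a positive weight $\omega$ on $\mathbb{R}^n$, $L^2(\omega)$ is the space of measurable $f$ with $\int_{\mathbb{R}^n}|f(x)|^2\omega(x)\,dx<\infty$. $\rho_A:\mathbb{R}^n\to[0,\infty)$ is a quasi-norm associated with $A$, i.e., a function such that: (a) $\rho_A$ is $C^\infty$ on $\mathbb{R}^n\setminus\{0\}$ and continuous at $0$; (b) $\rho_A(x)=\rho_A(-x)>0$ for all $x\ne0$; (c) $\rho_A(Ax)=|\det A|\,\rho_A(x)$ for all $x\in\mathbb{R}^n$. (Any two quasi-norms associated with the same $A$ are equivalent up to multiplicative constants.) *)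

(* Defs.v *)
From HB Require Import structures.
From mathcomp Require Import all_boot all_order all_algebra.
From mathcomp Require Import complex.
From mathcomp Require Import all_classical all_reals all_analysis.

Set Implicit Arguments.
Unset Strict Implicit.
Unset Printing Implicit Defensive.

Import Order.TTheory GRing.Theory Num.Theory.
Import numFieldNormedType.Exports.

Local Open Scope classical_set_scope.
Local Open Scope ring_scope.

(* Points of R^n are column vectors.  Their sigma-algebra is generated by the
   coordinate functions, i.e. it is the Borel sigma-algebra. *)
Section measurable_cV.
Context {R : realType} (n : nat).

Definition cV_coord (i : 'I_n) (x : 'cV[R]_n) : measurableTypeR R := x i ord0.

Let cV_set0 : g_sigma_preimage cV_coord set0.
Proof. exact: sigma_algebra0. Qed.

Let cV_setC A : g_sigma_preimage cV_coord A -> g_sigma_preimage cV_coord (~` A).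
Proof. exact: sigma_algebraC. Qed.

Let cV_bigcup (F : (set 'cV[R]_n)^nat) :
  (forall i, g_sigma_preimage cV_coord (F i)) ->
  g_sigma_preimage cV_coord (\bigcup_i (F i)).
Proof. exact: sigma_algebra_bigcup. Qed.

HB.instance Definition _ := @isMeasurable.Build default_measure_display
  'cV[R]_n (g_sigma_preimage cV_coord) cV_set0 cV_setC cV_bigcup.

Lemma measurable_cV_coord (i : 'I_n) : measurable_fun setT (cV_coord i).
Proof.
move=> _ Y mY; rewrite setTI; apply: sub_sigma_algebra => /=.
rewrite -bigcup_seq/=; exists i => /=; first by rewrite mem_index_enum.
by exists Y => //; rewrite setTI.
Qed.

Lemma measurable_fun_cVP d (T : measurableType d) (f : T -> 'cV[R]_n) :
  (forall i, measurable_fun setT (fun t => cV_coord i (f t))) ->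
  measurable_fun setT f.
Proof.
move=> mf.
suff sub : g_sigma_preimage cV_coord `<=`
    [set A : set 'cV[R]_n | measurable (f @^-1` A)].
  by move=> _ A mA; rewrite setTI; exact: sub.
apply: smallest_sub.
  split => [|A|F mF] /=.
  - by rewrite preimage_set0.
  - by move=> mA; rewrite setTD preimage_setC; exact: measurableC.
  - by rewrite preimage_bigcup; apply: bigcup_measurable => k _; exact: mF.
rewrite -bigcup_seq => A [i _] [Y mY <-] /=.
by rewrite setTI -comp_preimage -[X in measurable X]setTI; exact: mf.
Qed.

End measurable_cV.

Section lebesgue_cV.
Context {R : realType}.

Definition cV_cons n (p : 'cV[R]_n * measurableTypeR R) : 'cV[R]_n.+1 :=
  \col_i (if unlift ord0 i is Some k then p.1 k ord0 else p.2).

Lemma measurable_cV_cons n : measurable_fun setT (@cV_cons n).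
Proof.
apply: measurable_fun_cVP => i; case: (unliftP ord0 i) => [k|] ->.
- rewrite [X in measurable_fun _ X](_ : _ = cV_coord k \o fst).
    by apply: measurableT_comp => //; exact: measurable_cV_coord.
  by apply/funext => p; rewrite /cV_coord mxE liftK.
- rewrite [X in measurable_fun _ X](_ : _ = snd) //.
  by apply/funext => p; rewrite /cV_coord mxE unlift_none.
Qed.

Section step.
Variables (n : nat) (mu : {measure set 'cV[R]_n -> \bar R}).

Definition lebesgue_cV_step : set 'cV[R]_n.+1 -> \bar R :=
  pushforward (mu \x @lebesgue_measure R)%E (@cV_cons n).

HB.instance Definition _ := Measure.copy lebesgue_cV_step
  (measure_function_pushforward__canonical__measure_function_Measure
     (mu \x @lebesgue_measure R)%E (@measurable_cV_cons n)).

End step.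

(* Lebesgue measure on R^n, as the n-fold product of the Lebesgue measure of
   the line (a point mass for n = 0). *)
Fixpoint lebesgue_cV (n : nat) : {measure set 'cV[R]_n -> \bar R} :=
  match n with
  | 0 => dirac (0 : 'cV[R]_0)
  | m.+1 => lebesgue_cV_step (lebesgue_cV m)
  end.

Lemma lebesgue_cV_box n (A : 'I_n -> set (measurableTypeR R)) :
  (forall i, measurable (A i)) ->
  lebesgue_cV n [set x | forall i, A i (x i ord0)] =
  (\prod_(i < n) lebesgue_measure (A i))%E.
Proof.
elim: n A => [|n IHn] A mA.
  by rewrite big_ord0 /= diracE mem_set //= => -[].
rewrite big_ord_recl /= /lebesgue_cV_step /pushforward.
rewrite (_ : _ @^-1` _ =
    [set x : 'cV[R]_n | forall i, A (lift ord0 i) (x i ord0)] `*` A ord0).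
  rewrite product_measure1E //.
    by rewrite muleC; congr (_ * _)%E; exact: (IHn (fun i => A (lift ord0 i))).
  rewrite (_ : mkset _ = \bigcap_(i in [set: 'I_n])
      (@cV_coord R n i @^-1` A (lift ord0 i))).
    apply: fin_bigcap_measurable => // i _.
    by rewrite -[X in measurable X]setTI; exact: measurable_cV_coord.
  by apply/seteqP; split => x /= h i; have := h i => // /(_ I).
apply/seteqP; split => [[x t] /= h|[x t] [/= hx ht] i].
- split => [i|]; first by have := h (lift ord0 i); rewrite mxE liftK.
  by have := h ord0; rewrite mxE unlift_none.
- by case: (unliftP ord0 i) => [k|] ->; rewrite mxE ?liftK ?unlift_none.
Qed.

End lebesgue_cV.

Section L2.
Context {R : realType} {n : nat}.
Implicit Types (f g : 'cV[R]_n -> R[i]) (w : 'cV[R]_n -> R).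

Definition cmeasurable f : Prop :=
  measurable_fun setT (fun x => complex.Re (f x)) /\
  measurable_fun setT (fun x => complex.Im (f x)).

(* Elements of L^2 spaces are represented by functions, not by classes of
   almost everywhere equal functions. *)
Definition weighted_L2 w : set ('cV[R]_n -> R[i]) :=
  [set f | cmeasurable f /\
    (\int[lebesgue_cV n]_x (Normc.normc (f x) ^+ 2 * w x)%:E < +oo)%E].

Definition L2_sqnorm f : \bar R :=
  (\int[lebesgue_cV n]_x (Normc.normc (f x) ^+ 2)%:E)%E.

Definition L2 : set ('cV[R]_n -> R[i]) :=
  [set f | cmeasurable f /\ (L2_sqnorm f < +oo)%E].

Definition L2_inner f g : R[i] :=
  let h x := f x * conjc (g x) in
  Complex (\int[lebesgue_cV n]_x complex.Re (h x))
          (\int[lebesgue_cV n]_x complex.Im (h x)).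

Definition closed_span (S : set ('cV[R]_n -> R[i])) : set ('cV[R]_n -> R[i]) :=
  [set f | L2 f /\ forall e : R, 0 < e ->
    exists (m : nat) (c : 'I_m -> R[i]) (s : 'I_m -> 'cV[R]_n -> R[i]),
      (forall i, S (s i)) /\
      (L2_sqnorm (fun x => f x - \sum_(i < m) c i * s i x)%R < e%:E)%E].

Section systems.
Variables (I : eqType) (phi : I -> 'cV[R]_n -> R[i]).

Definition complete_system : Prop :=
  (forall i, L2 (phi i)) /\ L2 `<=` closed_span (range phi).

Definition riesz_basis : Prop :=
  complete_system /\
  exists a b : R, [/\ 0 < a, 0 < b &
    forall (s : seq I) (c : I -> R[i]), uniq s ->
      let coef := \sum_(i <- s) Normc.normc (c i) ^+ 2 in
      let comb := fun x => \sum_(i <- s) c i * phi i x in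
      ((a * coef)%:E <= L2_sqnorm comb <= (b * coef)%:E)%E].

Definition orthonormal_basis : Prop :=
  complete_system /\
  forall i i', L2_inner (phi i) (phi i') = (i == i')%:R.

End systems.

Definition translate (y : 'cV[R]_n) f : 'cV[R]_n -> R[i] := fun x => f (x - y).

Definition dilate (P : 'M[R]_n) f : 'cV[R]_n -> R[i] :=
  fun x => (Num.sqrt `|\det P|)%:C%C * f (P *m x).

Definition lattice_point (k : 'cV[int]_n) : 'cV[R]_n := map_mx intr k.

Definition shift_invariant (V : set ('cV[R]_n -> R[i])) : Prop :=
  forall k f, V f -> V (translate (lattice_point k) f).

End L2.

Section matrices.
Context {R : realType} {n : nat}.
Implicit Types A : 'M[R]_n.

Definition expansive A : Prop :=
  forall lambda : R[i],
    eigenvalue (map_mx (real_complex R) A) lambda -> 1 < `|lambda|.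

Definition rational_matrix A : Prop :=
  forall i j, exists q : rat, A i j = ratr q.

Definition iterated_partial (s : seq 'I_n) (f : 'cV[R]_n -> R) :
    'cV[R]_n -> R :=
  foldr (fun i g => 'D_(delta_mx i ord0) g) f s.

Definition smooth_on (U : set 'cV[R]_n) (f : 'cV[R]_n -> R) : Prop :=
  forall (s : seq 'I_n) (x : 'cV[R]_n), U x ->
    {for x, continuous (iterated_partial s f)} /\
    forall i, derivable (iterated_partial s f) x (delta_mx i ord0).

Record quasi_norm A (rho : 'cV[R]_n -> R) : Prop := QuasiNorm {
  quasi_norm_ge0 : forall x, 0 <= rho x;
  quasi_norm_smooth : smooth_on [set x | x != 0] rho;
  quasi_norm_cont0 : {for 0, continuous rho};
  quasi_norm_sym : forall x, x != 0 -> rho x = rho (- x) /\ 0 < rho x;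
  quasi_norm_scale : forall x, rho (A *m x) = `|\det A| * rho x
}.

End matrices.

(* The size n.+1 makes square matrices a unit ring, so that [A ^ j] is
   available for every integer j. *)
Section wavelets.
Context {R : realType} {n L : nat}.
Implicit Types (A : 'M[R]_n.+1) (psi : 'I_L -> 'cV[R]_n.+1 -> R[i]).

Definition wavelet_index : Type := (int * 'cV[int]_n.+1 * 'I_L)%type.

Definition affine_system A psi (i : wavelet_index) : 'cV[R]_n.+1 -> R[i] :=
  let: (j, k, l) := i in dilate (A ^ j) (translate (lattice_point k) (psi l)).

Definition biorthogonal_riesz_wavelets A psi psi_dual : Prop :=
  [/\ riesz_basis (affine_system A psi),
      riesz_basis (affine_system A psi_dual) &
      forall i i', L2_inner (affine_system A psi i)
                            (affine_system A psi_dual i') = (i == i')%:R].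

Definition orthonormal_wavelet A psi : Prop :=
  orthonormal_basis (affine_system A psi).

Definition negative_dilates A psi : set ('cV[R]_n.+1 -> R[i]) :=
  closed_span [set affine_system A psi i | i in [set i | i.1.1 < 0]].

End wavelets.

(* Main.v *)
(* Let [P J] be the oblique projection onto the closed span of the wavelets with
   [j < J], along the orthogonal complement of the span of their duals.  Shift
   invariance of both spaces of negative dilates makes [P 0] commute with the
   translations by Z^n; so does [P 1], since the layer [j = 0] is invariant.  The
   dilation by [A] conjugates [P 0] into [P 1], so [P 0] also commutes with the
   translations by A Z^n.  If [A] had an irrational entry, Z^n + A Z^n would
   contain arbitrarily small [y != 0].

   Take traces of Z^n-periodic operators over a unit box away from the origin:
   there [P J] is Hilbert-Schmidt.  The decay of the dual wavelets makes [P J]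
   almost commute with multiplication by a slowly oscillating character, while
   moving that character past the translation [Tr y] costs a phase different
   from 1; hence [Tr y \o P J] has trace zero.  Letting [y] tend to 0, [P 0] and
   [P 1] have trace zero, but [P 1 - P 0], the projection onto a single layer, has
   trace [L], that is [2 * L] over the reals, the scalars used throughout. *)

From HB Require Import structures.
Require Import Defs.
From mathcomp Require Import all_boot all_order all_algebra.
From mathcomp Require Import complex.
From mathcomp Require Import all_classical all_reals all_analysis.
From mathcomp Require Import ring lra.

Set Implicit Arguments.
Unset Strict Implicit.
Unset Printing Implicit Defensive.

Import Order.TTheory GRing.Theory Num.Theory.
Import numFieldNormedType.Exports.
Import measurable_realfun.

Local Open Scope classical_set_scope.
Local Open Scope ring_scope.

(** * Real Hilbert spaces, Riesz bases and oblique projections *)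

(** Commutation with the character is only approximate, yet the trace must vanish exactly. Let [M]
    be the character, [T] a phase times the translation, and [T2] its conjugate by [M]. If [M]
    commuted with [P], then [T2 P] would be conjugate to [T P], and cyclicity would equate their
    traces. In general the compressions [P M P] and [P M^-1 P] are mutually inverse on the range of
    [P] up to errors [E], [E'] of norm less than 1; cyclicity gives tr T(P - E)E^m = tr T2(P -
    E')E'^m for all [m], and these identities telescope. So the leak only has to fall below a fixed
    threshold. As [P] is idempotent, its trace over the box is the pairing of two Hilbert-Schmidt
    operators, [P] and its adjoint. The box avoids the origin because its images under the negative
    powers of [A] then overlap boundedly, which bounds the mass on it of all wavelets with [j <= 0].
    The Jacobian of [A ^ j] is read off from the wavelets: biorthogonality holds before and after
    the dilation, and this fixes the factor. *)

Record hilbert (R : realType) := Hilbert {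
  hcar :> lmodType R;
  ip : hcar -> hcar -> R;
  ipC : forall x y, ip x y = ip y x;
  ipDl : forall x y z, ip (x + y) z = ip x z + ip y z;
  ipZl : forall a x y, ip (a *: x) y = a * ip x y;
  ip_ge0 : forall x, 0 <= ip x x;
  ip_eq0 : forall x, ip x x = 0 -> x = 0;
  ip_complete : forall u : nat -> hcar,
    (forall e, 0 < e -> exists N, forall m n, (N <= m)%N -> (N <= n)%N ->
       ip (u m - u n) (u m - u n) < e) ->
    exists l, forall e, 0 < e -> exists N, forall n, (N <= n)%N ->
       ip (u n - l) (u n - l) < e }.

Arguments ip : simpl never.

Section hilbert_theory.
Context {R : realType} {H : hilbert R}.
Implicit Types (x y z f g : H) (X Y : H -> H).

Definition nsq x : R := ip x x.

Lemma ipDr x y z : ip z (x + y) = ip z x + ip z y.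
Proof. by rewrite ipC ipDl !(ipC z). Qed.

Lemma ipZr a x y : ip y (a *: x) = a * ip y x.
Proof. by rewrite ipC ipZl (ipC y). Qed.

Lemma ipNl x y : ip (- x) y = - ip x y.
Proof. by rewrite -scaleN1r ipZl mulN1r. Qed.

Lemma ipNr x y : ip y (- x) = - ip y x.
Proof. by rewrite -scaleN1r ipZr mulN1r. Qed.

Lemma ipBl x y z : ip (x - y) z = ip x z - ip y z.
Proof. by rewrite ipDl ipNl. Qed.

Lemma ipBr x y z : ip z (x - y) = ip z x - ip z y.
Proof. by rewrite ipDr ipNr. Qed.

Lemma ip0l y : ip 0 y = 0.
Proof. by rewrite -(scale0r y) ipZl mul0r. Qed.

Lemma ip0r y : ip y 0 = 0.
Proof. by rewrite ipC ip0l. Qed.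

Lemma ip_suml I (s : seq I) (P : pred I) (F : I -> H) y :
  ip (\sum_(i <- s | P i) F i) y = \sum_(i <- s | P i) ip (F i) y.
Proof.
by elim/big_rec2: _ => [|i a b _ <-]; rewrite ?ip0l // ipDl.
Qed.

Lemma ip_sumr I (s : seq I) (P : pred I) (F : I -> H) y :
  ip y (\sum_(i <- s | P i) F i) = \sum_(i <- s | P i) ip y (F i).
Proof. by rewrite ipC ip_suml; under eq_bigr do rewrite ipC. Qed.

Lemma nsq_ge0 x : 0 <= nsq x. Proof. exact: ip_ge0. Qed.

Lemma nsq0 : nsq (0 : H) = 0. Proof. exact: ip0l. Qed.

Lemma nsqN x : nsq (- x) = nsq x.
Proof. by rewrite /nsq ipNl ipNr opprK. Qed.

Lemma nsqZ a x : nsq (a *: x) = a ^+ 2 * nsq x.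
Proof. by rewrite /nsq ipZl ipZr mulrA. Qed.

Lemma nsqD x y : nsq (x + y) = nsq x + 2 * ip x y + nsq y.
Proof. by rewrite /nsq ipDl !ipDr (ipC y x); ring. Qed.

Lemma nsqB x y : nsq (x - y) = nsq x - 2 * ip x y + nsq y.
Proof. by rewrite nsqD nsqN ipNr; ring. Qed.

Lemma nsqD_le x y : nsq (x + y) <= 2 * nsq x + 2 * nsq y.
Proof. by have := nsq_ge0 (x - y); rewrite nsqB nsqD; lra. Qed.

Lemma nsqB_le x y : nsq (x - y) <= 2 * nsq x + 2 * nsq y.
Proof. by rewrite -(nsqN y); exact: nsqD_le. Qed.

Lemma ip_polar x y : ip x y = (nsq (x + y) - nsq (x - y)) / 4.
Proof. by rewrite nsqB nsqD; lra. Qed.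

Lemma ip_cauchy_schwarz x y : ip x y ^+ 2 <= nsq x * nsq y.
Proof.
have [y0|y0] := eqVneq (nsq y) 0.
  by rewrite (ip_eq0 y0) ip0r nsq0 mulr0 expr0n.
have yp : 0 < nsq y by rewrite lt_neqAle eq_sym y0 nsq_ge0.
have := nsq_ge0 (nsq y *: x - ip x y *: y).
rewrite nsqB !nsqZ ipZl ipZr => h.
have : 0 <= nsq y * (nsq x * nsq y - ip x y ^+ 2) by nra.
by rewrite pmulr_rge0// subr_ge0.
Qed.

(** The free [c] lets a small factor be paired with one that is merely bounded. *)
Lemma ip_amgm c x y : 0 < c -> `|ip x y| <= c * nsq x + c^-1 * nsq y.
Proof.
move=> c0.
have h1 := nsq_ge0 (c *: x - y); have h2 := nsq_ge0 (c *: x + y).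
move: h1 h2; rewrite nsqB nsqD !nsqZ ipZl => h1 h2.
have e : c * (c * nsq x + c^-1 * nsq y) = c ^+ 2 * nsq x + nsq y.
  by field; rewrite gt_eqF.
have x0 := nsq_ge0 x; have y0 := nsq_ge0 y.
rewrite -(ler_pM2l c0) e -(gtr0_norm c0) -normrM (gtr0_norm c0).
have cx : 0 <= c ^+ 2 * nsq x by rewrite mulr_ge0// sqr_ge0.
by rewrite ler_norml; apply/andP; split; lra.
Qed.

Lemma ip_ext x y : (forall g, ip x g = ip y g) -> x = y.
Proof.
move=> h; apply/eqP; rewrite -subr_eq0; apply/eqP/ip_eq0.
by rewrite ipBl h subrr.
Qed.

Lemma nsq_lim (u : nat -> H) l :
  (forall e, 0 < e -> exists N, forall n, (N <= n)%N -> nsq (u n - l) < e) ->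
  forall g, (fun n => ip (u n) g) @ \oo --> ip l g.
Proof.
move=> ul g; apply/cvgrPdist_lt => e e0.
have g1 : 0 < nsq g + 1 by rewrite ltr_wpDl// nsq_ge0.
have [N hN] := ul (e ^+ 2 / (nsq g + 1)) (divr_gt0 (exprn_gt0 2 e0) g1).
near=> n.
have nN : (N <= n)%N by near: n; exact: nbhs_infty_ge.
have := ip_cauchy_schwarz (u n - l) g.
have := hN n nN; rewrite ltr_pdivlMr// => h cs.
have lt2 : ip (u n - l) g ^+ 2 < e ^+ 2.
  apply: le_lt_trans cs (le_lt_trans _ h).
  by rewrite ler_wpM2l ?nsq_ge0// lerDl.
rewrite distrC -ipBl -(ltr_pXn2r (n := 2)) ?nnegrE ?(ltW e0)//.
by rewrite real_normK ?num_real.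
Unshelve. all: by end_near.
Qed.

(** Operators are bare functions: having an adjoint in this sense already forces linearity, so no
    linear structure is carried along. *)
Definition adj X Y := forall f g, ip (X f) g = ip f (Y g).

Lemma adjC X Y : adj X Y -> adj Y X.
Proof. by move=> h f g; rewrite ipC -h ipC. Qed.

Lemma adj_add X X' Y Y' : adj X X' -> adj Y Y' -> adj (X \+ Y) (X' \+ Y').
Proof. by move=> hX hY f g /=; rewrite ipDl hX hY ipDr. Qed.

Lemma adj_sub X X' Y Y' : adj X X' -> adj Y Y' -> adj (X \- Y) (X' \- Y').
Proof. by move=> hX hY f g /=; rewrite ipBl hX hY ipBr. Qed.

Lemma adjD X X' : adj X X' -> forall f g, X (f + g) = X f + X g.
Proof. by move=> hX f g; apply: ip_ext => z; rewrite ipDl !hX ipDl. Qed.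

Lemma adjS X X' : adj X X' -> forall a f, X (a *: f) = a *: X f.
Proof. by move=> hX a f; apply: ip_ext => z; rewrite ipZl !hX ipZl. Qed.

Lemma adj0 X X' : adj X X' -> X 0 = 0.
Proof. by move=> hX; rewrite -(scale0r 0) (adjS hX) !scale0r. Qed.

Lemma adjN X X' : adj X X' -> forall f, X (- f) = - X f.
Proof. by move=> hX f; rewrite -scaleN1r (adjS hX) scaleN1r. Qed.

Lemma adjB X X' : adj X X' -> forall f g, X (f - g) = X f - X g.
Proof. by move=> hX f g; rewrite (adjD hX) (adjN hX). Qed.

(** An additive isometry preserves [ip] by polarization; writing [g] as [X (Y g)] then removes [X]
    from the pairing. *)
Lemma adj_isometry X Y : (forall f g, X (f + g) = X f + X g) ->
  (forall f, nsq (X f) = nsq f) -> cancel Y X -> adj X Y.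
Proof.
move=> XD Xn YK f g; rewrite -{1}(YK g).
have XN z : X (- z) = - X z.
  apply/eqP; rewrite -subr_eq0 opprK -XD addNr; apply/eqP/ip_eq0.
  by rewrite -/(nsq _) Xn nsq0.
by rewrite !ip_polar -XN -!XD !Xn.
Qed.

End hilbert_theory.

Arguments nsq : simpl never.

(** * Series of nonnegative extended reals *)

Section series.
Context {R : realType}.
Local Open Scope ereal_scope.

Lemma esum_exchange (T1 T2 : choiceType) (A : set T1) (B : set T2)
    (a : T1 -> T2 -> \bar R) : (forall i j, 0 <= a i j) ->
  \esum_(i in A) \esum_(j in B) a i j = \esum_(j in B) \esum_(i in A) a i j.
Proof.
move=> a0; rewrite !esum_esum//.
rewrite (reindex_esum (B `*`` fun=> A) _ (fun x => (x.2, x.1)))//; split => //=.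
- by move=> [i j] [].
- by move=> [i1 i2] [j1 j2] /= _ _ [] -> ->.
- by move=> [i1 i2] [? ?] /=; exists (i2, i1).
Qed.

Lemma esumZl (T : choiceType) (A : set T) (c : R) (a : T -> \bar R) :
  (0 <= c)%R -> (forall i, 0 <= a i) ->
  \esum_(i in A) (c%:E * a i) = c%:E * \esum_(i in A) a i.
Proof.
move=> c0 a0; have [->|cn] := eqVneq c 0%R.
  by rewrite mul0e esum1// => i _; rewrite mul0e.
have cp : (0 < c)%R by rewrite lt_neqAle eq_sym cn.
have key (d : R) (b : T -> \bar R) : (0 < d)%R -> (forall i : T, 0 <= b i) ->
    (d%:E * esum A b <= esum A (fun i => d%:E * b i))%E.
  move=> d0 b0; rewrite -lee_pdivlMl//; apply: ge_ereal_sup => _ [X [fX XA] <-].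
  rewrite lee_pdivlMl// ge0_mule_fsumr//; apply: esum_ge; exists X => //.
apply/eqP; rewrite eq_le key// andbT.
rewrite -lee_pdivrMl//; apply: le_trans (key _ _ _ _) _; rewrite ?invr_gt0//.
  by move=> i; rewrite mule_ge0// lee_fin.
by apply: le_esum => i _; rewrite muleA -EFinM mulVf// mul1e.
Qed.

Lemma esum_cvg (a : nat -> R) : (forall i, 0 <= a i)%R ->
  \esum_(i in [set: nat]) (a i)%:E < +oo ->
  (fun n => (\sum_(i < n) a i)%R) @ \oo --> fine (\esum_(i in [set: nat]) (a i)%:E).
Proof.
move=> a0; rewrite -nneseries_esumT; last by move=> i; rewrite lee_fin.
move=> fin.
have c := @is_cvg_nneseries R (fun i => (a i)%:E) xpredT 0
  (fun i _ _ => ltac:(rewrite lee_fin; exact: a0)).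
have fn : \sum_(i <oo) (a i)%:E \is a fin_num.
  rewrite ge0_fin_numE//; apply: nneseries_ge0 => i _ _; by rewrite lee_fin.
move/cvgP : (c) => _.
have := c; rewrite -(fineK fn) => {}c.
have : (fun n => (\sum_(i < n) a i)%:E) @ \oo --> (fine (\sum_(i <oo) (a i)%:E))%:E.
  rewrite (_ : (fun n => _) = fun n => \sum_(0 <= i < n) (a i)%:E) //.
  by apply/funext => n; rewrite big_mkord sumEFin.
by move/fine_cvg.
Qed.

Lemma esum_partial_le (a : nat -> R) n : (forall i, 0 <= a i)%R ->
  (\sum_(i < n) a i)%:E <= \esum_(i in [set: nat]) (a i)%:E.
Proof.
move=> a0; rewrite -nneseries_esumT; last by move=> i; rewrite lee_fin.
rewrite -sumEFin -(big_mkord xpredT (fun i => (a i)%:E)).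
by apply: nneseries_lim_ge => i _; rewrite lee_fin.
Qed.

Lemma esum_le_partial (a : nat -> R) (K : \bar R) : (forall i, 0 <= a i)%R ->
  (forall n, (\sum_(i < n) a i)%:E <= K) ->
  \esum_(i in [set: nat]) (a i)%:E <= K.
Proof.
move=> a0 h; rewrite -nneseries_esumT; last by move=> i; rewrite lee_fin.
apply: lime_le; first by apply: is_cvg_nneseries => i _ _; rewrite lee_fin.
by apply: nearW => n; rewrite big_mkord sumEFin.
Qed.

End series.

Lemma cvgn_unique {R : realType} (u : nat -> R) (a b : R) :
  u @ \oo --> a -> u @ \oo --> b -> a = b.
Proof. by move=> ua ub; exact: (cvg_unique _ ua ub). Qed.

(** * Bessel bounds, biorthogonal expansions and oblique projections *)

Section riesz.
Context {R : realType} {H : hilbert R}.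
Implicit Types (x y f g : H) (phi : nat -> H) (c : nat -> R) (S : set nat).

Definition riesz_ub phi b := forall (s : seq nat) c, uniq s ->
  nsq (\sum_(i <- s) c i *: phi i) <= b * \sum_(i <- s) c i ^+ 2.

Definition total_family phi := forall x, (forall i, ip x (phi i) = 0) -> x = 0.

Lemma riesz_ub_nat phi b c m n : riesz_ub phi b ->
  nsq (\sum_(m <= i < n) c i *: phi i) <= b * \sum_(m <= i < n) c i ^+ 2.
Proof. by move=> /(_ (index_iota m n) c); apply; exact: iota_uniq. Qed.

(** Duality: pair [f] with the combination [w] of the [phi i] whose coefficients are [ip f (phi i)].
    Then [ip f w] is the sum itself, and Cauchy-Schwarz together with the bound on [nsq w] cancels
    one factor of it. *)
Lemma bessel phi b f n : riesz_ub phi b ->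
  \sum_(i < n) ip f (phi i) ^+ 2 <= b * nsq f.
Proof.
move=> /riesz_ub_nat h; rewrite -(big_mkord xpredT (fun i => ip f (phi i) ^+ 2)).
set s := (X in X <= _); have s0 : 0 <= s by apply: sumr_ge0 => i _; exact: sqr_ge0.
have := h (fun i => ip f (phi i)) 0%N n.
set w := (X in nsq X) => nw.
have fw : ip f w = s.
  by rewrite ip_sumr; apply: eq_bigr => i _; rewrite ipZr expr2.
(* A zero sum cannot be cancelled; there the claim is [0 <= b * nsq f], and the Riesz bound at the
   single vector [phi 0] gives [0 <= b]. *)
have [s00|sn] := eqVneq s 0.
  have [s1|] := leP s (b * nsq f) => //.
  have := nw; rewrite -/s s00 mulr0 => nw0.
  have h0 := h (fun=> 1) 0%N 1%N.
  rewrite !big_nat1 scale1r expr1n mulr1 in h0.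
  by rewrite ltNge mulr_ge0 ?nsq_ge0// (le_trans _ h0)// nsq_ge0.
have sp : 0 < s by rewrite lt_neqAle eq_sym sn.
have := ip_cauchy_schwarz f w; rewrite fw -(ler_pM2l sp) => cs.
rewrite -(ler_pM2l sp).
have : nsq f * nsq w <= nsq f * (b * s) by rewrite ler_wpM2l ?nsq_ge0.
move: cs; rewrite expr2 ler_pM2l// => cs cs2; lra.
Qed.

(** The upper Riesz bound carries the Cauchy property from the partial sums of [c i ^+ 2] to the
    partial sums of vectors. *)
Lemma synthesis_ex phi b c (K : R) : riesz_ub phi b -> 0 <= b ->
  (forall n, \sum_(i < n) c i ^+ 2 <= K) ->
  exists x, (forall g, (fun n => \sum_(i < n) c i * ip (phi i) g) @ \oo --> ip x g)
    /\ nsq x <= b * K.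
Proof.
move=> ub b0 cK.
pose s n := \sum_(i < n) c i ^+ 2.
pose u n := \sum_(i < n) c i *: phi i.
have snd m n : (m <= n)%N -> s n - s m = \sum_(m <= i < n) c i ^+ 2.
  move=> mn; rewrite /s -!(big_mkord xpredT (fun i => c i ^+ 2)).
  by rewrite (big_cat_nat _ (n := m))//= addrAC subrr add0r.
have und m n : (m <= n)%N -> u n - u m = \sum_(m <= i < n) c i *: phi i.
  move=> mn; rewrite /u -!(big_mkord xpredT (fun i => c i *: phi i)).
  by rewrite (big_cat_nat _ (n := m))//= addrAC subrr add0r.
have nds : nondecreasing_seq s.
  move=> m n mn; rewrite -subr_ge0 snd//.
  by apply: sumr_ge0 => i _; exact: sqr_ge0.
have cs : cvgn s.
  by apply: nondecreasing_is_cvgn => //; exists K => _ [n _ <-]; exact: cK.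
have cau e : 0 < e -> exists N, forall m n, (N <= m)%N -> (N <= n)%N ->
    nsq (u m - u n) < e.
  move=> e0; have d0 : 0 < e / (b + 1) by rewrite divr_gt0// ltr_wpDl.
  have /cvgrPdist_lt /(_ _ d0) [N _ hN] := cs.
  exists N.
  have key m n : (N <= m)%N -> (m <= n)%N -> nsq (u n - u m) < e.
    move=> Nm mn; rewrite und//; apply: le_lt_trans (riesz_ub_nat c m n ub) _.
    rewrite -snd//.
    have sl : s n <= limn s by apply: nondecreasing_cvgn_le.
    have := hN m Nm; rewrite /= ger0_norm; last first.
      by rewrite subr_ge0; exact: nondecreasing_cvgn_le.
    rewrite ltr_pdivlMr ?ltr_wpDl// => h.
    have sm : 0 <= s n - s m by rewrite subr_ge0 nds.
    apply: le_lt_trans h; nra.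
  move=> m n Nm Nn; have [mn|/ltnW nm] := leqP m n.
    by rewrite -nsqN opprB key.
  by rewrite key.
have [l hl] := ip_complete cau.
have lim := nsq_lim hl.
have ug n g : ip (u n) g = \sum_(i < n) c i * ip (phi i) g.
  by rewrite ip_suml; under eq_bigr do rewrite ipZl.
exists l; split=> [g|]; first by under eq_fun do rewrite -ug; exact: lim.
(* Weak convergence suffices for the norm: [ip (u n) l <= (nsq (u n) + nsq l) / 2], and the left
   side tends to [nsq l]. *)
have : nsq l <= (b * K + nsq l) / 2.
  apply: (cvgr_to_le (lim l)); apply: nearW => n.
  have := nsq_ge0 (u n - l); rewrite nsqB => h.
  suff : nsq (u n) <= b * K by lra.
  rewrite /u -(big_mkord xpredT (fun i => c i *: phi i)).
  apply: le_trans (riesz_ub_nat c 0 n ub) _.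
  by rewrite ler_wpM2l// big_mkord.
by lra.
Qed.

(** The sum of the series is characterised weakly, which makes the chosen vector unique; it is 0
    when no sum exists. *)
Definition synthesis phi c : H :=
  xget 0 [set x | forall g, (fun n => \sum_(i < n) c i * ip (phi i) g) @ \oo --> ip x g].

Lemma synthesisP phi b c K : riesz_ub phi b -> 0 <= b ->
  (forall n, \sum_(i < n) c i ^+ 2 <= K) ->
  (forall g, (fun n => \sum_(i < n) c i * ip (phi i) g) @ \oo --> ip (synthesis phi c) g)
    /\ nsq (synthesis phi c) <= b * K.
Proof.
move=> ub b0 cK; have [x [hx xK]] := synthesis_ex ub b0 cK.
rewrite /synthesis; case: xgetP => [y _ /= hy|/(_ x)/=]; last by [].
split=> //; suff -> : y = x by [].
by apply: ip_ext => g; apply: (cvgn_unique (hy g) (hx g)).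
Qed.

Lemma cvg_diag (a : nat -> R) j : (forall i, i != j -> a i = 0) ->
  (fun n => \sum_(i < n) a i) @ \oo --> a j.
Proof.
move=> aj; apply: cvg_near_cst; near=> n.
have jn : (j < n)%N by near: n; exact: nbhs_infty_gt.
by rewrite (bigD1 (Ordinal jn))//= big1 ?addr0// => i /aj.
Unshelve. all: by end_near.
Qed.

(* The oblique projection onto the closed span of [phi i], [i \in S], along the
   common kernel of the [psi i], [i \in S]. *)
Definition bproj phi psi S f : H :=
  synthesis phi (fun i => if i \in S then ip f (psi i) else 0).

(** Frames will be enumerated by [nat] through codes, and a number that codes no index carries the
    zero vector in both families: this is the second alternative of [biorth_diag]. *)
Record biorthogonal phi psi (b : R) : Prop := {
  biorth_ge0 : 0 <= b;
  biorth_ubl : riesz_ub phi b;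
  biorth_ubr : riesz_ub psi b;
  biorth_totl : total_family phi;
  biorth_totr : total_family psi;
  biorth_neq : forall i j, i != j -> ip (phi i) (psi j) = 0;
  biorth_diag : forall i,
    ip (phi i) (psi i) = 1 \/ (phi i = 0 /\ psi i = 0) }.

Lemma biorthogonalC phi psi b : biorthogonal phi psi b -> biorthogonal psi phi b.
Proof.
case=> b0 ul ur tl tr n d; split => //; first by move=> i j ij; rewrite ipC n 1?eq_sym.
by move=> i; rewrite ipC; case: (d i) => [|[-> ->]]; [left|right].
Qed.

Section bproj.
Variables (phi psi : nat -> H) (b : R).
Hypothesis bio : biorthogonal phi psi b.
Let b0 : 0 <= b := biorth_ge0 bio.

Let coef_le S f n :
  \sum_(i < n) (if (i : nat) \in S then ip f (psi i) else 0) ^+ 2 <= b * nsq f.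
Proof.
apply: le_trans (bessel f n (biorth_ubr bio)); apply: ler_sum => i _.
by case: ifP => // _; rewrite expr0n sqr_ge0.
Qed.

Lemma bproj_cvg S f g :
  (fun n => \sum_(i < n) (if (i : nat) \in S then ip f (psi i) else 0) * ip (phi i) g)
    @ \oo --> ip (bproj phi psi S f) g.
Proof. by have [] := synthesisP (c := fun i => if i \in S then ip f (psi i) else 0) (biorth_ubl bio) b0 (coef_le S f). Qed.

Lemma bproj_bound S f : nsq (bproj phi psi S f) <= b ^+ 2 * nsq f.
Proof.
by have [_] := synthesisP (c := fun i => if i \in S then ip f (psi i) else 0) (biorth_ubl bio) b0 (coef_le S f); rewrite expr2 mulrA.
Qed.

(** Sharper than [bproj_bound], since only the coefficients in [S] are charged. It serves both the
    leak, with [S] the complementary layers, and the Hilbert-Schmidt norm. *)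
Lemma bproj_bound_esum S f :
  ((nsq (bproj phi psi S f))%:E <= b%:E * \esum_(i in S) (ip f (psi i) ^+ 2)%:E)%E.
Proof.
rewrite esum_mkcond.
have e : forall i : nat, (if i \in S then (ip f (psi i) ^+ 2)%:E else 0)%E =
  ((if i \in S then ip f (psi i) else 0) ^+ 2)%:E.
  by move=> i; case: ifP => //; rewrite expr0n.
under eq_esum do rewrite e.
set s := esum _ _.
have s_le : (s <= (b * nsq f)%:E)%E.
  apply: esum_le_partial => [i|n]; first exact: sqr_ge0.
  by rewrite lee_fin coef_le.
have s_ge : (0 <= s)%E by apply: esum_ge0 => i _; rewrite lee_fin sqr_ge0.
have sf : s \is a fin_num.
  by rewrite ge0_fin_numE// (le_lt_trans s_le)// ltry.
rewrite -(fineK sf) -EFinM lee_fin.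
have [] // := synthesisP (biorth_ubl bio) b0 (K := fine s)
  (c := fun i => if i \in S then ip f (psi i) else 0).
move=> n; rewrite -lee_fin (fineK sf); apply: esum_partial_le => i.
exact: sqr_ge0.
Qed.

Lemma bproj_coef S f i :
  ip (bproj phi psi S f) (psi i) = if i \in S then ip f (psi i) else 0.
Proof.
have h := @bproj_cvg S f (psi i); apply: (cvgn_unique h).
have -> : (if i \in S then ip f (psi i) else 0) =
    (if i \in S then ip f (psi i) else 0) * ip (phi i) (psi i).
  case: (biorth_diag bio i) => [->|[-> ->]]; first by rewrite mulr1.
  by rewrite ip0r if_same mul0r.
apply: (@cvg_diag (fun j => (if j \in S then ip f (psi j) else 0) * ip (phi j) (psi i))).
by move=> j ji; rewrite (biorth_neq bio ji) mulr0.
Qed.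

Lemma coef_ext x y : (forall i, ip x (psi i) = ip y (psi i)) -> x = y.
Proof.
move=> h; apply/eqP; rewrite -subr_eq0; apply/eqP/(biorth_totr bio) => i.
by rewrite ipBl h subrr.
Qed.

Lemma bproj_idem S f : bproj phi psi S (bproj phi psi S f) = bproj phi psi S f.
Proof. apply: coef_ext => i; rewrite !bproj_coef.
by case: ifP => // ->. Qed.

Lemma bproj_compl S f : f - bproj phi psi S f = bproj phi psi (~` S) f.
Proof.
apply: coef_ext => i; rewrite ipBl !bproj_coef in_setC.
by case: ifP => _ /=; rewrite ?subrr ?subr0.
Qed.

End bproj.

Lemma bproj_adj phi psi b S : biorthogonal phi psi b ->
  adj (bproj phi psi S) (bproj psi phi S).
Proof.
move=> bio f g; have bio' := biorthogonalC bio.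
have h := @bproj_cvg phi psi b bio S f g; apply: (cvgn_unique h).
rewrite ipC; apply: cvg_trans (@bproj_cvg psi phi b bio' S g f).
apply: near_eq_cvg; apply: nearW => n; apply: eq_bigr => i _.
by case: ifP => _; rewrite ?mul0r// mulrC (ipC g) (ipC f).
Qed.

(** The two hypotheses say, on frame vectors, that [U] sends range into range and kernel into
    kernel; the adjoint of [U] extends this to all vectors. *)
Lemma bproj_intertwine phi psi b S S' U U' : biorthogonal phi psi b -> adj U U' ->
  (forall i m, i \in S -> m \notin S' -> ip (U (phi i)) (psi m) = 0) ->
  (forall i m, i \notin S -> m \in S' -> ip (U (phi i)) (psi m) = 0) ->
  forall f, U (bproj phi psi S f) = bproj phi psi S' (U f).
Proof.
move=> bio hU h1 h2 f; have bio' := biorthogonalC bio.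
apply: (coef_ext bio) => m; rewrite (bproj_coef bio).
have key A f' : (forall i, i \in A -> ip (U (phi i)) (psi m) = 0) ->
    ip (U (bproj phi psi A f')) (psi m) = 0.
  move=> hA; rewrite hU (bproj_adj _ bio) -(ip0r f'); congr (ip _ _).
  apply: (coef_ext bio') => i; rewrite ip0l (bproj_coef bio').
  by case: ifP => // /hA; rewrite hU ipC.
case: ifPn => mS'; last by rewrite key// => i iS; exact: h1.
apply/eqP; rewrite -subr_eq0 -ipBl -opprB ipNl oppr_eq0 -(adjB hU).
rewrite (bproj_compl bio) key// => i; rewrite in_setC => iS; exact: h2.
Qed.

Lemma bproj_setD phi psi b S S' : biorthogonal phi psi b -> S `<=` S' ->
  forall f, bproj phi psi S' f - bproj phi psi S f = bproj phi psi (S' `\` S) f.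
Proof.
move=> bio SS' f; apply: (coef_ext bio) => i; rewrite ipBl !(bproj_coef bio).
rewrite in_setD; case: ifPn => iS'; case: ifPn => iS /=; rewrite ?subrr ?subr0//.
by move: iS' iS; rewrite notin_setE inE => n /SS'.
Qed.

End riesz.

(** * Gram-Schmidt and Parseval's identity on the range of a projection *)

Section gram_schmidt.
Context {R : realType} {H : hilbert R}.
Variables (v : nat -> H) (Q : H -> H).
Hypotheses (Qadj : adj Q Q) (QQ : forall f, Q (Q f) = Q f).
Hypotheses (Qv : forall n, Q (v n) = v n).
Hypothesis vtot : forall f, Q f = f -> (forall n, ip f (v n) = 0) -> f = 0.

Let normalize (w : H) : H := (Num.sqrt (nsq w))^-1 *: w.

Let nsq_normalize w : normalize w = 0 \/ nsq (normalize w) = 1.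
Proof.
have [w0|w0] := eqVneq (nsq w) 0; [left|right].
  by rewrite /normalize (ip_eq0 w0) scaler0.
rewrite /normalize nsqZ exprVn sqr_sqrtr ?nsq_ge0//.
by rewrite mulVf.
Qed.

Let normalizeE w : w = Num.sqrt (nsq w) *: normalize w.
Proof.
have [w0|w0] := eqVneq (nsq w) 0; first by rewrite w0 sqrtr0 scale0r (ip_eq0 w0).
rewrite /normalize scalerA divff ?scale1r// sqrtr_eq0 -ltNge.
by rewrite lt_neqAle eq_sym w0 nsq_ge0.
Qed.

(** The list of all earlier vectors is carried along to keep the recursion structural. A vector
    dependent on its predecessors contributes 0, because [normalize 0 = 0]. *)
Fixpoint gs_seq n : seq H := if n is m.+1 then
  rcons (gs_seq m) (normalize (v m - \sum_(x <- gs_seq m) ip (v m) x *: x)) else [::].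

Definition gs n : H := normalize (v n - \sum_(x <- gs_seq n) ip (v n) x *: x).

Let gs_seqE n : gs_seq n = mkseq gs n.
Proof. by elim: n => // n IH; rewrite mkseqS -IH. Qed.

Let gsE n : gs n = normalize (v n - \sum_(i < n) ip (v n) (gs i) *: gs i).
Proof.
rewrite {1}/gs gs_seqE /mkseq big_map -(big_mkord xpredT (fun i => ip (v n) (gs i) *: gs i)).
by rewrite /index_iota subn0.
Qed.

Lemma gs_norm n : gs n = 0 \/ nsq (gs n) = 1.
Proof. exact: nsq_normalize. Qed.

Lemma gs_orth i j : i != j -> ip (gs i) (gs j) = 0.
Proof.
suff key : forall n m, (m < n)%N -> ip (gs n) (gs m) = 0.
  by rewrite neq_ltn => /orP[/key|/key//]; rewrite ipC.
elim/ltn_ind => n IH m mn; rewrite gsE /normalize ipZl ipBl ip_suml.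
have -> : \sum_(k < n) ip (ip (v n) (gs k) *: gs k) (gs m) =
    ip (v n) (gs m) * nsq (gs m).
  rewrite (bigD1 (Ordinal mn))//= ipZl big1 ?addr0// => k km.
  rewrite ipZl; have [l|l|e] := ltngtP (k : nat) m.
  - by rewrite (ipC (gs k)) (IH m mn k l) mulr0.
  - by rewrite (IH k (ltn_ord k) m l) mulr0.
  - by move/negP: km; case; apply/eqP/val_inj.
case: (gs_norm m) => [->|->]; first by rewrite !ip0r mul0r subrr mulr0.
by rewrite mulr1 subrr mulr0.
Qed.

Let gs_bio : forall s c, uniq s ->
  nsq (\sum_(i <- s) c i *: gs i) <= 1 * \sum_(i <- s) c i ^+ 2.
Proof.
move=> s c us; rewrite mul1r; elim: s us => [|i s IH] /=.
  by rewrite !big_nil nsq0.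
move=> /andP[iS us]; rewrite !big_cons nsqD ipZl ip_sumr big_seq big1 ?mulr0 ?addr0.
  rewrite lerD ?IH// nsqZ; case: (gs_norm i) => ->; rewrite ?nsq0 ?mulr1//.
  by rewrite mulr0 sqr_ge0.
move=> j js; rewrite ipZr gs_orth ?mulr0//.
by apply: contraNneq iS => ->.
Qed.

Lemma Q_gs n : Q (gs n) = gs n.
Proof.
elim/ltn_ind: n => n IH; rewrite gsE /normalize (adjS Qadj) (adjB Qadj) Qv.
congr (_ *: (_ - _)).
rewrite (big_morph Q (adjD Qadj) (adj0 Qadj)); apply: eq_bigr => i _.
by rewrite (adjS Qadj) IH.
Qed.

(** The sum [g] of the Fourier series of [Q f] lies in the range of [Q], and [Q f - g] is orthogonal
    to every [gs n], hence to every [v n], hence zero. *)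
Lemma gs_parseval f :
  (\esum_(i in [set: nat]) (ip f (gs i) ^+ 2)%:E = (nsq (Q f))%:E)%E.
Proof.
have ub : riesz_ub gs 1 := gs_bio.
have QfE i : ip f (gs i) = ip (Q f) (gs i) by rewrite Qadj Q_gs.
have bes n := bessel (Q f) n ub.
have [cv nb] := synthesisP (c := fun i => ip (Q f) (gs i)) ub ler01 bes.
set g := synthesis _ _ in cv nb.
have gc j : ip g (gs j) = ip (Q f) (gs j).
  apply: (cvgn_unique (cv (gs j))).
  have -> : ip (Q f) (gs j) = ip (Q f) (gs j) * ip (gs j) (gs j).
    by case: (gs_norm j) => [->|]; rewrite ?ip0r ?mulr0// /nsq => ->; rewrite mulr1.
  apply: (@cvg_diag _ (fun i => ip (Q f) (gs i) * ip (gs i) (gs j))) => i ij.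
  by rewrite gs_orth// mulr0.
have Qg : Q g = g.
  apply: ip_ext => h; rewrite Qadj.
  apply: (cvgn_unique (cv (Q h))); apply: cvg_trans (cv h).
  apply: near_eq_cvg; apply: nearW => n; apply: eq_bigr => i _.
  by rewrite -Qadj Q_gs.
have gE : g = Q f.
  apply/eqP; rewrite -subr_eq0; apply/eqP/vtot.
    by rewrite (adjB Qadj) Qg QQ.
  move=> n; have -> : v n = (v n - \sum_(i < n) ip (v n) (gs i) *: gs i)
      + \sum_(i < n) ip (v n) (gs i) *: gs i by rewrite subrK.
  rewrite ipDr (normalizeE (v n - _)) -gsE ipZr ip_sumr ipBl gc subrr mulr0 add0r.
  by rewrite big1// => i _; rewrite ipZr ipBl gc subrr mulr0.
have : (fun n => \sum_(i < n) ip f (gs i) ^+ 2) @ \oo --> nsq (Q f).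
  rewrite /nsq -{1}gE; apply: cvg_trans (cv (Q f)).
  apply: near_eq_cvg; apply: nearW => n; apply: eq_bigr => i _.
  by rewrite QfE expr2 (ipC (gs i)).
have fin : (\esum_(i in [set: nat]) (ip f (gs i) ^+ 2)%:E < +oo)%E.
  apply: le_lt_trans (ltry (1 * nsq (Q f))).
  apply: esum_le_partial => [i|n]; first exact: sqr_ge0.
  by rewrite lee_fin; under eq_bigr do rewrite QfE; exact: bes.
have cf := @esum_cvg R (fun i => ip f (gs i) ^+ 2) (fun i => sqr_ge0 _) fin.
move=> cn; rewrite -(cvgn_unique cf cn) fineK// ge0_fin_numE//.
by apply: esum_ge0 => i _; rewrite lee_fin sqr_ge0.
Qed.

End gram_schmidt.

(** * Hilbert-Schmidt forms of periodic operators *)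

Section hilbert_schmidt.
Context {R : realType} {H : hilbert R}.
Variables (e : nat -> H) (Q : H -> H).
Implicit Types (X Y Z : H -> H).

(* The squared norm of [X] on the range of the projection [Q]; [e] plays the
   role of an orthonormal basis of that range. *)
Definition hsn X : \bar R := (\esum_(a in [set: nat]) (nsq (X (e a)))%:E)%E.

(** Polarization of [hsn], so that identities between norms pass to pairings. For an idempotent [P]
    with adjoint [P'], the form at [P], [P'] is the trace of [P] compressed to the range of [Q]. *)
Definition hsform X Y : R := (fine (hsn (X \+ Y)) - fine (hsn (X \- Y))) / 4.

Lemma hsn_ge0 X : (0 <= hsn X)%E.
Proof. by apply: esum_ge0 => a _; rewrite lee_fin nsq_ge0. Qed.

Lemma hsn_fin X : (hsn X < +oo)%E -> hsn X \is a fin_num.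
Proof. by move=> h; rewrite ge0_fin_numE// hsn_ge0. Qed.

Lemma fine_hsn_ge0 X : 0 <= fine (hsn X).
Proof. by rewrite fine_ge0// hsn_ge0. Qed.

Lemma hsn_le X Y c : 0 <= c -> (forall a, nsq (X (e a)) <= c * nsq (Y (e a))) ->
  (hsn X <= c%:E * hsn Y)%E.
Proof.
move=> c0 h; rewrite /hsn -esumZl//; last by move=> i; rewrite lee_fin nsq_ge0.
by apply: le_esum => a _; rewrite -EFinM lee_fin.
Qed.

Lemma hsn_le_fin X Y c : 0 <= c -> (forall a, nsq (X (e a)) <= c * nsq (Y (e a))) ->
  (hsn Y < +oo)%E -> (hsn X < +oo)%E.
Proof.
move=> c0 h fY; apply: le_lt_trans (hsn_le c0 h) _.
by rewrite -(fineK (hsn_fin fY)) -EFinM ltry.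
Qed.

Lemma hsn_eq X Y : (forall a, nsq (X (e a)) = nsq (Y (e a))) -> hsn X = hsn Y.
Proof. by move=> h; apply: eq_esum => a _; rewrite h. Qed.

Lemma hsn_addfin X Y : (hsn X < +oo)%E -> (hsn Y < +oo)%E ->
  (hsn (X \+ Y)%R < +oo)%E.
Proof.
move=> fX fY; apply: (@le_lt_trans _ _ (2%:E * hsn X + 2%:E * hsn Y)%E).
  rewrite /hsn -!esumZl//; do ?by move=> i; rewrite lee_fin nsq_ge0.
  rewrite -esumD.
  - by apply: le_esum => a _; rewrite -!EFinM -EFinD lee_fin nsqD_le.
  - by move=> i _; rewrite -EFinM lee_fin mulr_ge0// nsq_ge0.
  - by move=> i _; rewrite -EFinM lee_fin mulr_ge0// nsq_ge0.
by rewrite -(fineK (hsn_fin fX)) -(fineK (hsn_fin fY)) -!EFinM -EFinD ltry.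
Qed.

Lemma hsn_opp X : hsn (\- X) = hsn X.
Proof. by apply: hsn_eq => a; rewrite /= nsqN. Qed.

Lemma hsform_cvg X Y : (hsn X < +oo)%E -> (hsn Y < +oo)%E ->
  (fun n => \sum_(a < n) ip (X (e a)) (Y (e a))) @ \oo --> hsform X Y.
Proof.
move=> fX fY.
have c1 := esum_cvg (fun a => nsq_ge0 _) (hsn_addfin fX fY).
have fY' : (hsn (\- Y)%R < +oo)%E by rewrite hsn_opp.
have c2 := esum_cvg (fun a => nsq_ge0 _) (hsn_addfin fX fY').

have : (fun n => ((\sum_(a < n) nsq ((X \+ Y) (e a))) -
    (\sum_(a < n) nsq ((X \+ (\- Y)) (e a)))) * 4^-1) @ \oo --> hsform X Y.
  by apply: cvgMr_tmp; apply: cvgB; [exact: c1|exact: c2].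
apply: cvg_trans; apply: near_eq_cvg; apply: nearW => n /=.
by rewrite -sumrB mulr_suml; apply: eq_bigr => a _; rewrite ip_polar.
Qed.

Lemma hsform_lin X Y X1 Y1 X2 Y2 (c1 c2 : R) :
  (hsn X < +oo)%E -> (hsn Y < +oo)%E -> (hsn X1 < +oo)%E -> (hsn Y1 < +oo)%E ->
  (hsn X2 < +oo)%E -> (hsn Y2 < +oo)%E ->
  (forall a, ip (X (e a)) (Y (e a)) =
     c1 * ip (X1 (e a)) (Y1 (e a)) + c2 * ip (X2 (e a)) (Y2 (e a))) ->
  hsform X Y = c1 * hsform X1 Y1 + c2 * hsform X2 Y2.
Proof.
move=> fX fY fX1 fY1 fX2 fY2 h.
have h0 := hsform_cvg fX fY; apply: (cvgn_unique h0).
have h1 := hsform_cvg fX1 fY1; have h2 := hsform_cvg fX2 fY2.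
have : (fun n => c1 * (\sum_(a < n) ip (X1 (e a)) (Y1 (e a))) +
    c2 * (\sum_(a < n) ip (X2 (e a)) (Y2 (e a)))) @ \oo -->
    c1 * hsform X1 Y1 + c2 * hsform X2 Y2.
  by apply: cvgD; apply: cvgMl_tmp.
apply: cvg_trans; apply: near_eq_cvg; apply: nearW => n /=.
by rewrite !mulr_sumr -big_split; apply: eq_bigr => a _.
Qed.

Lemma hsform_eq X Y X1 Y1 :
  (hsn X < +oo)%E -> (hsn Y < +oo)%E -> (hsn X1 < +oo)%E -> (hsn Y1 < +oo)%E ->
  (forall a, ip (X (e a)) (Y (e a)) = ip (X1 (e a)) (Y1 (e a))) ->
  hsform X Y = hsform X1 Y1.
Proof.
move=> fX fY fX1 fY1 h.
rewrite (@hsform_lin X Y X1 Y1 X1 Y1 1 0) ?mul1r ?mul0r ?addr0// => a.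
by rewrite h mul1r mul0r addr0.
Qed.

Lemma hsform_le X Y c : 0 < c -> (hsn X < +oo)%E -> (hsn Y < +oo)%E ->
  `|hsform X Y| <= c * fine (hsn X) + c^-1 * fine (hsn Y).
Proof.
move=> c0 fX fY.
have h : (fun n => `|\sum_(a < n) ip (X (e a)) (Y (e a))|) @ \oo --> `|hsform X Y|.
  by apply: cvg_norm; exact: hsform_cvg.
apply: (cvgr_to_le h); apply: nearW => n.
apply: le_trans (ler_norm_sum _ _ _) _.
apply: (@le_trans _ _ (\sum_(a < n) (c * nsq (X (e a)) + c^-1 * nsq (Y (e a))))).
  by apply: ler_sum => a _; exact: ip_amgm.
have p Z : (hsn Z < +oo)%E -> \sum_(a < n) nsq (Z (e a)) <= fine (hsn Z).
  move=> fZ; rewrite -lee_fin fineK ?hsn_fin//.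
  by apply: (@esum_partial_le R (fun a => nsq (Z (e a)))) => a; exact: nsq_ge0.
rewrite big_split/= -!mulr_sumr lerD// ler_wpM2l ?p// ?invr_ge0 ltW//.
Qed.

Section invariance.
Context {G : countZmodType} (T Zt : G -> H -> H).
Hypothesis parseval : forall f,
  (\esum_(i in [set: nat]) (ip f (e i) ^+ 2)%:E = (nsq (Q f))%:E)%E.
Hypothesis tiling : forall f,
  (\esum_(k in [set: G]) (nsq (Q (T k f)))%:E = (nsq f)%:E)%E.
Hypothesis Tadj : forall k, adj (T k) (T (- k)).
Hypothesis ZtD : forall k f g, Zt k (f + g) = Zt k f + Zt k g.
Hypothesis ZtQ : forall k f, nsq (Q (Zt k f)) = nsq (Q f).

(** Covariance under lattice translations up to [Zt k]. A character commutes with a translation only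
    up to a constant phase, which the [Q]-norm does not see. *)
Definition twisted X := forall k f, T k (X f) = Zt k (X (T k f)).

(* The trace property: the norms of [X] and of its adjoint over one cell agree,
   because translating the input cell amounts to translating the output cell. *)
Lemma hsn_adj X X' : adj X X' -> twisted X -> hsn X = hsn X'.
Proof.
move=> hX tX; rewrite /hsn.
transitivity (\esum_(a in [set: nat]) \esum_(k in [set: G])
    \esum_(b in [set: nat]) (ip (X (T k (e a))) (e b) ^+ 2)%:E)%E.
  apply: eq_esum => a _; rewrite -tiling; apply: eq_esum => k _.
  by rewrite tX ZtQ parseval.
transitivity (\esum_(b in [set: nat]) \esum_(k in [set: G])
    \esum_(a in [set: nat]) (ip (T (- k) (X' (e b))) (e a) ^+ 2)%:E)%E.
  transitivity (\esum_(a in [set: nat]) \esum_(b in [set: nat])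
      \esum_(k in [set: G]) (ip (X (T k (e a))) (e b) ^+ 2)%:E)%E.
    apply: eq_esum => a _; apply: esum_exchange => *.
    by rewrite lee_fin sqr_ge0.
  rewrite esum_exchange; last first.
    by move=> *; apply: esum_ge0 => *; rewrite lee_fin sqr_ge0.
  apply: eq_esum => b _; rewrite esum_exchange; last first.
    by move=> *; rewrite lee_fin sqr_ge0.
  by apply: eq_esum => k _; apply: eq_esum => a _; rewrite hX Tadj ipC.
apply: eq_esum => b _.
under eq_esum => k _ do rewrite parseval.
rewrite -tiling; apply/esym; rewrite (reindex_esum [set: G] setT (fun k => - k))//; split => //.
Qed.

(** Cyclicity tr(Y'X) = tr(XY'), obtained from [hsn_adj] for [X \+ Y] and [X \- Y]. *)
Lemma hsform_adj X X' Y Y' : adj X X' -> adj Y Y' -> twisted X -> twisted Y ->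
  hsform X Y = hsform Y' X'.
Proof.
move=> hX hY tX tY; rewrite /hsform.
have tD : twisted (X \+ Y) by move=> k f /=; rewrite (adjD (Tadj k)) tX tY ZtD.
have ZtB k f g : Zt k (f - g) = Zt k f - Zt k g.
  by apply/eqP; rewrite eq_sym subr_eq -ZtD subrK.
have tB : twisted (X \- Y) by move=> k f /=; rewrite (adjB (Tadj k)) tX tY ZtB.
rewrite (hsn_adj (adj_add hX hY) tD) (hsn_adj (adj_sub hX hY) tB).
congr ((fine _ - fine _) / _); apply: hsn_eq => a /=; first by rewrite addrC.
by rewrite -nsqN opprB.
Qed.

End invariance.

End hilbert_schmidt.

Lemma adj_iter {R : realType} {H : hilbert R} (X X' : H -> H) m :
  adj X X' -> adj (iter m X) (iter m X').
Proof.
move=> hX; elim: m => [//|m IH] f g.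
by rewrite iterS hX IH -iterSr.
Qed.

Lemma adj_commute {R : realType} {H : hilbert R} (U U' X X' : H -> H) :
  adj U U' -> adj X X' -> (forall f, U' (X f) = X (U' f)) ->
  forall f, U (X' f) = X' (U f).
Proof.
move=> hU hX UX f; apply: ip_ext => g.
by rewrite hU (adjC hX) -UX -hU -(adjC hX).
Qed.

(** * Traces of translated projections under modulation *)

Section modulation.
Context {R : realType} {H : hilbert R} {G : countZmodType}.
Variables (e : nat -> H) (Q : H -> H) (Tk Zk Zk' : G -> H -> H).
Variables (P P' M M' T T' T2 T2' : H -> H) (KP eps : R).
Hypothesis parseval : forall f,
  (\esum_(i in [set: nat]) (ip f (e i) ^+ 2)%:E = (nsq (Q f))%:E)%E.
Hypothesis tiling : forall f,
  (\esum_(k in [set: G]) (nsq (Q (Tk k f)))%:E = (nsq f)%:E)%E.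
Hypothesis Tkadj : forall k, adj (Tk k) (Tk (- k)).
Hypothesis Zkadj : forall k, adj (Zk k) (Zk' k).
Hypothesis ZkQ : forall k f, nsq (Q (Zk k f)) = nsq (Q f).
Hypothesis ZkK : forall k f, Zk k (Zk' k f) = f.
Hypothesis ZkK' : forall k f, Zk' k (Zk k f) = f.
Hypotheses (hP : adj P P') (hM : adj M M') (hT : adj T T') (hT2 : adj T2 T2').
Hypothesis PP : forall f, P (P f) = P f.
Hypothesis MK : forall f, M' (M f) = f.
Hypothesis MK' : forall f, M (M' f) = f.
Hypothesis TP : forall f, T (P f) = P (T f).
Hypothesis T2P : forall f, T2 (P f) = P (T2 f).
Hypothesis MT : forall f, M (T f) = T2 (M f).
Hypothesis Pb : forall f, nsq (P f) <= KP * nsq f.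
Hypothesis Tn : forall f, nsq (T f) = nsq f.
Hypothesis T2n : forall f, nsq (T2 f) = nsq f.
Hypothesis Mn : forall f, nsq (M f) = nsq f.
Hypothesis M'n : forall f, nsq (M' f) = nsq f.
Hypotheses (KP0 : 0 <= KP) (eps0 : 0 <= eps) (small : KP * eps < 1).
Hypothesis leak : forall f, nsq (M (P f) - P (M (P f))) <= eps * nsq (P f).
Hypothesis leak' : forall f, nsq (M' (P f) - P (M' (P f))) <= eps * nsq (P f).
Hypothesis TkP : forall k f, Tk k (P f) = P (Tk k f).
Hypothesis TkT : forall k f, Tk k (T f) = T (Tk k f).
Hypothesis TkM : forall k f, Tk k (M f) = Zk k (M (Tk k f)).
Hypothesis ZkP : forall k f, Zk k (P f) = P (Zk k f).
Hypothesis ZkM : forall k f, Zk k (M f) = M (Zk k f).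
Hypothesis ZkT : forall k f, Zk k (T f) = T (Zk k f).
Hypothesis finP : (hsn e P < +oo)%E.

(** [C] and [C'] compress [M] and its inverse to the range of [P]; [E] and [E'] measure how far
    [C' \o C] and [C \o C'] are from [P]. *)
Let C f := P (M (P f)).
Let C' f := P (M' (P f)).
Let E f := P (M' (M (P f) - P (M (P f)))).
Let E' f := P (M (M' (P f) - P (M' (P f)))).
Let hC : adj C (fun f => P' (M' (P' f))).
Proof. by move=> f g; rewrite /C hP hM hP. Qed.
Let hC' : adj C' (fun f => P' (M (P' f))).
Proof. by move=> f g; rewrite /C' hP (adjC hM) hP. Qed.
Let hE' : adj E' (fun f => P' (M (M' (P' f) - P' (M' (P' f))))).
Proof.
move=> f g; rewrite /E' hP hM ipBl (adjC hM) hP hP (adjC hM) hP.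
by rewrite -ipBr -(adjB (adjC hP)) -(adjB hM).
Qed.

Let PB f g : P (f - g) = P f - P g. Proof. exact: (adjB hP). Qed.
Let MB f g : M (f - g) = M f - M g. Proof. exact: (adjB hM). Qed.
Let M'B f g : M' (f - g) = M' f - M' g. Proof. exact: (adjB (adjC hM)). Qed.
Let TB f g : T (f - g) = T f - T g. Proof. exact: (adjB hT). Qed.
Let T2B f g : T2 (f - g) = T2 f - T2 g. Proof. exact: (adjB hT2). Qed.

Let C'C f : C' (C f) = P f - E f.
Proof. by rewrite /C' /C /E !PP M'B MK PB PP opprB addrC subrK. Qed.
Let CC' f : C (C' f) = P f - E' f.
Proof. by rewrite /C' /C /E' !PP MB MK' PB PP opprB addrC subrK. Qed.
Let PE f : P (E f) = E f. Proof. exact: PP. Qed.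
Let PE' f : P (E' f) = E' f. Proof. exact: PP. Qed.
Let EP f : E (P f) = E f. Proof. by rewrite /E PP. Qed.
Let E'P f : E' (P f) = E' f. Proof. by rewrite /E' PP. Qed.
Let CP f : C (P f) = C f. Proof. by rewrite /C PP. Qed.
Let PC f : P (C f) = C f. Proof. exact: PP. Qed.
Let C'P f : C' (P f) = C' f. Proof. by rewrite /C' PP. Qed.
Let PC' f : P (C' f) = C' f. Proof. exact: PP. Qed.

(** Bracket [C C' C] in the two possible ways. *)
Let CE f : C (E f) = E' (C f).
Proof.
have h : C (P f - E f) = P (C f) - E' (C f) by rewrite -C'C CC'.
move: h; rewrite (adjB hC) CP PC => /eqP.
by rewrite (inj_eq (addrI _)) eqr_opp => /eqP.
Qed.

Let CEm m f : C (iter m E f) = iter m E' (C f).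
Proof. by elim: m => // m IH; rewrite !iterS CE IH. Qed.

Let P_iter m f : P (iter m E f) = iter m E (P f).
Proof. by elim: m => // m IH; rewrite !iterS -IH PE EP. Qed.
Let P_iter' m f : P (iter m E' f) = iter m E' (P f).
Proof. by elim: m => // m IH; rewrite !iterS -IH PE' E'P. Qed.

Let E_le f : nsq (E f) <= (KP * eps) * nsq (P f).
Proof.
apply: le_trans (Pb _) _; rewrite M'n -mulrA.
by apply: ler_wpM2l => //; exact: leak.
Qed.
Let E'_le f : nsq (E' f) <= (KP * eps) * nsq (P f).
Proof.
apply: le_trans (Pb _) _; rewrite Mn -mulrA.
by apply: ler_wpM2l => //; exact: leak'.
Qed.

Let Em_le m f : nsq (iter m E (P f)) <= (KP * eps) ^+ m * nsq (P f).
Proof.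
elim: m => [|m IH]; first by rewrite expr0 mul1r.
rewrite iterS exprS -mulrA; apply: le_trans (E_le _) _.
by rewrite P_iter PP ler_wpM2l// mulr_ge0.
Qed.
Let E'm_le m f : nsq (iter m E' (P f)) <= (KP * eps) ^+ m * nsq (P f).
Proof.
elim: m => [|m IH]; first by rewrite expr0 mul1r.
rewrite iterS exprS -mulrA; apply: le_trans (E'_le _) _.
by rewrite P_iter' PP ler_wpM2l// mulr_ge0.
Qed.

(** [a m] and [a2 m] stand for the traces of [T E^m P] and [T2 E'^m P]; at [m = 0] they are the two
    traces to be compared. *)
Let a m := hsform e (fun f => T (iter m E (P f))) P'.
Let a2 m := hsform e (fun f => T2 (iter m E' (P f))) P'.

Let ke0 m : 0 <= (KP * eps) ^+ m. Proof. by rewrite exprn_ge0// mulr_ge0. Qed.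

Let finP' : (hsn e P' < +oo)%E.
Proof.
by rewrite -(@hsn_adj _ _ e Q G Tk (fun=> idfun) parseval tiling Tkadj (fun _ _ => erefl) P P').
Qed.

Let fin1 m : (hsn e (fun f => T (iter m E (P f))) < +oo)%E.
Proof. by apply: (hsn_le_fin (Y := P) (ke0 m) _ finP) => i; rewrite Tn Em_le. Qed.
Let fin2 m : (hsn e (fun f => T2 (iter m E' (P f))) < +oo)%E.
Proof. by apply: (hsn_le_fin (Y := P) (ke0 m) _ finP) => i; rewrite T2n E'm_le. Qed.

Let C_le f : nsq (C f) <= KP * nsq (P f).
Proof. by apply: le_trans (Pb _) _; rewrite Mn. Qed.
Let C'_le f : nsq (C' f) <= KP * nsq (P f).
Proof. by apply: le_trans (Pb _) _; rewrite M'n. Qed.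

(** With [Y = T C' E'^m], the intertwining relations give [Y C = T (P - E) E^m] and
    [C Y = T2 (P - E') E'^m]; cyclicity equates the traces of [Y C] and [C Y]. *)
Let step m : a m - a m.+1 = a2 m - a2 m.+1.
Proof.
pose Y f := T (C' (iter m E' f)).
pose F f := P' (M (M' (P' f) - P' (M' (P' f)))).
pose Y' f := iter m F (P' (M (P' (T' f)))).
have hY : adj Y Y'.
  by move=> f g; rewrite /Y hT hC' (adj_iter m hE').
have PY f : P (Y f) = Y f by rewrite /Y -TP PC'.
have YP f : Y (P f) = Y f by rewrite /Y -P_iter' C'P.
have P'B f g : P' (f - g) = P' f - P' g by exact: (adjB (adjC hP)).
have TkP' k f : Tk k (P' f) = P' (Tk k f) by exact: (adj_commute (Tkadj k) hP).
have TkT' k f : Tk k (T' f) = T' (Tk k f) by exact: (adj_commute (Tkadj k) hT).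
have inv X : (forall k f, Zk k (X f) = X (Zk k f)) ->
    forall k f, Zk' k (X f) = X (Zk' k f).
  by move=> h k f; rewrite -{1}(ZkK k f) -h ZkK'.
have dual X X' : adj X X' -> (forall k f, Zk k (X f) = X (Zk k f)) ->
    forall k f, Zk k (X' f) = X' (Zk k f).
  by move=> hX /inv h k; exact: (adj_commute (Zkadj k) hX (h k)).
have ZkP' := dual _ _ hP ZkP; have ZkT' := dual _ _ hT ZkT.
have ZkM' := dual _ _ hM ZkM.
have ZiP' := inv _ ZkP'; have ZiM := inv _ ZkM; have ZiM' := inv _ ZkM'.
have TkM' k f : Tk k (M' f) = Zk' k (M' (Tk k f)).
  by rewrite -{2}(MK' f) TkM -ZkM' ZkK' MK.
have ZkB k f g : Zk k (f - g) = Zk k f - Zk k g by exact: (adjB (Zkadj k)).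
have ZiB k f g : Zk' k (f - g) = Zk' k f - Zk' k g by exact: (adjB (adjC (Zkadj k))).
have tC : twisted Tk Zk C by move=> k f; rewrite /C TkP TkM -ZkP TkP.
have TkF k f : Tk k (F f) = F (Tk k f).
  rewrite /F TkP' TkM (adjB (Tkadj k)) !(TkP', TkM').
  by rewrite -ZiP' -ZiB -ZiM ZkK.
have ZkF k f : Zk k (F f) = F (Zk k f).
  by rewrite /F ZkP' ZkM ZkB !(ZkP', ZkM').
(* Both [C] and [Y'] contain [M] once more often than [M'], so they pick up the same phase, as
   [hsform_adj] requires. *)
have tY' : twisted Tk Zk Y'.
  have it k f : Tk k (iter m F f) = iter m F (Tk k f).
    by elim: (m) => // m' IH; rewrite !iterS TkF IH.
  have itZ k f : Zk k (iter m F f) = iter m F (Zk k f).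
    by elim: (m) => // m' IH; rewrite !iterS ZkF IH.
  move=> k f; rewrite /Y' itZ it; congr (iter m F _).
  by rewrite TkP' TkM TkP' TkT' ZkP'.
have cyc : hsform e C Y' = hsform e Y (fun f => P' (M' (P' f))).
  apply: (@hsform_adj _ _ e Q G Tk Zk parseval tiling Tkadj) => //.
    by move=> k; exact: (adjD (Zkadj k)).
  exact: adjC.
have Y_le f : nsq (Y f) <= KP * (KP * eps) ^+ m * nsq (P f).
  rewrite -YP /Y Tn -mulrA; apply: le_trans (C'_le _) _.
  by rewrite ler_wpM2l// P_iter' PP E'm_le.
have Y_le' f : nsq (Y f) <= KP * (KP * eps) ^+ m * (KP * nsq f).
  apply: le_trans (Y_le f) _; rewrite ler_wpM2l// mulr_ge0//.
have kk : 0 <= KP * (KP * eps) ^+ m by rewrite mulr_ge0.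
have finY : (hsn e Y < +oo)%E by exact: (hsn_le_fin kk (fun i => Y_le (e i)) finP).
have finC : (hsn e C < +oo)%E by exact: (hsn_le_fin KP0 (fun i => C_le (e i)) finP).
have finY' : (hsn e Y' < +oo)%E.
  by rewrite (@hsn_adj _ _ e Q G Tk Zk parseval tiling Tkadj ZkQ Y' Y)//; exact: adjC.
have finC' : (hsn e (fun f => P' (M' (P' f))) < +oo)%E.
  by rewrite -(@hsn_adj _ _ e Q G Tk Zk parseval tiling Tkadj ZkQ _ _ hC tC).
have kk' : 0 <= KP * (KP * eps) ^+ m * KP by rewrite mulr_ge0.
have finYC : (hsn e (fun f => Y (C f)) < +oo)%E.
  apply: (hsn_le_fin (Y := C) kk' _ finC) => i.
  by have := Y_le' (C (e i)); rewrite mulrA.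
have finCY : (hsn e (fun f => C (Y f)) < +oo)%E.
  by apply: (hsn_le_fin (Y := Y) KP0 _ finY) => i; rewrite -{2}PY; exact: C_le.
have L : hsform e (fun f => Y (C f)) P' = hsform e C Y'.
  by apply: hsform_eq => // i; rewrite -hP PY hY.
have RR : hsform e (fun f => C (Y f)) P' = hsform e Y (fun f => P' (M' (P' f))).
  by apply: hsform_eq => // i; rewrite -hP PC hC.
have La : hsform e (fun f => Y (C f)) P' = 1 * a m + -1 * a m.+1.
  apply: hsform_lin => // i.
  rewrite /Y -CEm C'C TB ipBl mul1r mulN1r P_iter; congr (_ - ip (T _) _).
  by rewrite -EP P_iter.
have Ra : hsform e (fun f => C (Y f)) P' = 1 * a2 m + -1 * a2 m.+1.
  apply: hsform_lin => // i.
  have -> : C (Y (e i)) = T2 (C (C' (iter m E' (e i)))).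
    by rewrite /Y /C -TP MT -T2P.
  rewrite CC' T2B ipBl mul1r mulN1r P_iter'; congr (_ - ip (T2 _) _).
  by rewrite -E'P P_iter'.
by move: La; rewrite L cyc -RR Ra !mul1r !mulN1r => ->.
Qed.

(** By [step] the difference [a m - a2 m] does not depend on [m], while each term is bounded by a
    geometric sequence plus an error that the free constant of [hsform_le] makes small. *)
Lemma hsform_modulation :
  hsform e (fun f => T (P f)) P' = hsform e (fun f => T2 (P f)) P'.
Proof.
have tel m : a 0 - a2 0 = a m - a2 m.
  by elim: m => // m ->; have := step m; lra.
apply/eqP; rewrite -subr_eq0 -normr_eq0 eq_le normr_ge0 andbT.
change (`|a 0 - a2 0| <= 0); set d := `|_|.
rewrite leNgt; apply/negP => d0.
set N := fine (hsn e P); set N' := fine (hsn e P').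
have N0 : 0 <= N := fine_hsn_ge0 _ _; have N'0 : 0 <= N' := fine_hsn_ge0 _ _.
(* Chosen so that the [P'] part of the bound stays below [d / 4]; a large [m] then does the same for
   the other part. *)
pose c := 4 * (N' + 1) / d.
have c0 : 0 < c by rewrite divr_gt0// mulr_gt0// ltr_wpDl.
have am m : `|a m| <= c * ((KP * eps) ^+ m * N) + c^-1 * N'.
  apply: le_trans (hsform_le c0 (fin1 m) finP') _; rewrite lerD2r ler_wpM2l ?(ltW c0)//.
  rewrite -lee_fin EFinM !fineK ?hsn_fin//.
  by apply: hsn_le => // i; rewrite Tn Em_le.
have a2m m : `|a2 m| <= c * ((KP * eps) ^+ m * N) + c^-1 * N'.
  apply: le_trans (hsform_le c0 (fin2 m) finP') _; rewrite lerD2r ler_wpM2l ?(ltW c0)//.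
  rewrite -lee_fin EFinM !fineK ?hsn_fin//.
  by apply: hsn_le => // i; rewrite T2n E'm_le.
have cN : c^-1 * N' < d / 4.
  rewrite /c invf_div -mulrA ltr_pM2l// ltr_pdivrMl ?mulr_gt0 ?ltr_wpDl//.
  by rewrite mulrC mulVKf// ltrDl || lra.
have ke1 : `|KP * eps| < 1 by rewrite ger0_norm// mulr_ge0.
have := cvg_expr ke1.
have N1 : 0 < N + 1 by rewrite ltr_wpDl.
have q0 : 0 < d / (4 * c * (N + 1)) by rewrite divr_gt0// mulr_gt0// mulr_gt0.
move=> /cvgrPdist_lt /(_ _ q0) [m _ hm].
have := hm m (leqnn m); rewrite /= sub0r normrN ger0_norm// => hk.
have cm : c * ((KP * eps) ^+ m * N) < d / 4.
  have : (KP * eps) ^+ m * (4 * c * (N + 1)) < d.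
    by rewrite -ltr_pdivlMr// mulr_gt0// mulr_gt0.
  have h0 := ke0 m.
  have : 0 <= c * (KP * eps) ^+ m by rewrite mulr_ge0// ltW.
  nra.
have := ler_normB (a m) (a2 m); rewrite -tel -/d.
have := am m; have := a2m m; lra.
Qed.

End modulation.

(** [P - U \o P] is small in Hilbert-Schmidt norm: finitely many [e a] are handled by [U] being
    close to the identity there, the others by the convergent tail of [hsn e P], on which the
    isometry [U] costs only a constant factor. *)
Lemma hsform_approx {R : realType} {H : hilbert R} (e : nat -> H) (P P' : H -> H) :
  (hsn e P < +oo)%E -> (hsn e P' < +oo)%E ->
  (forall n d, 0 < d -> exists U : H -> H, [/\ forall f, nsq (U f) = nsq f,
     forall a, (a < n)%N -> nsq (U (P (e a)) - P (e a)) <= d &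
     hsform e (fun f => U (P f)) P' = 0]) ->
  hsform e P P' = 0.
Proof.
move=> fP fP' hU; apply/eqP; rewrite -normr_eq0 eq_le normr_ge0 andbT.
rewrite leNgt; apply/negP; set t := `|_| => t0.
set N' := fine (hsn e P'); have N'0 : 0 <= N' := fine_hsn_ge0 _ _.
pose c := 4 * (N' + 1) / t.
have c0 : 0 < c by rewrite divr_gt0// mulr_gt0// ltr_wpDl.
have cN : c^-1 * N' < t / 4.
  have -> : c^-1 * N' = t / 4 * (N' / (N' + 1)).
    have tn : t != 0 by rewrite gt_eqF.
    have Nn : N' + 1 != 0 by rewrite gt_eqF// ltr_wpDl.
    by rewrite /c; field; rewrite ?tn ?Nn.
  rewrite -[ltRHS]mulr1 ltr_pM2l ?divr_gt0// ltr_pdivrMr ?ltr_wpDl//.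
  by rewrite mul1r ltrDl.
(* The 8 leaves room for the factor 4 in [nsq (x - U x) <= 4 * nsq x], so that the tail takes half
   of [t / (4 * c)]; the first [n] vectors share the other half. *)
have c20 : 0 < t / (4 * c) / 8 by rewrite divr_gt0// divr_gt0// mulr_gt0.
have cv := esum_cvg (fun a => nsq_ge0 (P (e a))) fP.
have /cvgrPdist_lt /(_ _ c20) [n _ hn] := cv.
have {}hn := hn n (leqnn n); rewrite /= -/(hsn e P) in hn.
have d0 : 0 < t / (4 * c) / 2 / n.+1%:R by rewrite divr_gt0// divr_gt0// divr_gt0// mulr_gt0.
have [U [Un Ua U0]] := hU n _ d0.
set D := fun f => P f - U (P f).
have Dle : (hsn e D <= (t / (4 * c))%:E)%E.
  apply: esum_le_partial => [i|m]; first exact: nsq_ge0.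
  rewrite lee_fin.
  apply: (@le_trans _ _ (\sum_(a < n + m) nsq (D (e a)))).
    rewrite -(big_mkord xpredT (fun a => nsq (D (e a)))).
    rewrite -[leRHS](big_mkord xpredT (fun a => nsq (D (e a)))).
    rewrite [leRHS](big_cat_nat _ (n := m))//= ?leq_addl// lerDl.
    by apply: sumr_ge0 => i _; exact: nsq_ge0.
  rewrite big_split_ord/=.
  have h1 : \sum_(a < n) nsq (D (e (lshift m a))) <= t / (4 * c) / 2.
    apply: (@le_trans _ _ (\sum_(a < n) t / (4 * c) / 2 / n.+1%:R)).
      by apply: ler_sum => a _; rewrite /D -nsqN opprB; exact: Ua (ltn_ord a).
    rewrite sumr_const card_ord -[leLHS]mulr_natr -[leLHS]mulrA -[leRHS]mulr1.
    apply: ler_wpM2l; last by rewrite ler_pdivrMl// mulr1 ler_nat.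
    by rewrite ltW// divr_gt0// divr_gt0// mulr_gt0.
  have h2 : \sum_(a < m) nsq (D (e (rshift n a))) <= 4 * (t / (4 * c) / 8).
    apply: (@le_trans _ _ (\sum_(a < m) 4 * nsq (P (e (rshift n a))))).
      apply: ler_sum => a _; apply: le_trans (nsqB_le _ _) _.
      by rewrite Un; lra.
    rewrite -mulr_sumr ler_pM2l//.
    apply: le_trans (ltW hn); apply: le_trans (ler_norm _).
    rewrite lerBrDl.
    have := @esum_partial_le R (fun a => nsq (P (e a))) (n + m) (fun a => nsq_ge0 _).
    by rewrite -/(hsn e P) -(fineK (hsn_fin fP)) lee_fin big_split_ord.
  lra.
have fD : (hsn e D < +oo)%E by apply: le_lt_trans Dle _; rewrite ltry.
have fU : (hsn e (fun f => U (P f)) < +oo)%E by rewrite (@hsn_eq _ _ e _ P).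
have DE : hsform e D P' = 1 * hsform e P P' + -1 * hsform e (fun f => U (P f)) P'.
  by apply: hsform_lin => // a; rewrite /D ipBl mul1r mulN1r.
move: DE; rewrite U0 mulr0 addr0 mul1r => DE.
have := hsform_le c0 fD fP'; rewrite DE -/t -/N'.
have : c * fine (hsn e D) <= c * (t / (4 * c)).
  by rewrite ler_pM2l// -lee_fin fineK// hsn_fin.
have -> : c * (t / (4 * c)) = t / 4 by field; rewrite gt_eqF.
lra.
Qed.

(** * Lebesgue measure on R^n *)

Section lebesgue_cV_theory.
Context {R : realType}.
Implicit Types (n : nat).

Local Notation mR := (measurableTypeR R).

Definition cV_box n (A : 'I_n -> set R) : set 'cV[R]_n :=
  [set x | forall i, A i (x i ord0)].

Lemma measurable_cV_box n (A : 'I_n -> set mR) :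
  (forall i, measurable (A i)) -> measurable (cV_box A).
Proof.
move=> mA; rewrite (_ : cV_box A = \bigcap_(i in [set: 'I_n])
    (@cV_coord R n i @^-1` A i)).
  apply: fin_bigcap_measurable => // i _.
  by rewrite -[X in measurable X]setTI; exact: measurable_cV_coord.
by apply/seteqP; split => x /= h i; have := h i => // /(_ I).
Qed.

Definition cV_boxes n : set (set 'cV[R]_n) :=
  [set B | exists A : 'I_n -> set mR, (forall i, measurable (A i)) /\ B = cV_box A].

Lemma cV_boxes_setI n : setI_closed (@cV_boxes n).
Proof.
move=> _ _ [A [mA ->]] [B [mB ->]]; exists (fun i => A i `&` B i); split.
  by move=> i; exact: measurableI.
apply/seteqP; split => x; first by case=> h1 h2 i; split; [exact: h1|exact: h2].
by move=> h; split => i; case: (h i).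
Qed.

Lemma measurable_cV_boxes n : @measurable _ 'cV[R]_n = <<s @cV_boxes n >>.
Proof.
apply/seteqP; split; last first.
  apply: smallest_sub; first exact: sigma_algebra_measurable.
  by move=> _ [A [mA ->]]; exact: measurable_cV_box.
apply: smallest_sub; first exact: smallest_sigma_algebra.
move=> X; rewrite -bigcup_seq => -[i _] [Y mY <-]; rewrite setTI.
apply: sub_sigma_algebra; exists (fun j => if j == i then Y else setT); split.
  by move=> j; case: ifP.
apply/seteqP; split => x /= h; last by have := h i; rewrite eqxx.
by move=> j; case: eqP => // ->.
Qed.

Definition cV_ball n (r : R) : set 'cV[R]_n := cV_box (fun=> `[- r, r]%classic).

Lemma measurable_cV_ball n r : measurable (@cV_ball n r).
Proof. by apply: measurable_cV_box => i; exact: measurable_itv. Qed.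

Lemma lebesgue_cV_ball n (r : R) : 0 <= r ->
  lebesgue_cV n (cV_ball r) = ((r + r) ^+ n)%:E.
Proof.
move=> r0; rewrite lebesgue_cV_box; last by move=> i; exact: measurable_itv.
under eq_bigr do rewrite lebesgue_measure_itv/= lte_fin.
have -> : (if - r < r then ((r)%:E - (- r)%:E)%E else 0%E) = (r + r)%:E.
  case: ltP => h; first by rewrite -EFinN opprK -EFinD.
  by rewrite (_ : r + r = 0)//; lra.
by rewrite -(big_morph EFin EFinM erefl) prodr_const card_ord.
Qed.

Lemma cV_ball_cover n : \bigcup_k (@cV_ball n k%:R) = setT.
Proof.
apply/seteqP; split => // x _.
pose m := \sum_i `|x i ord0|.
have [k hk] : exists k : nat, m <= k%:R.
  by exists (Num.truncn m).+1; exact/ltW/truncnS_gt.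
exists k => // i /=; rewrite in_itv/= -ler_norml.
apply: le_trans hk; rewrite /m (bigD1 i)//= lerDl.
by apply: sumr_ge0 => j _.
Qed.

(** Boxes form a generating pi-system, exhausted by cubes of finite measure. *)
Lemma measure_cV_unique n (m1 m2 : {measure set 'cV[R]_n -> \bar R}) :
  (forall A : 'I_n -> set mR, (forall i, measurable (A i)) ->
     m1 (cV_box A) = m2 (cV_box A)) ->
  (forall k : nat, (m1 (cV_ball k%:R) < +oo)%E) ->
  forall A, measurable A -> m1 A = m2 A.
Proof.
move=> h fin; apply: (@measure_unique _ R _ (@cV_boxes n) (fun k => cV_ball k%:R)) => //.
- exact: measurable_cV_boxes.
- exact: cV_boxes_setI.
- by move=> k; exists (fun=> `[- k%:R, k%:R]%classic); split => // i; exact: measurable_itv.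
- exact: cV_ball_cover.
- by move=> _ [A [mA ->]]; exact: h.
Qed.

Lemma measurable_funcV_add n :
  measurable_fun setT (fun p : 'cV[R]_n * 'cV[R]_n => p.1 + p.2).
Proof.
apply: measurable_fun_cVP => i.
rewrite [X in measurable_fun _ X](_ : _ = (cV_coord i \o fst) \+ (cV_coord i \o snd)).
  by apply: measurable_funD; apply: measurableT_comp => //; exact: measurable_cV_coord.
by apply/funext => p; rewrite /cV_coord /= mxE.
Qed.

Lemma measurable_cV_shift n (y : 'cV[R]_n) : measurable_fun setT (fun x : 'cV[R]_n => x + y).
Proof.
apply: measurable_fun_cVP => i.
rewrite [X in measurable_fun _ X](_ : _ = (fun x => cV_coord i x + y i ord0 : mR)).
  by apply: measurable_funD => //; exact: measurable_cV_coord.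
by apply/funext => p; rewrite /cV_coord /= mxE.
Qed.

Lemma measurable_cV_mulmx n (A : 'M[R]_n) : measurable_fun setT (fun x : 'cV[R]_n => A *m x).
Proof.
apply: measurable_fun_cVP => i.
rewrite [X in measurable_fun _ X](_ : _ = (fun x => \sum_j A i j * cV_coord j x)).
  apply: measurable_sum => j; apply: measurable_funM => //.
  exact: measurable_cV_coord.
by apply/funext => p; rewrite /cV_coord /= mxE.
Qed.

Lemma measurable_shiftR (y : R) : measurable_fun setT (fun x : mR => x + y : mR).
Proof. exact: measurable_funD. Qed.

Lemma lebesgue_measureD (y : R) (A : set R) : measurable A ->
  lebesgue_measure ((fun x => x + y) @^-1` A) = lebesgue_measure A.
Proof.
move=> mA.
have mf := measurable_shiftR y.
have := @lebesgue_measure_unique R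
  (measure_function_pushforward__canonical__measure_function_Measure
     (@lebesgue_measure R) mf) _ A mA.
move=> -> //= _ [[a b]] _ <-.
rewrite /pushforward (_ : (fun x => x + y) @^-1` _ = `]a - y, b - y]%classic).
  by rewrite !lebesgue_measure_itv/= !lte_fin ltrD2r -!EFinD opprB addrA subrK || idtac.
by apply/seteqP; split => x /=; rewrite !in_itv/= ltrBlDr lerBrDr.
Qed.

Lemma lebesgue_cV_shift n (y : 'cV[R]_n) (A : set 'cV[R]_n) : measurable A ->
  lebesgue_cV n ((fun x => x + y) @^-1` A) = lebesgue_cV n A.
Proof.
move=> mA.
pose nu := measure_function_pushforward__canonical__measure_function_Measure
  (lebesgue_cV n) (measurable_cV_shift y).
apply/esym; apply: (@measure_cV_unique n (lebesgue_cV n) nu) => // [B mB|k]; last first.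
  by rewrite lebesgue_cV_ball// ltry.
have -> : nu (cV_box B) = lebesgue_cV n (cV_box (fun i => (fun t => t + y i ord0) @^-1` B i)).
  congr (lebesgue_cV n _); apply/seteqP.
  by split => x /= h i; have := h i; rewrite mxE.
rewrite !lebesgue_cV_box//; last first.
  move=> i; rewrite -[X in measurable X]setTI.
  exact: measurable_shiftR.
by apply: eq_bigr => i _; rewrite lebesgue_measureD//; exact: mB.
Qed.

Lemma measurable_cV_sub n :
  measurable_fun setT (fun p : 'cV[R]_n * 'cV[R]_n => p.2 - p.1).
Proof.
apply: measurable_fun_cVP => i.
rewrite [X in measurable_fun _ X](_ : _ = (cV_coord i \o snd) \- (cV_coord i \o fst)).
  by apply: measurable_funB; apply: measurableT_comp => //; exact: measurable_cV_coord.
by apply/funext => p; rewrite /cV_coord /= !mxE.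
Qed.

Lemma cV_ball_sigma_finite n (nu : {measure set 'cV[R]_n -> \bar R}) :
  (forall k : nat, (nu (cV_ball k%:R) < +oo)%E) -> sigma_finite setT nu.
Proof.
move=> fin; exists (fun k => cV_ball k%:R); first by rewrite cV_ball_cover.
by move=> k; split => //; exact: measurable_cV_ball.
Qed.

Lemma tonelli_sigma_finite d1 d2 (T1 : measurableType d1) (T2 : measurableType d2)
    (m1 : {measure set T1 -> \bar R}) (m2 : {measure set T2 -> \bar R})
    (f : T1 * T2 -> \bar R) :
  sigma_finite setT m1 -> sigma_finite setT m2 ->
  measurable_fun setT f -> (forall p, 0 <= f p)%E ->
  (\int[m1]_x \int[m2]_y f (x, y) = \int[m2]_y \int[m1]_x f (x, y))%E.
Proof.
move=> s1 s2.
pose a1 := @isSigmaFinite.Build _ _ _ m1 s1.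
pose a2 := @isSFinite.Build _ _ _ m1 (sfinite_measure_sigma_finite s1).
pose b1 := @isSigmaFinite.Build _ _ _ m2 s2.
pose b2 := @isSFinite.Build _ _ _ m2 (sfinite_measure_sigma_finite s2).
pose n1 : {sigma_finite_measure set T1 -> \bar R} := HB.pack (Measure.sort m1) a1 a2.
pose n2 : {sigma_finite_measure set T2 -> \bar R} := HB.pack (Measure.sort m2) b1 b2.
exact: (@fubini_tonelli _ _ _ _ R n1 n2 f).
Qed.

(** Both sides equal the double integral of [\1_E (x + y) * \1_F y] with [F = cV_ball 1]: either
    integrate in [x] first, or substitute [y - x] for [y] and use the symmetry [F = - F]. *)
Lemma haar_unique n (nu : {measure set 'cV[R]_n -> \bar R}) :
  (forall (y : 'cV[R]_n) E, measurable E -> nu ((fun x => x + y) @^-1` E) = nu E) ->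
  (forall k : nat, (nu (cV_ball k%:R) < +oo)%E) ->
  forall E, measurable E ->
  (lebesgue_cV n E * nu (cV_ball 1) = nu E * lebesgue_cV n (cV_ball 1))%E.
Proof.
move=> nuT nufin E mE; set F := cV_ball 1.
have mF : measurable F := measurable_cV_ball _.
have FN (x : 'cV[R]_n) : F (- x) = F x.
  by apply/propext; split=> h i; have := h i; rewrite /= !in_itv/= mxE -!ler_norml normrN.
have lsig : sigma_finite setT (@lebesgue_cV R n).
  by apply: cV_ball_sigma_finite => k; rewrite lebesgue_cV_ball// ltry.
have nsig := cV_ball_sigma_finite nufin.
have mS : measurable_fun setT (fun p : 'cV[R]_n * 'cV[R]_n => p.1 + p.2) :=
  @measurable_funcV_add n.
have mB := @measurable_cV_sub n.
have mf A B h : measurable A -> measurable B ->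
    measurable_fun setT (h : 'cV[R]_n * 'cV[R]_n -> 'cV[R]_n) ->
    measurable_fun setT (fun p => (\1_A (h p) * \1_B p.2)%:E : \bar R).
  move=> mA mB' mh; apply/measurable_EFinP; apply: measurable_funM.
    by apply: measurableT_comp => //; exact: measurable_indic.
  by apply: measurableT_comp => //; exact: measurable_indic.
have f0 (a b : set 'cV[R]_n) x y : (0 <= (\1_a x * \1_b y)%:E :> \bar R)%E.
  by rewrite lee_fin mulr_ge0.
have I1 := tonelli_sigma_finite lsig nsig (mf E F _ mE mF mS) (fun=> f0 _ _ _ _).
have I2 := tonelli_sigma_finite lsig nsig (mf F E _ mF mE mB) (fun=> f0 _ _ _ _).
have cst (m : {measure set 'cV[R]_n -> \bar R}) A b : measurable A ->
    (\int[m]_x (\1_A x * (nat_of_bool b)%:R)%:E = m A * (nat_of_bool b)%:R%:E)%E.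
  move=> mA; case: b; last by under eq_integral do rewrite mulr0; rewrite integral0 mule0.
  under eq_integral do rewrite mulr1.
  by rewrite integral_indic// setIT mule1.
have mi A : measurable A -> measurable_fun setT (fun y : 'cV[R]_n => (\1_A y)%:E : \bar R).
  by move=> mA; apply/measurable_EFinP; exact: measurable_indic.
have i0 A (y : 'cV[R]_n) : setT y -> (0 <= (\1_A y)%:E :> \bar R)%E.
  by move=> _; rewrite lee_fin.
have L1 : (\int[nu]_y \int[lebesgue_cV n]_x (\1_E (x + y) * \1_F y)%:E =
    lebesgue_cV n E * nu F)%E.
  rewrite -[in RHS](setIT F) -[in RHS](integral_indic nu measurableT mF).
  rewrite -(ge0_integralZl nu measurableT (mi F mF) (i0 F) (measure_ge0 _ _)).
  apply: eq_integral => y _; rewrite indicE.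
  rewrite (cst (lebesgue_cV n) ((fun x => x + y) @^-1` E)) ?lebesgue_cV_shift//.
  by rewrite -[X in measurable X]setTI; exact: measurable_cV_shift.
have L2 : (\int[nu]_y \int[lebesgue_cV n]_x (\1_F (y - x) * \1_E y)%:E =
    lebesgue_cV n F * nu E)%E.
  rewrite -[in RHS](setIT E) -[in RHS](integral_indic nu measurableT mE).
  rewrite -(ge0_integralZl nu measurableT (mi E mE) (i0 E) (measure_ge0 _ _)).
  apply: eq_integral => y _; rewrite indicE.
  have e : [set x | F (y - x)] = (fun x => x + (- y)) @^-1` F.
    by apply/seteqP; split => x /=; rewrite -FN opprB.
  rewrite (cst (lebesgue_cV n) [set x | F (y - x)]) e ?lebesgue_cV_shift//.
  by rewrite -[X in measurable X]setTI; exact: measurable_cV_shift.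
rewrite -L1 muleC -L2; transitivity (\int[lebesgue_cV n]_x \int[nu]_y (\1_E (x + y) * \1_F y)%:E)%E.
  exact: esym I1.
apply: etrans I2; apply: eq_integral => x _.
have sh A B : measurable A -> measurable B ->
    (\int[nu]_y (\1_A y * \1_B y)%:E = nu (A `&` B))%E.
  move=> mA mB'; transitivity (\int[nu]_y (\1_(A `&` B) y)%:E)%E.
    by apply: eq_integral => y _; rewrite indicI.
  by rewrite integral_indic ?setIT//; exact: measurableI.
have mp (y : 'cV[R]_n) A : measurable A -> measurable ((fun x => x + y) @^-1` A).
  by move=> mA; rewrite -[X in measurable X]setTI; exact: measurable_cV_shift.
transitivity (nu ((fun y => y + x) @^-1` E `&` F)).
  rewrite -sh//; last exact: mp.
  by apply: eq_integral => y _; rewrite !indicE/= addrC.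
rewrite -(nuT (- x)); last by apply: measurableI => //; exact: mp.
transitivity (nu ((fun y => y + (- x)) @^-1` F `&` E)).
  by congr (nu _); apply/seteqP; split => y /= [h1 h2]; split => //;
    move: h1 h2; rewrite ?subrK.
by rewrite -sh//; exact: mp.
Qed.

Lemma ge0_integral_cV_shift n (y : 'cV[R]_n) (f : 'cV[R]_n -> \bar R) :
  measurable_fun setT f -> (forall x, 0 <= f x)%E ->
  (\int[lebesgue_cV n]_x f (x + y)%R = \int[lebesgue_cV n]_x f x)%E.
Proof.
move=> mf f0; have mT := measurable_cV_shift y.
have := @ge0_integral_pushforward _ _ _ _ R _ mT (lebesgue_cV n) setT f measurableT mf
  (fun x _ => f0 x).
rewrite preimage_setT => <-.
by apply: eq_measure_integral => /= A mA _; exact: lebesgue_cV_shift.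
Qed.

(** The transported measure is translation invariant and locally finite, so [haar_unique] makes it a
    multiple of Lebesgue measure. The factor stays unidentified here; [biorthogonal_scales_volume]
    determines it. *)
Lemma lebesgue_cV_mulmx n (B : 'M[R]_n) : B \in unitmx ->
  exists2 c : R, 0 <= c & forall E, measurable E ->
    lebesgue_cV n ((fun x => B *m x) @^-1` E) = (c%:E * lebesgue_cV n E)%E.
Proof.
move=> uB; have mB := measurable_cV_mulmx B.
pose nu := measure_function_pushforward__canonical__measure_function_Measure
  (lebesgue_cV n) mB.
have mp E : measurable E -> measurable ((fun x => B *m x) @^-1` E).
  by move=> mE; rewrite -[X in measurable X]setTI; exact: measurable_cV_mulmx.
have fin (k : nat) : (nu (cV_ball k%:R) < +oo)%E.
  (* The preimage of a ball under [B] lies in a ball whose radius is read off from the entries of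
     [invmx B]. *)
  pose K : R := \sum_i \sum_j `|invmx B i j| * k%:R.
  have K0 : 0 <= K by apply: sumr_ge0 => i _; apply: sumr_ge0 => j _; rewrite mulr_ge0.
  apply: (@le_lt_trans _ _ (lebesgue_cV n (cV_ball K))); last first.
    by rewrite lebesgue_cV_ball// ltry.
  change (lebesgue_cV n ((fun x => B *m x) @^-1` cV_ball k%:R) <= lebesgue_cV n (cV_ball K))%E.
  apply: le_measure.
  - exact: mem_set (mp _ (measurable_cV_ball _)).
  - exact: mem_set (measurable_cV_ball _).
  move=> x /= h i; rewrite /= in_itv/= -ler_norml.
  rewrite -[x](mulKmx uB) mxE (le_trans (ler_norm_sum _ _ _))//.
  apply: (@le_trans _ _ (\sum_j `|invmx B i j| * k%:R)); last first.
    rewrite /K [leRHS](bigD1 i)//= lerDl.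
    by apply: sumr_ge0 => i' _; apply: sumr_ge0 => j _; rewrite mulr_ge0.
  apply: ler_sum => j _; rewrite normrM ler_wpM2l//.
  by have := h j; rewrite /= in_itv/= -ler_norml.
have shift (y : 'cV[R]_n) E : measurable E -> nu ((fun x => x + y) @^-1` E) = nu E.
  move=> mE; rewrite -[RHS](@lebesgue_cV_shift n (invmx B *m y)); last exact: mp.
  congr (lebesgue_cV n _); apply/seteqP.
  by split => x /=; rewrite mulmxDr mulKVmx.
have h := haar_unique shift fin.
have := fin 1%N; set t := nu _ => tfin.
have t0 : (0 <= t)%E by exact: measure_ge0.
have tf : t \is a fin_num by rewrite ge0_fin_numE.
exists (fine t / (1 + 1) ^+ n); first by rewrite divr_ge0// ?fine_ge0// exprn_ge0.
move=> E mE; have := h E mE; rewrite lebesgue_cV_ball// -/t.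
have d0 : (1 + 1 : R) ^+ n != 0 by rewrite gt_eqF// exprn_gt0.
move=> e; change (nu E = ((fine t / (1 + 1) ^+ n)%:E * lebesgue_cV n E)%E).
have {1}-> : nu E = (nu E * (((1 + 1) ^+ n)%:E * ((1 + 1) ^+ n)^-1%:E))%E.
  by rewrite -EFinM divff// mule1.
by rewrite muleA -e [in RHS]EFinM (fineK tf) [RHS]muleC muleA.
Qed.

Lemma ge0_integral_cV_mulmx n (B : 'M[R]_n) (c : R) : 0 <= c ->
  (forall E, measurable E ->
    lebesgue_cV n ((fun x => B *m x) @^-1` E) = (c%:E * lebesgue_cV n E)%E) ->
  forall f : 'cV[R]_n -> \bar R, measurable_fun setT f -> (forall x, 0 <= f x)%E ->
  (\int[lebesgue_cV n]_x f (B *m x) = c%:E * \int[lebesgue_cV n]_x f x)%E.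
Proof.
move=> c0 h f mf f0; have mB := measurable_cV_mulmx B.
have := @ge0_integral_pushforward _ _ _ _ R _ mB (lebesgue_cV n) setT f measurableT mf
  (fun x _ => f0 x).
rewrite preimage_setT => <-.
have := @ge0_integral_mscale _ _ R (lebesgue_cV n) setT measurableT (NngNum c0) f mf
  (fun x _ => f0 x).
move=> <-.
by apply: eq_measure_integral => /= A mA _; exact: h.
Qed.

End lebesgue_cV_theory.

(** * The Hilbert space L^2(R^n) *)

Section real_L2_complete.
Context d (T : measurableType d) {R : realType} (mu : {measure set T -> \bar R}).
Implicit Types (f g : T -> R).

Lemma integral_sqrD_le f g : measurable_fun setT f -> measurable_fun setT g ->
  (\int[mu]_x ((f x + g x) ^+ 2)%:E <=
   2%:E * \int[mu]_x (f x ^+ 2)%:E + 2%:E * \int[mu]_x (g x ^+ 2)%:E)%E.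
Proof.
move=> mf mg.
have mf2 : measurable_fun setT (fun x => (f x ^+ 2)%:E : \bar R).
  by apply/measurable_EFinP; exact: measurable_funX.
have mg2 : measurable_fun setT (fun x => (g x ^+ 2)%:E : \bar R).
  by apply/measurable_EFinP; exact: measurable_funX.
have p0 (h : T -> R) x : setT x -> (0 <= (h x ^+ 2)%:E :> \bar R)%E.
  by move=> _; rewrite lee_fin sqr_ge0.
rewrite -(ge0_integralZl mu measurableT mf2 (p0 f))// -(ge0_integralZl mu measurableT mg2 (p0 g))//.
rewrite -ge0_integralD//.
- apply: ge0_le_integral => //.
  + by move=> x _; rewrite lee_fin sqr_ge0.
  + by apply/measurable_EFinP; apply: measurable_funX; exact: measurable_funD.
  + by apply: emeasurable_funD; apply: measurable_funeM.
  + by move=> x _; rewrite -!EFinM -EFinD lee_fin; have := sqr_ge0 (f x - g x); nra.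
- by move=> x _; rewrite -EFinM lee_fin mulr_ge0// sqr_ge0.
- exact: measurable_funeM.
- by move=> x _; rewrite -EFinM lee_fin mulr_ge0// sqr_ge0.
- exact: measurable_funeM.
Qed.

(** Riesz-Fischer. The weights [4 ^+ j] in the series [G] turn its finiteness at a point into a
    geometric bound on the increments there, while the rate [8^-1 ^+ j] keeps [G] integrable. *)
Lemma real_L2_complete (f : nat -> T -> R) : (forall n, measurable_fun setT (f n)) ->
  (forall e : R, 0 < e -> exists N, forall m n, (N <= m)%N -> (N <= n)%N ->
     (\int[mu]_x ((f m x - f n x) ^+ 2)%:E < e%:E)%E) ->
  exists g, measurable_fun setT g /\ forall e : R, 0 < e -> exists N, forall n,
    (N <= n)%N -> (\int[mu]_x ((f n x - g x) ^+ 2)%:E < e%:E)%E.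
Proof.
move=> mf cau.
have /choice [N hN] : forall j : nat, exists N, forall m n, (N <= m)%N -> (N <= n)%N ->
     (\int[mu]_x ((f m x - f n x) ^+ 2)%:E < ((8^-1) ^+ j)%:E)%E.
  by move=> j; apply: cau; rewrite exprn_gt0// invr_gt0.
(* Partial sums of [N] are nondecreasing and at least [N j] at step [j]. *)
pose phi j := (\sum_(i < j.+1) N i)%N.
have phiN j : (N j <= phi j)%N by rewrite /phi big_ord_recr/= leq_addl.
have phiS j : (phi j <= phi j.+1)%N by rewrite /phi [leqRHS]big_ord_recr/= leq_addr.
pose h j := f (phi j).
pose a j x : R := 4 ^+ j * (h j.+1 x - h j x) ^+ 2.
have a0 j x : 0 <= a j x by rewrite mulr_ge0// sqr_ge0.
have ma j : measurable_fun setT (fun x => (a j x)%:E : \bar R).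
  apply/measurable_EFinP; apply: measurable_funM => //; apply: measurable_funX.
  by apply: measurable_funB; exact: mf.
pose G x := (\sum_(j <oo) (a j x)%:E)%E.
have G0 x : (0 <= G x)%E by apply: nneseries_ge0 => j _ _; rewrite lee_fin.
have mG : measurable_fun setT G.
  by apply: ge0_emeasurable_sum => // j x _ _; rewrite lee_fin.
have iG : (\int[mu]_x G x <= 2%:E)%E.
  rewrite integral_nneseries//; last by move=> j x _; rewrite lee_fin.
  apply: lime_le; first by apply: is_cvg_nneseries => j _ _; apply: integral_ge0 => x _; rewrite lee_fin; exact: a0.
  apply: nearW => n.
  apply: (@le_trans _ _ (2 - 2 * 2^-1 ^+ n)%:E); last first.
    by rewrite lee_fin gerBl mulr_ge0// exprn_ge0// invr_ge0.
  elim: n => [|j IH]; first by rewrite big_geq// expr0 mulr1 subrr.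
  rewrite big_nat_recr//=.
  have -> : ((2 - 2 * 2^-1 ^+ j.+1)%:E = (2 - 2 * 2^-1 ^+ j)%:E + (2^-1 ^+ j)%:E :> \bar R)%E.
    by rewrite -EFinD exprS; congr (_%:E); field.
  apply: leeD => //.
  rewrite /a; under eq_integral do rewrite EFinM.
  rewrite ge0_integralZl//; last 2 first.
  - by apply/measurable_EFinP; apply: measurable_funX; apply: measurable_funB; exact: mf.
  - by move=> x _; rewrite lee_fin sqr_ge0.
  apply: (@le_trans _ _ ((4 ^+ j)%:E * ((8^-1) ^+ j)%:E)%E).
    apply: lee_wpmul2l; first by rewrite lee_fin.
    apply: ltW; apply: hN; first exact: leq_trans (phiN j) (phiS j).
    exact: phiN.
  rewrite -EFinM -exprMn lee_fin (_ : 4 * 8^-1 = 2^-1 :> R)//.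
  by field.
(* Each increment is at most [2^-1 ^+ j * s], with [s] the square root of [G x]; summing the
   geometric series doubles this, and squaring gives the factor 4. *)
have key x i k : (i <= k)%N -> G x \is a fin_num ->
    (h k x - h i x) ^+ 2 <= 4 * (4^-1) ^+ i * fine (G x).
  move=> ik Gf; set s := Num.sqrt (fine (G x)).
  have s0 : 0 <= s := sqrtr_ge0 _.
  have s2 : s ^+ 2 = fine (G x) by rewrite sqr_sqrtr// fine_ge0.
  have dj j : `|h j.+1 x - h j x| <= (2^-1) ^+ j * s.
    rewrite -(ler_pXn2r (n := 2))// ?nnegrE ?mulr_ge0// ?exprn_ge0 ?invr_ge0//.
    rewrite real_normK ?num_real// exprMn s2 -lee_fin [leRHS]EFinM (fineK Gf).
    have -> : ((2^-1 : R) ^+ j) ^+ 2 = (4 ^+ j)^-1.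
      by rewrite -exprVn -exprM mulnC exprM; congr (_ ^+ _); field.
    rewrite -(fineK Gf) -EFinM lee_fin ler_pdivlMl ?exprn_gt0//.
    rewrite -lee_fin (fineK Gf) /G nneseries_esumT; last first.
      by move=> i'; rewrite lee_fin; exact: a0.
    apply: esum_ge; exists [set j]; first by split => //; exact: finite_set1.
    by rewrite fsbig_set1.
  have tel m : `|h (i + m)%N x - h i x| <= 2 * ((2^-1) ^+ i - (2^-1) ^+ (i + m)) * s.
    elim: m => [|m IH]; first by rewrite addn0 !subrr normr0 mulr0 mul0r.
    rewrite addnS; have := ler_normD (h (i + m).+1 x - h (i + m)%N x) (h (i + m)%N x - h i x).
    rewrite addrA subrK => /le_trans; apply.
    have := dj (i + m)%N; rewrite [(2^-1) ^+ (i + m).+1]exprS.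
    set p := (2^-1) ^+ (i + m); set q := (2^-1) ^+ i in IH *.
    have -> : 2 * (q - 2^-1 * p) * s = p * s + 2 * (q - p) * s by field.
    by move=> dj'; exact: lerD.
  rewrite -(subnKC ik); have := tel (k - i)%N; set v := h _ x - h i x => hv.
  have {}hv : `|v| <= 2 * (2^-1) ^+ i * s.
    apply: le_trans hv _; rewrite ler_wpM2r// ler_wpM2l// gerBl.
    by rewrite exprn_ge0// invr_ge0.
  rewrite -(real_normK (num_real v)).
  have -> : 4 * (4^-1) ^+ i * fine (G x) = (2 * (2^-1) ^+ i * s) ^+ 2.
    rewrite !exprMn s2 -exprM mulnC exprM; congr (_ * _ ^+ _ * _); first by ring.
    by rewrite exprVn -natrX.
  by rewrite ler_pXn2r// nnegrE// !mulr_ge0// exprn_ge0// invr_ge0.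
have cb x : G x \is a fin_num -> forall e, 0 < e -> exists i : nat,
    4 * (4^-1) ^+ i * fine (G x) < e.
  move=> Gf e e0.
  have l1 : `|(4^-1 : R)| < 1 by rewrite ger0_norm ?invr_ge0// invf_lt1// ltr1n.
  have fg : 0 <= fine (G x) by rewrite fine_ge0.
  have d0 : 0 < e / (4 * (fine (G x) + 1)) by rewrite divr_gt0// mulr_gt0// ltr_wpDl.
  have /cvgrPdist_lt /(_ _ d0) [i _ hi] := cvg_expr l1.
  exists i; have := hi i (leqnn i).
  rewrite /= sub0r normrN ger0_norm ?exprn_ge0 ?invr_ge0// ltr_pdivlMr; last first.
    by rewrite mulr_gt0// ltr_wpDl.
  have p0 : 0 <= (4^-1 : R) ^+ i by rewrite exprn_ge0 ?invr_ge0.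
  by apply: le_lt_trans; nra.
pose E := [set x | (G x < +oo)%E].
have mE : measurable E.
  by rewrite -[E]setTI; exact: emeasurable_fun_infty_o.
pose h' k x := h k x * \1_E x.
have cvh x : cvgn (fun k => h' k x).
  rewrite /h' indicE; case: (boolP (x \in E)) => [xE|_] /=; last first.
    by under eq_fun do rewrite mulr0; exact: is_cvg_cst.
  under eq_fun do rewrite mulr1.
  have Gf : G x \is a fin_num by rewrite ge0_fin_numE//; move: xE; rewrite inE.
  apply: cauchy_cvg; apply: cauchy_exP => e e0.
  have [i hi] := cb x Gf (e ^+ 2) (exprn_gt0 2 e0).
  exists (h i x); exists i => // k /= ik.
  rewrite /ball/= -(ltr_pXn2r (n := 2))// ?nnegrE ?(ltW e0)// distrC real_normK ?num_real//.
  by apply: le_lt_trans hi; exact: key.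
pose g x := limn (fun k => h' k x).
have mg : measurable_fun setT g.
  have mh' k : measurable_fun setT (h' k).
    by apply: measurable_funM; [exact: mf|exact: measurable_indic].
  apply: (measurable_fun_cvg mh') => x _.
  exact: (cvh x).
(* Where [G x] is infinite the right-hand side is [+oo], so no null set has to be removed. *)
have hg i x : (((h i x - g x) ^+ 2)%:E <= (4 * (4^-1) ^+ i)%:E * G x)%E.
  have [Gf|Gi] := boolP (G x \is a fin_num); last first.
    have -> : G x = +oo%E by move: Gi; rewrite ge0_fin_numE// -leNgt leye_eq => /eqP.
    by rewrite gt0_muley ?leey// lte_fin mulr_gt0// exprn_gt0// invr_gt0.
  rewrite -(fineK Gf) -EFinM lee_fin.
  have xE : x \in E by rewrite inE /E/= -ge0_fin_numE.
  have cg : (fun k => (h k x - h i x) ^+ 2) @ \oo --> (g x - h i x) ^+ 2.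
    have e : (fun k => h k x) = (fun k => h' k x).
      by apply/funext => k; rewrite /h' indicE xE mulr1.
    have c1 : (fun k => h k x) @ \oo --> g x by rewrite e; exact: cvh.
    have c2 : (fun k => h k x - h i x) @ \oo --> g x - h i x by apply: cvgB => //; exact: cvg_cst.
    by under eq_fun do rewrite expr2; rewrite expr2; exact: cvgM.
  rewrite -sqrrN opprB; apply: (cvgr_to_le cg); exists i => // k /= ik.
  exact: key.
exists g; split => // e e0.
have ihg i : (\int[mu]_x ((h i x - g x) ^+ 2)%:E <= (8 * (4^-1) ^+ i)%:E)%E.
  apply: (@le_trans _ _ (\int[mu]_x ((4 * (4^-1) ^+ i)%:E * G x))%E).
    apply: ge0_le_integral => //.
    - by move=> x _; rewrite lee_fin sqr_ge0.
    - by apply/measurable_EFinP; apply: measurable_funX; apply: measurable_funB => //; exact: mf.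
    - exact: measurable_funeM.
  rewrite ge0_integralZl//.
  have -> : 8 * (4^-1) ^+ i = 4 * (4^-1) ^+ i * 2 :> R by ring.
  by rewrite [leRHS]EFinM; apply: lee_wpmul2l => //; rewrite lee_fin mulr_ge0// exprn_ge0// invr_ge0.
have l1 : `|(4^-1 : R)| < 1 by rewrite ger0_norm ?invr_ge0// invf_lt1// ltr1n.
(* The final bound [2 * 8^-1 ^+ i + 16 * 4^-1 ^+ i] is at most [18 * 4^-1 ^+ i]. *)
have d0 : 0 < e / 36 by rewrite divr_gt0.
have /cvgrPdist_lt /(_ _ d0) [i _ hi] := cvg_expr l1.
have := hi i (leqnn i); rewrite /= sub0r normrN ger0_norm ?exprn_ge0 ?invr_ge0// => {}hi.
exists (phi i) => n pn.
have -> : (fun x => ((f n x - g x) ^+ 2)%:E) =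
    (fun x => (((f n x - h i x) + (h i x - g x)) ^+ 2)%:E : \bar R).
  by apply/funext => x; rewrite addrA subrK.
apply: le_lt_trans (integral_sqrD_le _ _) _.
- by apply: measurable_funB; exact: mf.
- by apply: measurable_funB => //; exact: mf.
have b1 := hN i n (phi i) (leq_trans (phiN i) pn) (phiN i).
apply: (@le_lt_trans _ _ (2%:E * ((8^-1) ^+ i)%:E + 2%:E * (8 * (4^-1) ^+ i)%:E)%E).
  by apply: leeD; apply: lee_wpmul2l; rewrite ?lee_fin//; exact: ltW.
rewrite -!EFinM -EFinD lte_fin.
have : (8^-1 : R) ^+ i <= (4^-1) ^+ i.
  by apply: lerXn2r; rewrite ?nnegrE ?invr_ge0// lef_pV2 ?posrE// ler_nat.
lra.
Qed.

End real_L2_complete.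

(** * Square-integrable complex functions *)

Section complex_parts.
Context {R : realType}.
Implicit Types z w : R[i].

(** The squared modulus as a polynomial, free of the square root in [Normc.normc]. *)
Definition csq z : R := complex.Re z ^+ 2 + complex.Im z ^+ 2.

Lemma csqE z : Normc.normc z ^+ 2 = csq z.
Proof. by case: z => a b; rewrite /= sqr_sqrtr// addr_ge0// sqr_ge0. Qed.

Lemma csq_ge0 z : 0 <= csq z. Proof. by rewrite addr_ge0// sqr_ge0. Qed.

Lemma reD z w : complex.Re (z + w) = complex.Re z + complex.Re w.
Proof. by case: z; case: w. Qed.
Lemma imD z w : complex.Im (z + w) = complex.Im z + complex.Im w.
Proof. by case: z; case: w. Qed.
Lemma reN z : complex.Re (- z) = - complex.Re z. Proof. by case: z. Qed.
Lemma imN z : complex.Im (- z) = - complex.Im z. Proof. by case: z. Qed.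
Lemma reM z w : complex.Re (z * w) =
  complex.Re z * complex.Re w - complex.Im z * complex.Im w.
Proof. by case: z; case: w. Qed.
Lemma imM z w : complex.Im (z * w) =
  complex.Re z * complex.Im w + complex.Im z * complex.Re w.
Proof. by case: z => a b; case: w => c e /=. Qed.
Lemma re_conj z : complex.Re (conjc z) = complex.Re z. Proof. by case: z. Qed.
Lemma im_conj z : complex.Im (conjc z) = - complex.Im z. Proof. by case: z. Qed.
Lemma reC (a : R) : complex.Re a%:C%C = a. Proof. by []. Qed.
Lemma imC (a : R) : complex.Im a%:C%C = 0. Proof. by []. Qed.

Lemma complex_ext z w : complex.Re z = complex.Re w -> complex.Im z = complex.Im w ->
  z = w.
Proof. by case: z => a b; case: w => c e /= -> ->. Qed.

Lemma csqM z w : csq (z * w) = csq z * csq w.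
Proof. by rewrite /csq reM imM; ring. Qed.
Lemma csqN z : csq (- z) = csq z.
Proof. by rewrite /csq reN imN !sqrrN. Qed.
Lemma csqC (a : R) : csq a%:C%C = a ^+ 2.
Proof. by rewrite /csq reC imC expr0n addr0. Qed.
Lemma csq0 : csq 0 = 0. Proof. by rewrite /csq !expr0n addr0. Qed.
Lemma csqD_le z w : csq (z + w) <= 2 * csq z + 2 * csq w.
Proof.
rewrite /csq reD imD.
have := sqr_ge0 (complex.Re z - complex.Re w).
have := sqr_ge0 (complex.Im z - complex.Im w); nra.
Qed.

End complex_parts.

Section L2_functions.
Context {R : realType} {n : nat}.
Local Notation mu := (@lebesgue_cV R n).
Implicit Types (f g h : 'cV[R]_n -> R[i]).

Lemma cmeasurableD f g : cmeasurable f -> cmeasurable g -> cmeasurable (fun x => f x + g x).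
Proof.
move=> [f1 f2] [g1 g2]; split.
  by under eq_fun do rewrite reD; exact: measurable_funD.
by under eq_fun do rewrite imD; exact: measurable_funD.
Qed.

Lemma cmeasurableM f g : cmeasurable f -> cmeasurable g -> cmeasurable (fun x => f x * g x).
Proof.
move=> [f1 f2] [g1 g2]; split.
  by under eq_fun do rewrite reM; apply: measurable_funB; exact: measurable_funM.
by under eq_fun do rewrite imM; apply: measurable_funD; exact: measurable_funM.
Qed.

Lemma cmeasurable_cst c : cmeasurable (fun _ : 'cV[R]_n => c).
Proof. by split; exact: measurable_cst. Qed.

Lemma cmeasurable_real (h : 'cV[R]_n -> R) : measurable_fun setT h ->
  cmeasurable (fun x => (h x)%:C%C).
Proof. by move=> mh; split => //; exact: measurable_cst. Qed.

Lemma cmeasurable_conj f : cmeasurable f -> cmeasurable (fun x => conjc (f x)).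
Proof.
move=> [f1 f2]; split; first by under eq_fun do rewrite re_conj.
by under eq_fun do rewrite im_conj; exact: measurable_funN.
Qed.

Lemma cmeasurable_comp f (T : 'cV[R]_n -> 'cV[R]_n) : measurable_fun setT T ->
  cmeasurable f -> cmeasurable (fun x => f (T x)).
Proof.
move=> mT [f1 f2]; split.
  by apply: (measurableT_comp (f := fun x => complex.Re (f x))).
by apply: (measurableT_comp (f := fun x => complex.Im (f x))).
Qed.

Lemma measurable_csq f : cmeasurable f -> measurable_fun setT (fun x => csq (f x)).
Proof. by move=> [f1 f2]; apply: measurable_funD; exact: measurable_funX. Qed.

Lemma measurable_csqE f : cmeasurable f ->
  measurable_fun setT (fun x => (csq (f x))%:E : \bar R).
Proof. by move=> mf; apply/measurable_EFinP; exact: measurable_csq. Qed.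

Lemma L2_sqnormE f : L2_sqnorm f = (\int[mu]_x (csq (f x))%:E)%E.
Proof. by apply: eq_integral => x _; rewrite csqE. Qed.

Lemma L2_sqnorm_ge0 f : (0 <= L2_sqnorm f)%E.
Proof. by apply: integral_ge0 => x _; rewrite lee_fin sqr_ge0. Qed.

Lemma L2_sqnorm_le f g (c : R) : 0 <= c -> cmeasurable f -> cmeasurable g ->
  (forall x, csq (f x) <= c * csq (g x)) -> (L2_sqnorm f <= c%:E * L2_sqnorm g)%E.
Proof.
move=> c0 mf mg h; rewrite !L2_sqnormE -ge0_integralZl//.
- apply: ge0_le_integral => //.
  + by move=> x _; rewrite lee_fin csq_ge0.
  + exact: measurable_csqE.
  + by apply: measurable_funeM; exact: measurable_csqE.
  + by move=> x _; rewrite -EFinM lee_fin.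
- exact: measurable_csqE.
- by move=> x _; rewrite lee_fin csq_ge0.
Qed.

Lemma L2_le f g (c : R) : 0 <= c -> cmeasurable f ->
  (forall x, csq (f x) <= c * csq (g x)) -> L2 g -> L2 f.
Proof.
move=> c0 mf h [mg fg]; split => //; apply: le_lt_trans (L2_sqnorm_le c0 mf mg h) _.
have gf : L2_sqnorm g \is a fin_num by rewrite ge0_fin_numE// L2_sqnorm_ge0.
by rewrite -(fineK gf) -EFinM ltry.
Qed.

Lemma L2_sqnormD f g : cmeasurable f -> cmeasurable g ->
  (L2_sqnorm (fun x => f x + g x)%R <= 2%:E * L2_sqnorm f + 2%:E * L2_sqnorm g)%E.
Proof.
move=> mf mg; have m f' : cmeasurable f' -> measurable_fun setT (fun x => (csq (f' x))%:E : \bar R).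
  by move=> ?; exact: measurable_csqE.
have p f' x : setT x -> (0 <= (csq (f' x))%:E :> \bar R)%E.
  by move=> _; rewrite lee_fin csq_ge0.
have p2 f' x : setT x -> (0 <= 2%:E * (csq (f' x))%:E :> \bar R)%E.
  by move=> _; rewrite -EFinM lee_fin mulr_ge0// csq_ge0.
rewrite !L2_sqnormE -(ge0_integralZl mu measurableT (m f mf) (p f))//.
rewrite -(ge0_integralZl mu measurableT (m g mg) (p g))//.
have m2 f' : cmeasurable f' ->
    measurable_fun setT (fun x => 2%:E * (csq (f' x))%:E : \bar R)%E.
  by move=> ?; apply: measurable_funeM; exact: m.
rewrite -(ge0_integralD mu measurableT (p2 f) (m2 f mf) (p2 g) (m2 g mg)).
apply: ge0_le_integral => //.
- by move=> x _; rewrite lee_fin csq_ge0.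
- by apply: m; exact: cmeasurableD.
- by apply: emeasurable_funD; exact: m2.
- by move=> x _; rewrite -!EFinM -EFinD lee_fin csqD_le.
Qed.

Lemma L2D f g : L2 f -> L2 g -> L2 (fun x => f x + g x).
Proof.
move=> [mf ff] [mg fg]; split; first exact: cmeasurableD.
apply: le_lt_trans (L2_sqnormD mf mg) _.
have F h : (L2_sqnorm h < +oo)%E -> L2_sqnorm h = (fine (L2_sqnorm h))%:E.
  by move=> fh; rewrite fineK// ge0_fin_numE// L2_sqnorm_ge0.
by rewrite (F f ff) (F g fg) -!EFinM -EFinD ltry.
Qed.

Lemma L2_mul f g (c : R) : 0 <= c -> cmeasurable g -> (forall x, csq (g x) <= c) ->
  L2 f -> L2 (fun x => g x * f x).
Proof.
move=> c0 mg h L; apply: (L2_le (g := f) c0) => //.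
  by apply: cmeasurableM => //; case: L.
by move=> x; rewrite csqM ler_wpM2r// csq_ge0.
Qed.

Lemma L2Z c f : L2 f -> L2 (fun x => c * f x).
Proof. by apply: (@L2_mul _ _ (csq c)) => //; exact: csq_ge0. Qed.

Lemma L2N f : L2 f -> L2 (fun x => - f x).
Proof. by under [X in _ -> L2 X]eq_fun do rewrite -mulN1r; exact: L2Z. Qed.

Lemma L2B f g : L2 f -> L2 g -> L2 (fun x => f x - g x).
Proof. by move=> Lf Lg; apply: L2D => //; exact: L2N. Qed.

Lemma L2_0 : L2 (fun _ : 'cV[R]_n => 0).
Proof.
split; first exact: cmeasurable_cst.
by rewrite L2_sqnormE; under eq_integral do rewrite csq0; rewrite integral0.
Qed.

(* [locked] keeps the unifier from comparing integrals. *)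
Definition fip : ('cV[R]_n -> R[i]) -> ('cV[R]_n -> R[i]) -> R :=
  locked (fun f g => \int[mu]_x
    (complex.Re (f x) * complex.Re (g x) + complex.Im (f x) * complex.Im (g x))).

Lemma fipE f g : fip f g = \int[mu]_x
  (complex.Re (f x) * complex.Re (g x) + complex.Im (f x) * complex.Im (g x)).
Proof. by rewrite /fip -lock. Qed.

Lemma L2_integrable f : L2 f -> mu.-integrable setT (EFin \o (fun x => csq (f x))).
Proof.
move=> [mf ff]; apply/integrableP; split; first exact: measurable_csqE.
rewrite L2_sqnormE in ff; under eq_integral do rewrite /= ger0_norm ?csq_ge0//.
exact: ff.
Qed.

Lemma fip_integrable f g : L2 f -> L2 g -> mu.-integrable setT (EFin \o (fun x =>
  complex.Re (f x) * complex.Re (g x) + complex.Im (f x) * complex.Im (g x))).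
Proof.
move=> Lf Lg.
have := integrableD measurableT (L2_integrable Lf) (L2_integrable Lg).
apply: le_integrable => //.
  case: Lf => [[f1 f2] _]; case: Lg => [[g1 g2] _].
  by apply/measurable_EFinP; apply: measurable_funD; exact: measurable_funM.
move=> x _ /=; rewrite lee_fin (ger0_norm (addr_ge0 (csq_ge0 _) (csq_ge0 _))) /csq.
move: (complex.Re _) (complex.Re _) (complex.Im _) (complex.Im _) => a b c e.
have := sqr_ge0 (a - b); have := sqr_ge0 (a + b); have := sqr_ge0 (c - e).
have := sqr_ge0 (c + e) => h1 h2 h3 h4.
by rewrite ler_norml; apply/andP; split; nra.
Qed.

Lemma fipC f g : fip f g = fip g f.
Proof. by rewrite !fipE; apply: eq_Rintegral => x _; rewrite mulrC [X in _ + X]mulrC. Qed.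

Lemma fipDl f g h : L2 f -> L2 g -> L2 h -> fip (fun x => f x + g x) h = fip f h + fip g h.
Proof.
move=> Lf Lg Lh; rewrite !fipE -RintegralD//; try exact: fip_integrable.
by apply: eq_Rintegral => x _; rewrite reD imD; ring.
Qed.

Lemma fipZl (a : R) f h : L2 f -> L2 h -> fip (fun x => a%:C%C * f x) h = a * fip f h.
Proof.
move=> Lf Lh; rewrite !fipE -RintegralZl//; last exact: fip_integrable.
by apply: eq_Rintegral => x _; rewrite reM imM reC imC; ring.
Qed.

Lemma fip_sq f : fip f f = fine (L2_sqnorm f).
Proof.
by rewrite L2_sqnormE fipE /Rintegral; congr fine; apply: eq_integral => x _.
Qed.

Lemma L2_sqnorm_fip f : L2 f -> L2_sqnorm f = (fip f f)%:E.
Proof. by move=> [_ h]; rewrite fip_sq fineK// ge0_fin_numE// L2_sqnorm_ge0. Qed.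

Lemma L2_sqnormN f : L2_sqnorm (fun x => - f x) = L2_sqnorm f.
Proof. by rewrite !L2_sqnormE; apply: eq_integral => x _; rewrite csqN. Qed.

(** For a null [f] the squared norm of [t f + g] is affine in [t]; with a nonzero slope it would
    take the value -1, which is what [t] is chosen for. *)
Lemma fip_null f g : L2 f -> L2 g -> L2_sqnorm f = 0%E -> fip f g = 0.
Proof.
move=> Lf Lg f0; apply/eqP; apply/negPn/negP => fg0.
have ff : fip f f = 0 by rewrite fip_sq f0.
pose t := - (fip g g + 1) / (2 * fip f g).
have : 0 <= fip (fun x => t%:C%C * f x + g x) (fun x => t%:C%C * f x + g x).
  by rewrite fip_sq fine_ge0// L2_sqnorm_ge0.
have Ltf := L2Z t%:C%C Lf; have Ls := L2D Ltf Lg.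
rewrite (fipDl Ltf Lg Ls) (fipZl _ Lf Ls) !(fipC _ (fun x => _ + _)).
rewrite (fipDl Ltf Lg Lf) (fipDl Ltf Lg Lg) !(fipZl _ Lf)//.
rewrite ff (fipC g f) !mulr0 add0r.
have -> : t * fip f g + (t * fip f g + fip g g) = - 1.
  by rewrite /t; field.
by rewrite leNgt oppr_lt0 ltr01.
Qed.

End L2_functions.

(** * Classes of square-integrable functions and completeness *)

Section L2_space.
Context {R : realType} {n : nat}.
Local Notation mu := (@lebesgue_cV R n).
Implicit Types (f g h : 'cV[R]_n -> R[i]).

Definition L2_eq f g : Prop := L2_sqnorm (fun x => f x - g x) = 0%E.

Lemma L2_eq_refl f : L2_eq f f.
Proof. by rewrite /L2_eq L2_sqnormE; under eq_integral do rewrite subrr csq0; rewrite integral0. Qed.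

Lemma L2_eq_sym f g : L2_eq f g -> L2_eq g f.
Proof. by rewrite /L2_eq -L2_sqnormN; under eq_fun do rewrite opprB. Qed.

Lemma L2_sqnormD0 f g : cmeasurable f -> cmeasurable g ->
  L2_sqnorm f = 0%E -> L2_sqnorm g = 0%E -> L2_sqnorm (fun x => f x + g x) = 0%E.
Proof.
move=> mf mg f0 g0; apply/eqP; rewrite eq_le L2_sqnorm_ge0 andbT.
by apply: le_trans (L2_sqnormD mf mg) _; rewrite f0 g0 !mule0 adde0.
Qed.

Lemma L2_eq_trans f g h : L2 f -> L2 g -> L2 h -> L2_eq f g -> L2_eq g h -> L2_eq f h.
Proof.
move=> Lf Lg Lh fg gh; rewrite /L2_eq.
have -> : (fun x => f x - h x) = (fun x => (f x - g x) + (g x - h x)).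
  by apply/funext => x; rewrite addrA subrK.
by apply: L2_sqnormD0 => //; [case: (L2B Lf Lg)|case: (L2B Lg Lh)].
Qed.

Lemma L2_eqD f f' g g' : L2 f -> L2 f' -> L2 g -> L2 g' ->
  L2_eq f f' -> L2_eq g g' -> L2_eq (fun x => f x + g x) (fun x => f' x + g' x).
Proof.
move=> Lf Lf' Lg Lg' ff gg; rewrite /L2_eq; under eq_fun do rewrite opprD addrACA.
by apply: L2_sqnormD0 => //; [case: (L2B Lf Lf')|case: (L2B Lg Lg')].
Qed.

Lemma L2_eqM f g h (c : R) : 0 <= c -> cmeasurable h -> (forall x, csq (h x) <= c) ->
  L2 f -> L2 g -> L2_eq f g -> L2_eq (fun x => h x * f x) (fun x => h x * g x).
Proof.
move=> c0 mh hc Lf Lg fg; rewrite /L2_eq; under eq_fun do rewrite -mulrBr.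
apply/eqP; rewrite eq_le L2_sqnorm_ge0 andbT.
have [mB _] := L2B Lf Lg.
apply: le_trans (L2_sqnorm_le c0 (cmeasurableM mh mB) mB _) _.
  by move=> x; rewrite csqM ler_wpM2r// csq_ge0.
by rewrite fg mule0.
Qed.

Lemma L2_eqZ f g c : L2 f -> L2 g -> L2_eq f g -> L2_eq (fun x => c * f x) (fun x => c * g x).
Proof. by apply: (L2_eqM (csq_ge0 c) (cmeasurable_cst c)). Qed.

(** The choice is made from the class as a set, so equivalent functions get the same representative
    and almost everywhere equality becomes equality in [L2class]. *)
Definition L2_repr f := xget (fun _ => 0) [set g | L2 g /\ L2_eq f g].

Lemma L2_reprP f : L2 f -> L2 (L2_repr f) /\ L2_eq f (L2_repr f).
Proof.
move=> Lf; rewrite /L2_repr; case: xgetP => [g _ //|/(_ f)] /=.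
by case; split => //; exact: L2_eq_refl.
Qed.

Lemma L2_repr_eq f g : L2 f -> L2 g -> L2_eq f g -> L2_repr f = L2_repr g.
Proof.
move=> Lf Lg fg; rewrite /L2_repr; congr xget; apply/seteqP; split => h [Lh e]; split => //.
  by apply: (L2_eq_trans _ Lf) => //; exact: L2_eq_sym.
exact: (L2_eq_trans _ Lg).
Qed.

(* Square integrable functions modulo equality almost everywhere, each class being
   represented by a chosen member. *)
Record L2class := L2Class {
  l2fun :> 'cV[R]_n -> R[i];
  l2funP : L2 l2fun /\ L2_repr l2fun = l2fun }.

Lemma l2fun_inj (x y : L2class) : l2fun x = l2fun y -> x = y.
Proof.
case: x => x px; case: y => y py /= xy; case: _ / xy in py *.
by congr L2Class; exact: Prop_irrelevance.
Qed.

Lemma L2_l2fun (x : L2class) : L2 x. Proof. by case: (l2funP x). Qed.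

Lemma L2_repr_idem f : L2 f -> L2 (L2_repr f) /\ L2_repr (L2_repr f) = L2_repr f.
Proof.
move=> Lf; have [Lr fr] := L2_reprP Lf; split => //.
by apply: L2_repr_eq => //; exact: L2_eq_sym.
Qed.

Definition L2z : L2class := L2Class (L2_repr_idem L2_0).

(** Total, with the zero class outside [L2], so that operators take no membership proof as
    argument. *)
Definition toL2 : ('cV[R]_n -> R[i]) -> L2class := locked (fun f =>
  if pselect (L2 f) is left Lf then L2Class (L2_repr_idem Lf) else L2z).

Lemma toL2E f : L2 f -> l2fun (toL2 f) = L2_repr f.
Proof. by rewrite /toL2 -lock; case: pselect. Qed.

Lemma toL2_aeq f : L2 f -> L2_eq f (toL2 f).
Proof. by move=> Lf; rewrite toL2E//; case: (L2_reprP Lf). Qed.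

Lemma toL2_eq f g : L2 f -> L2 g -> L2_eq f g -> toL2 f = toL2 g.
Proof. by move=> Lf Lg fg; apply: l2fun_inj; rewrite !toL2E//; exact: L2_repr_eq. Qed.

Lemma l2funK (x : L2class) : toL2 x = x.
Proof. by apply: l2fun_inj; rewrite toL2E; case: (l2funP x). Qed.

Definition L2add (x y : L2class) : L2class := toL2 (fun t => x t + y t).
Definition L2opp (x : L2class) : L2class := toL2 (fun t => - x t).
Definition L2scale (a : R) (x : L2class) : L2class := toL2 (fun t => a%:C%C * x t).

Lemma toL2D f g : L2 f -> L2 g -> L2add (toL2 f) (toL2 g) = toL2 (fun t => f t + g t).
Proof.
move=> Lf Lg; apply/esym/toL2_eq; [exact: L2D|exact/L2D/L2_l2fun/L2_l2fun|].
by apply: L2_eqD; rewrite ?L2_l2fun//; [exact: L2_l2fun|exact: L2_l2fun|exact: toL2_aeq|exact: toL2_aeq].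
Qed.

Lemma toL2Z a f : L2 f -> L2scale a (toL2 f) = toL2 (fun t => a%:C%C * f t).
Proof.
move=> Lf; apply/esym/toL2_eq; [exact: L2Z|exact/L2Z/L2_l2fun|].
by apply: L2_eqZ => //; [exact: L2_l2fun|exact: toL2_aeq].
Qed.

Lemma toL2N f : L2 f -> L2opp (toL2 f) = toL2 (fun t => - f t).
Proof.
move=> Lf; apply/esym/toL2_eq; [exact: L2N|exact/L2N/L2_l2fun|].
under eq_fun do rewrite -mulN1r; under [X in L2_eq _ X]eq_fun do rewrite -mulN1r.
by apply: L2_eqZ => //; [exact: L2_l2fun|exact: toL2_aeq].
Qed.

Let repr_ind (P : L2class -> Prop) : (forall f, L2 f -> P (toL2 f)) -> forall x, P x.
Proof. by move=> h x; rewrite -(l2funK x); apply: h; exact: L2_l2fun. Qed.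

HB.instance Definition _ := gen_eqMixin L2class.
HB.instance Definition _ := gen_choiceMixin L2class.

Let addA : associative L2add.
Proof.
elim/repr_ind => f Lf; elim/repr_ind => g Lg; elim/repr_ind => h Lh.
rewrite !toL2D//; do ?[exact: L2D].
by congr toL2; apply/funext => t; rewrite addrA.
Qed.

Let addC : commutative L2add.
Proof.
elim/repr_ind => f Lf; elim/repr_ind => g Lg; rewrite !toL2D//.
by congr toL2; apply/funext => t; rewrite addrC.
Qed.

Let add0 : left_id (toL2 (fun=> 0)) L2add.
Proof.
elim/repr_ind => f Lf; rewrite !toL2D//; last exact: L2_0.
by congr toL2; apply/funext => t; rewrite add0r.
Qed.

Let addN : left_inverse (toL2 (fun=> 0)) L2opp L2add.
Proof.
elim/repr_ind => f Lf; rewrite toL2N// toL2D//; last exact: L2N.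
by congr toL2; apply/funext => t; rewrite addNr.
Qed.

HB.instance Definition _ := GRing.isZmodule.Build L2class addA addC add0 addN.

Let scaleA a b v : L2scale a (L2scale b v) = L2scale (a * b) v.
Proof.
elim/repr_ind: v => f Lf; rewrite !toL2Z//; last exact: L2Z.
by congr toL2; apply/funext => t; rewrite mulrA -rmorphM.
Qed.

Let scale1 : left_id 1 L2scale.
Proof.
elim/repr_ind => f Lf; rewrite !toL2Z//.
by congr toL2; apply/funext => t; rewrite mul1r.
Qed.

Let scaleDr : right_distributive L2scale +%R.
Proof.
move=> a; elim/repr_ind => f Lf; elim/repr_ind => g Lg.
rewrite [_ + _]toL2D// !toL2Z//; last exact: L2D.
rewrite [RHS]toL2D//; do ?[exact: L2Z].
by congr toL2; apply/funext => t; rewrite mulrDr.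
Qed.

Let scaleDl v : {morph L2scale^~ v : a b / a + b}.
Proof.
elim/repr_ind: v => f Lf a b; rewrite !toL2Z//.
rewrite [RHS]toL2D//; do ?[exact: L2Z].
by congr toL2; apply/funext => t; rewrite -mulrDl -rmorphD.
Qed.

HB.instance Definition _ :=
  GRing.Zmodule_isLmodule.Build R L2class scaleA scale1 scaleDr scaleDl.

Lemma toL2_add f g : L2 f -> L2 g -> toL2 f + toL2 g = toL2 (fun t => f t + g t).
Proof. exact: toL2D. Qed.
Lemma toL2_scale a f : L2 f -> a *: toL2 f = toL2 (fun t => a%:C%C * f t).
Proof. exact: toL2Z. Qed.
Lemma toL2_opp f : L2 f -> - toL2 f = toL2 (fun t => - f t).
Proof. exact: toL2N. Qed.
Lemma toL2_0 : 0 = toL2 (fun=> 0). Proof. by []. Qed.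

Definition L2ip (x y : L2class) : R := fip x y.

Lemma L2ip_toL2 f g : L2 f -> L2 g -> L2ip (toL2 f) (toL2 g) = fip f g.
Proof.
move=> Lf Lg.
have key f1 f2 h : L2 f1 -> L2 f2 -> L2 h -> L2_eq f1 f2 -> fip f1 h = fip f2 h.
  move=> L1 L2' Lh e; have := fip_null (L2B L1 L2') Lh e.
  have -> : (fun x => f1 x - f2 x) = (fun x => f1 x + (-1 : R)%:C%C * f2 x).
    by apply/funext => x; rewrite rmorphN1 mulN1r.
  rewrite fipDl// ?fipZl//; last exact: L2Z.
  by move/eqP; rewrite mulN1r subr_eq0 => /eqP.
rewrite /L2ip; rewrite -(key f)//; [|exact: L2_l2fun|exact: L2_l2fun|exact: toL2_aeq].
rewrite fipC -(key g)//; [by rewrite fipC|exact: L2_l2fun|exact: toL2_aeq].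
Qed.

Let L2ipC x y : L2ip x y = L2ip y x. Proof. exact: fipC. Qed.

Let L2ipDl x y z : L2ip (x + y) z = L2ip x z + L2ip y z.
Proof.
elim/repr_ind: x => f Lf; elim/repr_ind: y => g Lg; elim/repr_ind: z => h Lh.
by rewrite toL2_add// !L2ip_toL2//; [exact: fipDl|exact: L2D].
Qed.

Let L2ipZl a x y : L2ip (a *: x) y = a * L2ip x y.
Proof.
elim/repr_ind: x => f Lf; elim/repr_ind: y => g Lg.
by rewrite toL2_scale// !L2ip_toL2//; [exact: fipZl|exact: L2Z].
Qed.

Let L2ip_ge0 x : 0 <= L2ip x x.
Proof. by rewrite /L2ip fip_sq fine_ge0// L2_sqnorm_ge0. Qed.

Let L2ip_eq0 x : L2ip x x = 0 -> x = 0.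
Proof.
elim/repr_ind: x => f Lf; rewrite L2ip_toL2// => f0.
rewrite toL2_0; apply: toL2_eq => //; first exact: L2_0.
by rewrite /L2_eq; under eq_fun do rewrite subr0; rewrite L2_sqnorm_fip// f0.
Qed.

Let L2complete (u : nat -> L2class) :
  (forall e, 0 < e -> exists N, forall m p, (N <= m)%N -> (N <= p)%N ->
     L2ip (u m - u p) (u m - u p) < e) ->
  exists l, forall e, 0 < e -> exists N, forall m, (N <= m)%N ->
     L2ip (u m - l) (u m - l) < e.
Proof.
move=> cau.
have sqB f g : L2 f -> L2 g ->
    (L2ip (toL2 f - toL2 g) (toL2 f - toL2 g))%:E = (\int[mu]_t (csq (f t - g t))%:E)%E.
  move=> Lf Lg; rewrite toL2_opp// toL2_add//; last exact: L2N.
  rewrite L2ip_toL2//; do ?[exact: L2B].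
  by rewrite -L2_sqnorm_fip ?L2_sqnormE//; exact: L2B.
have sqU m p : (L2ip (u m - u p) (u m - u p))%:E = (\int[mu]_t (csq (u m t - u p t))%:E)%E.
  by rewrite -sqB ?l2funK//; exact: L2_l2fun.
have mR m : measurable_fun setT (fun t => complex.Re (u m t)) by case: (L2_l2fun (u m)) => -[].
have mI m : measurable_fun setT (fun t => complex.Im (u m t)) by case: (L2_l2fun (u m)) => -[].
have mE (f : 'cV[R]_n -> R) : measurable_fun setT f ->
    measurable_fun setT (fun t => (f t ^+ 2)%:E : \bar R).
  by move=> mf; apply/measurable_EFinP; exact: measurable_funX.
have p0 (f : 'cV[R]_n -> R) t : setT t -> (0 <= (f t ^+ 2)%:E :> \bar R)%E.
  by move=> _; rewrite lee_fin sqr_ge0.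
have mcs m p : measurable_fun setT (fun t => (csq (u m t - u p t))%:E : \bar R).
  by apply: measurable_csqE; have [] := L2B (L2_l2fun (u m)) (L2_l2fun (u p)).
have cR (e : R) : 0 < e -> exists N, forall m p, (N <= m)%N -> (N <= p)%N ->
    (\int[mu]_t ((complex.Re (u m t) - complex.Re (u p t)) ^+ 2)%:E < e%:E)%E.
  move=> /cau [N hN]; exists N => m p Nm Np.
  apply: (@le_lt_trans _ _ (L2ip (u m - u p) (u m - u p))%:E); last by rewrite lte_fin hN.
  rewrite sqU; apply: ge0_le_integral => //.
  - by apply: p0.
  - by apply: mE; exact: measurable_funB.
  - by move=> t _; rewrite lee_fin /csq reD reN lerDl sqr_ge0.
have cI (e : R) : 0 < e -> exists N, forall m p, (N <= m)%N -> (N <= p)%N ->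
    (\int[mu]_t ((complex.Im (u m t) - complex.Im (u p t)) ^+ 2)%:E < e%:E)%E.
  move=> /cau [N hN]; exists N => m p Nm Np.
  apply: (@le_lt_trans _ _ (L2ip (u m - u p) (u m - u p))%:E); last by rewrite lte_fin hN.
  rewrite sqU; apply: ge0_le_integral => //.
  - by apply: p0.
  - by apply: mE; exact: measurable_funB.
  - by move=> t _; rewrite lee_fin /csq imD imN lerDr sqr_ge0.
have [gr [mgr hgr]] := real_L2_complete mR cR.
have [gi [mgi hgi]] := real_L2_complete mI cI.
pose g t := Complex (gr t) (gi t).
have mg : cmeasurable g by split.
have split_int m : (\int[mu]_t (csq (u m t - g t))%:E =
    \int[mu]_t ((complex.Re (u m t) - gr t) ^+ 2)%:E +
    \int[mu]_t ((complex.Im (u m t) - gi t) ^+ 2)%:E)%E.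
  rewrite -ge0_integralD//.
  - by apply: eq_integral => t _; rewrite /csq reD imD reN imN.
  - by apply: p0.
  - by apply: mE; exact: measurable_funB.
  - by apply: p0.
  - by apply: mE; exact: measurable_funB.
have conv (e : R) : 0 < e -> exists N, forall m, (N <= m)%N ->
    (\int[mu]_t (csq (u m t - g t))%:E < e%:E)%E.
  move=> e0; have e2 : 0 < e / 2 by rewrite divr_gt0.
  have [N1 h1] := hgr _ e2; have [N2 h2] := hgi _ e2.
  exists (maxn N1 N2) => m; rewrite geq_max => /andP[m1 m2].
  rewrite split_int [e in ltRHS](splitr e) EFinD.
  by apply: lteD; [exact: h1|exact: h2].
have Lg : L2 g.
  have [N hN] := conv 1 ltr01.
  have Ld : L2 (fun t => u N t - g t).
    split; last by rewrite L2_sqnormE (lt_trans (hN N (leqnn N)))// ltry.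
    under eq_fun do rewrite -mulN1r.
    apply: cmeasurableD; first by case: (L2_l2fun (u N)).
    by apply: cmeasurableM => //; exact: cmeasurable_cst.
  have := L2B (L2_l2fun (u N)) Ld.
  by under [X in L2 X]eq_fun do rewrite opprB addrC subrK.
exists (toL2 g) => e /conv [N hN]; exists N => m Nm.
rewrite -lte_fin -[u m]l2funK sqB//; last exact: L2_l2fun.
exact: hN.
Qed.

Definition L2_hilbert : hilbert R :=
  @Hilbert R L2class L2ip L2ipC L2ipDl L2ipZl L2ip_ge0 L2ip_eq0 L2complete.

End L2_space.

(** * Translations and multiplications as operators on classes *)

Section operators.
Context {R : realType} {n : nat}.
Local Notation mu := (@lebesgue_cV R n).
Local Notation H := (@L2_hilbert R n).
Local Notation fct := ('cV[R]_n -> R[i]).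
Implicit Types (f g h : fct) (y : 'cV[R]_n).

Lemma toL2_ind (P : H -> Prop) : (forall f, L2 f -> P (toL2 f)) -> forall x, P x.
Proof. by move=> h x; rewrite -(l2funK x); apply: h; exact: L2_l2fun. Qed.

Lemma ip_toL2 f g : L2 f -> L2 g -> ip (toL2 f : H) (toL2 g) = fip f g.
Proof. exact: L2ip_toL2. Qed.

Lemma nsq_toL2 f : L2 f -> nsq (toL2 f : H) = fine (L2_sqnorm f).
Proof. by move=> Lf; rewrite /nsq ip_toL2// fip_sq. Qed.

Lemma nsq_toL2E f : L2 f -> ((nsq (toL2 f : H))%:E = L2_sqnorm f)%E.
Proof. by move=> Lf; rewrite /nsq ip_toL2// L2_sqnorm_fip. Qed.

Lemma toL2B f g : L2 f -> L2 g -> (toL2 f : H) - toL2 g = toL2 (fun x => f x - g x).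
Proof. by move=> Lf Lg; rewrite toL2_opp// toL2_add//; exact: L2N. Qed.

Lemma toL2_sum I (s : seq I) (F : I -> fct) : (forall i, L2 (F i)) ->
  L2 (fun x => \sum_(i <- s) F i x) /\
  \sum_(i <- s) (toL2 (F i) : H) = toL2 (fun x => \sum_(i <- s) F i x).
Proof.
move=> LF; elim: s => [|i s [IL IE]].
  rewrite big_nil; under eq_fun do rewrite big_nil.
  by split; [exact: L2_0|exact: toL2_0].
rewrite big_cons IE; under eq_fun do rewrite big_cons.
by split; [exact: L2D|rewrite toL2_add].
Qed.

Lemma fip_mul (c f g : fct) : fip (fun x => c x * f x) g = fip f (fun x => conjc (c x) * g x).
Proof.
by rewrite !fipE; apply: eq_Rintegral => x _; rewrite !reM !imM re_conj im_conj; ring.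
Qed.

Definition L2op : (fct -> fct) -> H -> H := locked (fun F x => toL2 (F (l2fun x))).

Definition L2_preserving (F : fct -> fct) := (forall f, L2 f -> L2 (F f)) /\
  (forall f g, L2 f -> L2 g -> L2_eq f g -> L2_eq (F f) (F g)).

Lemma L2opE F f : L2_preserving F -> L2 f -> L2op F (toL2 f) = toL2 (F f).
Proof.
move=> [pF eF] Lf; rewrite /L2op -lock; apply: toL2_eq; [exact/pF/L2_l2fun|exact: pF|].
by apply: eF => //; [exact: L2_l2fun|apply: L2_eq_sym; exact: toL2_aeq].
Qed.

Lemma L2_preserving_bound F (K : R) : 0 <= K -> (forall f, cmeasurable f -> cmeasurable (F f)) ->
  (forall f g, F (fun x => f x - g x) = fun x => F f x - F g x) ->
  (forall f, cmeasurable f -> (L2_sqnorm (F f) <= K%:E * L2_sqnorm f)%E) ->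
  L2_preserving F.
Proof.
move=> K0 mF aF bF; split.
  move=> f [mf ff]; split; first exact: mF.
  apply: le_lt_trans (bF f mf) _.
  have gf : L2_sqnorm f \is a fin_num by rewrite ge0_fin_numE// L2_sqnorm_ge0.
  by rewrite -(fineK gf) -EFinM ltry.
move=> f g Lf Lg fg; rewrite /L2_eq -aF; apply/eqP; rewrite eq_le L2_sqnorm_ge0 andbT.
by apply: le_trans (bF _ _) _; [case: (L2B Lf Lg)|rewrite fg mule0].
Qed.

Lemma cmeasurable_translate y f : cmeasurable f -> cmeasurable (translate y f).
Proof. by move=> mf; apply: cmeasurable_comp mf; exact: measurable_cV_shift. Qed.

Lemma L2_sqnorm_translate y f : cmeasurable f -> L2_sqnorm (translate y f) = L2_sqnorm f.
Proof.
move=> mf; rewrite !L2_sqnormE /translate.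
rewrite -[RHS](@ge0_integral_cV_shift R n (- y))//; last by move=> x; rewrite lee_fin csq_ge0.
exact: measurable_csqE.
Qed.

Lemma translate_preserving y : L2_preserving (translate y : fct -> fct).
Proof.
apply: (@L2_preserving_bound _ 1) => //; first exact: cmeasurable_translate.
by move=> f mf; rewrite mul1e L2_sqnorm_translate.
Qed.

Lemma L2_translate y f : L2 f -> L2 (translate y f).
Proof. by case: (translate_preserving y) => + _; apply. Qed.

Lemma mul_preserving (c : fct) (K : R) : 0 <= K -> cmeasurable c ->
  (forall x, csq (c x) <= K) -> L2_preserving (fun f x => c x * f x).
Proof.
move=> K0 mc cK; apply: (@L2_preserving_bound _ K) => //.
- by move=> f; exact: cmeasurableM.
- by move=> f g; apply/funext => x; rewrite mulrBr.
- move=> f mf; apply: L2_sqnorm_le => //; first exact: cmeasurableM.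
  by move=> x; rewrite csqM ler_wpM2r// csq_ge0.
Qed.

Definition Tr y : H -> H := L2op (translate y).

Definition Mu (c : fct) : H -> H := L2op (fun f x => c x * f x).

(** The bound 1 covers the multipliers in use (phases, characters, indicators, the weight [v]) and
    is stable under products. *)
Definition bounded_mul (c : fct) := cmeasurable c /\ forall x, csq (c x) <= 1.

Lemma bounded_mulP c : bounded_mul c -> L2_preserving (fun f x => c x * f x).
Proof. by case=> mc c1; exact: (@mul_preserving c 1). Qed.

Lemma TrE y f : L2 f -> Tr y (toL2 f) = toL2 (translate y f).
Proof. exact/L2opE/translate_preserving. Qed.

Lemma MuE c f : bounded_mul c -> L2 f -> Mu c (toL2 f) = toL2 (fun x => c x * f x).
Proof. by move=> bc; apply: L2opE; exact: bounded_mulP. Qed.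

Lemma L2_Mu c f : bounded_mul c -> L2 f -> L2 (fun x => c x * f x).
Proof. by move=> /bounded_mulP [h _]; exact: h. Qed.

Lemma Tr_nsq y x : nsq (Tr y x) = nsq x.
Proof.
elim/toL2_ind: x => f Lf.
rewrite (TrE y Lf) (nsq_toL2 (L2_translate y Lf)) (nsq_toL2 Lf).
by case: Lf => mf _; rewrite (L2_sqnorm_translate y mf).
Qed.

Lemma TrTr y z x : Tr y (Tr z x) = Tr (y + z) x.
Proof.
elim/toL2_ind: x => f Lf; rewrite !TrE//; last exact: L2_translate.
by congr toL2; apply/funext => x; rewrite /translate opprD addrA.
Qed.

Lemma Tr0 x : Tr 0 x = x.
Proof.
elim/toL2_ind: x => f Lf; rewrite !TrE//.
by congr toL2; apply/funext => x; rewrite /translate subr0.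
Qed.

Lemma TrD y (x z : H) : Tr y (x + z) = Tr y x + Tr y z.
Proof.
elim/toL2_ind: x => f Lf; elim/toL2_ind: z => g Lg.
rewrite [_ + _]toL2_add// !TrE//; last exact: L2D.
by rewrite [RHS]toL2_add//; exact: L2_translate.
Qed.

Lemma Tr_adj y : adj (Tr y) (Tr (- y)).
Proof.
apply: adj_isometry; [exact: TrD|exact: Tr_nsq|].
by move=> x; rewrite TrTr subrr Tr0.
Qed.

Lemma bounded_mul_conj c : bounded_mul c -> bounded_mul (fun x => conjc (c x)).
Proof.
move=> [mc c1]; split; first exact: cmeasurable_conj.
by move=> x; rewrite /csq re_conj im_conj sqrrN; exact: c1.
Qed.

Lemma bounded_mulM c e : bounded_mul c -> bounded_mul e -> bounded_mul (fun x => c x * e x).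
Proof.
move=> [mc c1] [me e1]; split; first exact: cmeasurableM.
by move=> x; rewrite csqM mulr_ile1// ?csq_ge0.
Qed.

Lemma bounded_mul_translate y c : bounded_mul c -> bounded_mul (translate y c).
Proof.
by move=> [mc c1]; split; [exact: cmeasurable_translate|move=> x; exact: c1].
Qed.

Lemma bounded_mul_cst c : csq c <= 1 -> bounded_mul (fun=> c).
Proof. by split => //; exact: cmeasurable_cst. Qed.

Lemma Mu_adj c : bounded_mul c -> adj (Mu c) (Mu (fun x => conjc (c x))).
Proof.
move=> bc; elim/toL2_ind => f Lf; elim/toL2_ind => g Lg.
have bc' := bounded_mul_conj bc.
rewrite (MuE bc Lf) (MuE bc' Lg) (ip_toL2 (L2_Mu bc Lf) Lg) (ip_toL2 Lf (L2_Mu bc' Lg)).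
exact: fip_mul.
Qed.

Lemma MuMu c e x : bounded_mul c -> bounded_mul e ->
  Mu c (Mu e x) = Mu (fun x => c x * e x) x.
Proof.
move=> bc be; elim/toL2_ind: x => f Lf; have bce := bounded_mulM bc be.
rewrite (MuE be Lf) (MuE bc (L2_Mu be Lf)) (MuE bce Lf).
by congr toL2; apply/funext => x; rewrite mulrA.
Qed.

Lemma MuC c e x : bounded_mul c -> bounded_mul e -> Mu c (Mu e x) = Mu e (Mu c x).
Proof. by move=> bc be; rewrite !MuMu//; congr Mu; apply/funext => t; rewrite mulrC. Qed.

Lemma Mu1 x : Mu (fun=> 1) x = x.
Proof.
have b1 : bounded_mul (fun=> 1).
  by apply: bounded_mul_cst; rewrite /csq/= expr1n expr0n addr0.
elim/toL2_ind: x => f Lf; rewrite (MuE b1 Lf).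
by congr toL2; apply/funext => x; rewrite mul1r.
Qed.

Lemma TrMu y c x : bounded_mul c -> Tr y (Mu c x) = Mu (translate y c) (Tr y x).
Proof.
move=> bc; have bt := bounded_mul_translate y bc.
elim/toL2_ind: x => f Lf.
by rewrite (MuE bc Lf) (TrE y Lf) (TrE y (L2_Mu bc Lf)) (MuE bt (L2_translate y Lf)).
Qed.

Lemma Mu_nsq c x : cmeasurable c -> (forall t, csq (c t) = 1) -> nsq (Mu c x) = nsq x.
Proof.
move=> mc c1; have bc : bounded_mul c by split => // t; rewrite c1.
elim/toL2_ind: x => f Lf.
rewrite (MuE bc Lf) (nsq_toL2 (L2_Mu bc Lf)) (nsq_toL2 Lf) !L2_sqnormE.
by congr fine; apply: eq_integral => t _; rewrite csqM c1 mul1r.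
Qed.

(** [fip] is the real part of the complex inner product, which is conjugate linear on the right;
    hence its imaginary part is the real part after multiplying [g] by ['i]. *)
Lemma L2_innerE f g : L2_inner f g = Complex (fip f g) (fip f (fun x => 'i%C * g x)).
Proof.
rewrite /L2_inner !fipE; congr Complex; apply: eq_Rintegral => x _.
  by rewrite reM re_conj im_conj; ring.
by rewrite !imM reM re_conj im_conj /=; ring.
Qed.

Definition indC (E : set 'cV[R]_n) : fct := fun x => (\1_E x : R)%:C%C.

Lemma bounded_indC E : measurable E -> bounded_mul (indC E).
Proof.
move=> mE; split; first by apply: cmeasurable_real; exact: measurable_indic.
by move=> x; rewrite /indC csqC indicE; case: (x \in E); rewrite ?expr1n ?expr0n.
Qed.

Lemma indC_adj E : measurable E -> adj (Mu (indC E)) (Mu (indC E)).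
Proof.
move=> mE; have := Mu_adj (bounded_indC mE).
suff -> : (fun x => conjc (indC E x)) = indC E by [].
by apply/funext => x; apply: complex_ext; rewrite ?re_conj ?im_conj //= oppr0.
Qed.

Lemma indC_idem E x : measurable E -> Mu (indC E) (Mu (indC E) x) = Mu (indC E) x.
Proof.
move=> mE; have b := bounded_indC mE; rewrite MuMu//; congr Mu; apply/funext => t.
by rewrite /indC -rmorphM indicE; case: (_ \in _); rewrite ?mulr1 ?mulr0.
Qed.

Lemma nsq_indC E f : measurable E -> L2 f ->
  ((nsq (Mu (indC E) (toL2 f)))%:E = \int[mu]_(x in E) (csq (f x))%:E)%E.
Proof.
move=> mE Lf; have b := bounded_indC mE; rewrite (MuE b Lf) (nsq_toL2E (L2_Mu b Lf)) L2_sqnormE.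
rewrite [RHS]integral_mkcond; apply: eq_integral => x _.
rewrite patchE csqM /indC csqC indicE; case: (x \in E); rewrite ?expr1n ?mul1r//.
by rewrite expr0n mul0r.
Qed.

End operators.

(** * Complex systems as enumerated real frames *)

Section wavelet_frames.
Context {R : realType} {n : nat} {I : countType}.
Local Notation H := (@L2_hilbert R n).
Local Notation fct := ('cV[R]_n -> R[i]).
Implicit Types (phi psi : I -> fct) (f g : fct).

Definition cunit (b : bool) : R[i] := if b then 'i%C else 1.

Lemma csq_cunit b : csq (cunit b) = 1.
Proof. by case: b; rewrite /csq/= ?expr0n ?expr1n ?add0r ?addr0. Qed.

Definition rframe phi (j : I * bool) : fct := fun x => cunit j.2 * phi j.1 x.

(* A complex system [phi] as a real one: [phi i] and ['i * phi i], enumerated. *)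
Definition nframe phi (m : nat) : H :=
  oapp (fun j => toL2 (rframe phi j)) 0 (@pickle_inv (I * bool)%type m).

Lemma L2_rframe phi j : (forall i, L2 (phi i)) -> L2 (rframe phi j).
Proof. by move=> Lp; exact: L2Z. Qed.

Lemma nframe_pickle phi j : nframe phi (pickle j) = toL2 (rframe phi j).
Proof. by rewrite /nframe pickleK_inv. Qed.

(** Splitting a real combination by the boolean yields two complex ones, with real and with
    imaginary coefficients. Each obeys the bound [b], and [nsqD_le] costs the factor 2. *)
Lemma nframe_ub phi (b : R) : 0 <= b -> (forall i, L2 (phi i)) ->
  (forall (s : seq I) (c : I -> R[i]), uniq s ->
     (L2_sqnorm (fun x => \sum_(i <- s) c i * phi i x)%R <=
      (b * \sum_(i <- s) Normc.normc (c i) ^+ 2)%:E)%E) ->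
  riesz_ub (nframe phi) (2 * b).
Proof.
move=> b0 Lp ub s c us.
pose t := pmap (@pickle_inv (I * bool)%type) s.
have pinv m j : @pickle_inv (I * bool)%type m = Some j -> pickle j = m.
  by move=> e; have := @pickle_invK (I * bool)%type m; rewrite e.
have e1 : \sum_(m <- s) c m *: nframe phi m =
    \sum_(j <- t) c (pickle j) *: (toL2 (rframe phi j) : H).
  rewrite /t; elim: (s) => [|m s' IH]; first by rewrite !big_nil.
  rewrite big_cons IH /nframe /=; case e: (pickle_inv m) => [j|] /=.
    by rewrite big_cons (pinv _ _ e).
  by rewrite scaler0 add0r.
have e2 : \sum_(j <- t) c (pickle j) ^+ 2 <= \sum_(m <- s) c m ^+ 2.
  rewrite /t; elim: (s) => [|m s' IH]; first by rewrite !big_nil.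
  rewrite big_cons /=; case e: (pickle_inv m) => [j|] /=.
    by rewrite big_cons (pinv _ _ e) lerD2l.
  by rewrite -[leLHS]add0r lerD// sqr_ge0.
have ut : uniq t by apply: (pmap_uniq (@pickle_invK _)).
pose tb be := [seq j.1 | j <- t & j.2 == be].
have utb be : uniq (tb be).
  rewrite map_inj_in_uniq ?filter_uniq// => -[i1 b1] [i2 b2].
  by rewrite !mem_filter /= => /andP[/eqP -> _] /andP[/eqP -> _] ->.
have e3 be (V : nmodType) (F : I * bool -> V) : \sum_(j <- t | j.2 == be) F j = \sum_(i <- tb be) F (i, be).
  by rewrite big_map big_filter; apply: eq_bigr => -[i b'] /= /eqP ->.
have part be : nsq (\sum_(j <- t | j.2 == be) c (pickle j) *: (toL2 (rframe phi j) : H))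
    <= b * \sum_(j <- t | j.2 == be) c (pickle j) ^+ 2.
  rewrite !e3.
  pose C (i : I) : R[i] := (c (pickle (i, be)))%:C%C * cunit be.
  have -> : \sum_(i <- tb be) c (pickle (i, be)) *: (toL2 (rframe phi (i, be)) : H) =
      \sum_(i <- tb be) (toL2 (fun x => C i * phi i x) : H).
    apply: eq_bigr => i _; rewrite [LHS](toL2_scale _ (L2_rframe (i, be) Lp)).
    by congr toL2; apply/funext => x; rewrite /C /rframe /= mulrA.
  have [LS ->] := toL2_sum (tb be) (fun i => L2Z (C i) (Lp i)).
  rewrite -lee_fin (nsq_toL2E LS); apply: le_trans (ub _ _ (utb be)) _.
  rewrite lee_fin; apply/ler_wpM2l => //; apply/ler_sum => i _.
  by rewrite csqE csqM csqC csq_cunit mulr1.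
rewrite e1 (bigID (fun j => j.2 == true))/=.
apply: le_trans (nsqD_le _ _) _.
have e4 : (fun j : I * bool => j.2 != true) =1 (fun j => j.2 == false) by case=> ? [].
rewrite [X in _ + 2 * nsq X](eq_bigl _ _ e4).
apply: (@le_trans _ _ (2 * b * \sum_(j <- t) c (pickle j) ^+ 2)); last first.
  by apply: ler_wpM2l => //; rewrite mulr_ge0.
rewrite [X in _ <= _ * X](bigID (fun j : I * bool => j.2 == true))/= (eq_bigl _ _ e4).
have := part true; have := part false; lra.
Qed.

(** Orthogonality to [s] and to ['i * s] gives orthogonality to all complex combinations; an
    approximation of [g] with squared error below [fip f g ^+ 2 / (nsq f + 1)] then contradicts
    Cauchy-Schwarz. *)
Lemma fip_closed_span (S : set fct) f g : L2 f -> (forall s, S s -> L2 s) ->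
  (forall s, S s -> fip f s = 0) -> (forall s, S s -> fip f (fun x => 'i%C * s x) = 0) ->
  closed_span S g -> fip f g = 0.
Proof.
move=> Lf SL S0 Si [Lg hg].
have comb m (c : 'I_m -> R[i]) (s : 'I_m -> fct) : (forall i, S (s i)) ->
    L2 (fun x => \sum_(i < m) c i * s i x) /\ fip f (fun x => \sum_(i < m) c i * s i x) = 0.
  move=> Ss; have [LS e] := toL2_sum (index_enum 'I_m) (fun i => L2Z (c i) (SL _ (Ss i))).
  split => //; rewrite -(ip_toL2 Lf LS) -e ip_sumr big1// => i _.
  rewrite (ip_toL2 Lf (L2Z (c i) (SL _ (Ss i)))).
  have -> : (fun x => c i * s i x) = (fun x => (complex.Re (c i))%:C%C * s i x +
      (complex.Im (c i))%:C%C * ('i%C * s i x)).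
    apply/funext => x; rewrite mulrA -mulrDl; congr (_ * _).
    by apply: complex_ext; rewrite ?reD ?imD ?reM ?imM /=; ring.
  have Li := L2Z 'i%C (SL _ (Ss i)).
  rewrite fipC (fipDl (L2Z _ (SL _ (Ss i))) (L2Z _ Li) Lf).
  rewrite (fipZl _ (SL _ (Ss i)) Lf) (fipZl _ Li Lf) !(fipC _ f) S0// Si//.
  by rewrite !mulr0 addr0.
apply/eqP/negPn/negP => fg0.
have F0 : 0 < nsq (toL2 f : H) + 1 by rewrite ltr_wpDl// nsq_ge0.
have d0 : 0 < fip f g ^+ 2 / (nsq (toL2 f : H) + 1).
  by rewrite divr_gt0// lt_neqAle sqr_ge0 eq_sym sqrf_eq0 fg0.
have [m [c [s [Ss hs]]]] := hg _ d0.
have [LS S00] := comb m c s Ss.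
have Ld := L2B Lg LS.
have := ip_cauchy_schwarz (toL2 f : H) (toL2 (fun x => g x - \sum_(i < m) c i * s i x)).
have e : ip (toL2 f : H) (toL2 (fun x => g x - \sum_(i < m) c i * s i x)) = fip f g.
  by rewrite -toL2B// ipBr (ip_toL2 Lf Lg) (ip_toL2 Lf LS) S00 subr0.
rewrite e; move: hs; rewrite -(nsq_toL2E Ld) lte_fin ltr_pdivlMr// => hs.
apply/negP; rewrite -ltNge mulrC; apply: le_lt_trans hs.
by rewrite ler_wpM2l ?nsq_ge0// lerDl.
Qed.

Lemma nframe_total phi : complete_system phi -> total_family (nframe phi).
Proof.
move=> [Lp full]; apply: toL2_ind => f Lf h.
have S0 b i : fip f (fun x => cunit b * phi i x) = 0.
  have := h (pickle (i, b)); rewrite nframe_pickle.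
  by rewrite (ip_toL2 Lf (L2_rframe (i, b) Lp)).
apply: ip_eq0; rewrite (ip_toL2 Lf Lf).
apply: (@fip_closed_span (range phi)) => //; last exact: full.
- by move=> _ [i _ <-].
- move=> _ [i _ <-]; have := S0 false i.
  by congr (fip _ _ = _); apply/funext => x; rewrite mul1r.
- by move=> _ [i _ <-]; exact: (S0 true i).
Qed.

Lemma fipNr f g : L2 f -> L2 g -> fip f (fun x => - g x) = - fip f g.
Proof.
move=> Lf Lg; rewrite -(ip_toL2 Lf Lg) -(ip_toL2 Lf (L2N Lg)) -ipNr.
by congr (ip _ _); rewrite [RHS]toL2_opp.
Qed.

Lemma fip_rframe phi psi i j b b' : (forall i, L2 (phi i)) -> (forall i, L2 (psi i)) ->
  L2_inner (phi i) (psi j) = (i == j)%:R ->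
  fip (rframe phi (i, b)) (rframe psi (j, b')) = ((i, b) == (j, b'))%:R.
Proof.
move=> Lp Lq; rewrite L2_innerE => e.
have e1 : fip (phi i) (psi j) = (i == j)%:R.
  by have := congr1 (@complex.Re R) e => /= ->; case: (i == j).
have e2 : fip (phi i) (fun x => 'i%C * psi j x) = 0.
  by have := congr1 (@complex.Im R) e => /= ->; case: (i == j).
have key (c : R[i]) : conjc (cunit b) * cunit b' = c ->
    fip (rframe phi (i, b)) (rframe psi (j, b')) = fip (phi i) (fun x => c * psi j x).
  move=> <-; rewrite /rframe /= fip_mul; congr fip.
  by apply/funext => x; rewrite mulrA.
have one : (fun x => 1 * psi j x) = psi j by apply/funext => x; rewrite mul1r.
rewrite xpair_eqE; case: b b' key => -[] key; rewrite ?andbT ?andbF.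
- rewrite (key 1); last by apply: complex_ext; rewrite ?reM ?imM /=; ring.
  by rewrite one.
- rewrite (key (- 'i%C)); last by apply: complex_ext; rewrite ?reM ?imM /=; ring.
  have -> : (fun x => - 'i%C * psi j x) = (fun x => - ('i%C * psi j x)).
    by apply/funext => x; rewrite mulNr.
  by rewrite (fipNr (Lp i) (L2Z 'i%C (Lq j))) e2 oppr0.
- rewrite (key 'i%C); last by apply: complex_ext; rewrite ?reM ?imM /=; ring.
  by rewrite e2.
- rewrite (key 1); last by apply: complex_ext; rewrite ?reM ?imM /=; ring.
  by rewrite one.
Qed.

Lemma riesz_basis_biorthogonal phi psi : riesz_basis phi -> riesz_basis psi ->
  (forall i j, L2_inner (phi i) (psi j) = (i == j)%:R) ->
  exists b, biorthogonal (nframe phi) (nframe psi) b.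
Proof.
move=> [cphi [a1 [b1 [_ b10 ub1]]]] [cpsi [a2 [b2 [_ b20 ub2]]]] bi.
have Lp := cphi.1; have Lq := cpsi.1.
(* A common bound for both systems, doubled by the passage to real frames. *)
exists (2 * (b1 + b2)).
have wk be chi : riesz_ub (nframe chi) (2 * be) -> be <= b1 + b2 ->
    riesz_ub (nframe chi) (2 * (b1 + b2)).
  move=> h bb s c us; apply: le_trans (h s c us) _; apply: ler_wpM2r.
    by apply: sumr_ge0 => i _; exact: sqr_ge0.
  by rewrite ler_pM2l.
have ipE m k : ip (nframe phi m) (nframe psi k) =
    (if @pickle_inv (I * bool)%type m is Some j then (m == k)%:R else 0).
  rewrite /nframe; case em: (pickle_inv m) => [[i b]|] /=; last by rewrite ip0l.
  have pm := @pickle_invK (I * bool)%type m; rewrite em /= in pm.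
  case ek: (pickle_inv k) => [[j b']|] /=; last first.
    rewrite ip0r; case: eqP => // mk; move: ek; rewrite -mk -pm pickleK_inv //.
  have pk := @pickle_invK (I * bool)%type k; rewrite ek /= in pk.
  rewrite (ip_toL2 (L2_rframe (i, b) Lp) (L2_rframe (j, b') Lq)) (fip_rframe b b' Lp Lq (bi i j)).
  by rewrite -pm -pk (inj_eq (pcan_inj (@pickleK_inv _))).
split.
- by rewrite mulr_ge0// addr_ge0// ltW.
- apply: (wk b1); last by rewrite lerDl ltW.
  by apply: nframe_ub => //; [exact: ltW|move=> s c us; have /andP[] := ub1 s c us].
- apply: (wk b2); last by rewrite lerDr ltW.
  by apply: nframe_ub => //; [exact: ltW|move=> s c us; have /andP[] := ub2 s c us].
- exact: nframe_total.
- exact: nframe_total.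
- by move=> m k mk; rewrite ipE (negPf mk); case: pickle_inv.
- move=> m; rewrite ipE eqxx; case em: (pickle_inv m) => [j|]; [by left|right].
  by rewrite /nframe em.
Qed.

End wavelet_frames.

(** * Lattice sums *)

Section countable_sums.
Context {R : realType}.
Local Open Scope ereal_scope.

Lemma esum_pickle (I : countType) (F : I -> \bar R) : (forall i, 0 <= F i) ->
  \esum_(i in [set: I]) F i = \sum_(m <oo) oapp F 0 (@pickle_inv I m).
Proof.
move=> F0; rewrite nneseries_esumT; last by move=> m; case: pickle_inv => /=.
pose a m := oapp F 0 (@pickle_inv I m).
have inj : set_inj [set: I] (@pickle I) by move=> i j _ _; exact: (pcan_inj pickleK).
transitivity (\esum_(i in [set: I]) a (pickle i)).
  by apply: eq_esum => i _; rewrite /a pickleK_inv.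
rewrite -(esum_image _ _ a inj) [LHS]esum_mkcond; apply: eq_esum => m _.
case: ifPn => // /negP; rewrite inE /= => h; rewrite -/(a m) /a.
have := @pickle_invK I m; case: pickle_inv => [i|]//= im.
by exfalso; apply: h; exists i.
Qed.

Lemma integral_esum d (T : measurableType d) (mu : {measure set T -> \bar R})
    (I : countType) (F : I -> T -> \bar R) :
  (forall i, measurable_fun setT (F i)) -> (forall i x, 0 <= F i x) ->
  measurable_fun setT (fun x => \esum_(i in [set: I]) F i x) /\
  \int[mu]_x (\esum_(i in [set: I]) F i x) = \esum_(i in [set: I]) \int[mu]_x F i x.
Proof.
move=> mF F0.
have e x : \esum_(i in [set: I]) F i x = \sum_(m <oo) oapp (F^~ x) 0 (@pickle_inv I m).
  exact: esum_pickle.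
have m0 m : measurable_fun setT (fun x => oapp (F^~ x) 0 (@pickle_inv I m)).
  by case: pickle_inv => [i|] /=; [exact: mF|exact: measurable_cst].
have p0 m x : 0 <= oapp (F^~ x) 0 (@pickle_inv I m) by case: pickle_inv => /=.
split.
  under eq_fun do rewrite e.
  by apply: ge0_emeasurable_sum.
under eq_integral do rewrite e.
rewrite integral_nneseries// esum_pickle; last by move=> i; exact: integral_ge0.
apply: eq_eseriesr => m _; case: pickle_inv => //=.
by rewrite integral0.
Qed.

Lemma esum_eq1 (I : choiceType) (i0 : I) (F : I -> \bar R) : 0 <= F i0 ->
  (forall i, i != i0 -> F i = 0) -> \esum_(i in [set: I]) F i = F i0.
Proof.
move=> F0 h; rewrite -[RHS](@esum_set1 R I i0 F F0) [RHS]esum_mkcond.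
apply: eq_esum => i _; case: ifPn => //; rewrite notin_setE /= => /eqP; exact: h.
Qed.

End countable_sums.

Section lattice_tiling.
Context {R : realType} {n : nat}.
Local Notation mu := (@lebesgue_cV R n).

Definition unit_box (c : R) : set 'cV[R]_n := cV_box (fun=> `[c, c + 1[%classic).

Lemma measurable_unit_box c : measurable (unit_box c).
Proof. by apply: measurable_cV_box => i; exact: measurable_itv. Qed.

Lemma lebesgue_unit_box0 : mu (unit_box 0) = 1%E.
Proof.
rewrite lebesgue_cV_box; last by move=> i; exact: measurable_itv.
rewrite big1// => i _; rewrite lebesgue_measure_itv/= lte_fin add0r ltr01.
by rewrite -EFinB subr0.
Qed.

Lemma unit_box_unique c (x : 'cV[R]_n) : exists k0 : 'cV[int]_n, forall k,
  unit_box c (x + lattice_point k) <-> k = k0.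
Proof.
exists (\col_i - Num.floor (x i ord0 - c)) => k; split.
  move=> h; apply/colP => i; rewrite mxE; have := h i.
  rewrite /= in_itv /= !mxE => /andP[h1 h2].
  rewrite (@floor_def _ _ (- k i ord0)) ?opprK//.
  by rewrite intrD rmorphN /=; apply/andP; split; lra.
move=> -> i; rewrite /= in_itv /= !mxE rmorphN /=.
have := floor_itv (x i ord0 - c); rewrite intrD => /andP[h1 h2].
by apply/andP; split; lra.
Qed.

Lemma lattice_tiling c (f : 'cV[R]_n -> \bar R) : measurable_fun setT f ->
  (forall x, 0 <= f x)%E ->
  (\esum_(k in [set: 'cV[int]_n]) \int[mu]_(x in unit_box c) f (x - lattice_point k)%R
    = \int[mu]_x f x)%E.
Proof.
move=> mf f0; pose g (k : 'cV[int]_n) (x : 'cV[R]_n) : \bar R := ((\1_(unit_box c) (x + lattice_point k)%R : R)%:E * f x)%E.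
have m1 k : measurable_fun setT (fun x : 'cV[R]_n => (\1_(unit_box c) (x + lattice_point k)%R : R)%:E).
  apply/measurable_EFinP.
  have h := @measurable_indic _ _ R setT _ (measurable_unit_box c).
  exact: (measurableT_comp h (measurable_cV_shift _)).
have mg k : measurable_fun setT (g k) by apply: emeasurable_funM.
have g0 k x : (0 <= g k x)%E by rewrite mule_ge0// lee_fin indicE.
transitivity (\esum_(k in [set: 'cV[int]_n]) \int[mu]_x g k x)%E.
  apply: eq_esum => k _; rewrite integral_mkcond.
  rewrite -(@ge0_integral_cV_shift R n (- lattice_point k) (g k))//.
  apply: eq_integral => x _; rewrite /g subrK patchE indicE.
  by case: (x \in unit_box c); rewrite ?mul1e ?mul0e.
have [_ <-] := integral_esum mu mg g0; apply: eq_integral => x _.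
have [k0 hk] := unit_box_unique c x.
rewrite (esum_eq1 (i0 := k0)) ?g0//.
  by rewrite /g indicE mem_set ?mul1e//; exact/hk.
by move=> k kk; rewrite /g indicE memNset ?mul0e// => /hk /eqP; exact/negP.
Qed.

Lemma tiling_L2 c (x : @L2_hilbert R n) :
  (\esum_(k in [set: 'cV[int]_n])
     (nsq (Mu (indC (unit_box c)) (Tr (lattice_point k) x)))%:E = (nsq x)%:E)%E.
Proof.
move: x; apply: toL2_ind => f Lf; rewrite (nsq_toL2E Lf) L2_sqnormE.
rewrite -(@lattice_tiling c); last 2 first.
- by apply: measurable_csqE; case: Lf.
- by move=> x; rewrite lee_fin csq_ge0.
apply: eq_esum => k _; rewrite (TrE _ Lf).
by rewrite (nsq_indC (measurable_unit_box c) (L2_translate _ Lf)).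
Qed.

End lattice_tiling.

(** The last clause holds for every [F] because [iota] has countably many values, each taken on a
    measurable set. The decay weights will be powers of constants with exponent [iota]. *)
Lemma first_index {d} {T : measurableType d} (S : nat -> set T) :
  (forall i, measurable (S i)) -> (forall x, exists i, S i x) ->
  exists iota : T -> nat, [/\ forall x, S (iota x) x,
    forall x i, (i < iota x)%N -> ~ S i x &
    forall d' (U : measurableType d') (F : nat -> U), measurable_fun setT (fun x => F (iota x))].
Proof.
move=> mS cov.
have cov' x : exists i, `[< S i x >] by have [i hi] := cov x; exists i; exact/asboolP.
pose iota x := ex_minn (cov' x).
have S1 x : S (iota x) x by rewrite /iota; case: ex_minnP => m /asboolP.
have S2 x i : (i < iota x)%N -> ~ S i x.
  rewrite /iota; case: ex_minnP => m _ h im Si.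
  by have := h i (introT (asboolP _) Si); rewrite leqNgt im.
exists iota; split => // d' U F _ Y mY; rewrite setTI.
have -> : (fun x => F (iota x)) @^-1` Y =
    \bigcup_(i in [set i | Y (F i)]) (S i `\` \bigcup_(j in [set j | (j < i)%N]) S j).
  apply/seteqP; split => x /=.
    by move=> h; exists (iota x) => //; split => // -[j /= /S2].
  case=> i /= Yi [Si nS]; have -> // : iota x = i.
  apply/eqP; rewrite eqn_leq; apply/andP; split; rewrite leqNgt; apply/negP => h.
    exact: S2 h Si.
  by apply: nS; exists (iota x).
apply: bigcup_measurable => i _; apply: measurableD => //.
exact: bigcup_measurable.
Qed.

Lemma esum_geometric {R : realType} (c q : R) : 0 <= c -> 0 <= q -> q < 1 ->
  (\esum_(i in [set: nat]) (c * q ^+ i)%:E <= (c / (1 - q))%:E)%E.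
Proof.
move=> c0 q0 q1; apply: esum_le_partial => [i|m]; first by rewrite mulr_ge0// exprn_ge0.
rewrite lee_fin -mulr_sumr; apply: ler_wpM2l => //.
rewrite -[leRHS]mul1r ler_pdivlMr ?subr_gt0// mulrC.
have := subrX1 q m => e.
have -> : (1 - q) * (\sum_(i < m) q ^+ i) = 1 - q ^+ m by apply: oppr_inj; rewrite -mulNr !opprB -e.
by rewrite gerBl exprn_ge0.
Qed.

Section lattice_bounds.
Context {R : realType} {n : nat}.
Local Notation mu := (@lebesgue_cV R n).
Local Notation H := (@L2_hilbert R n).
Local Notation fct := ('cV[R]_n -> R[i]).

(** Every lattice point [k] with [x - k] in [E] places a whole unit box inside a translate of [E'];
    these boxes are disjoint, so their number is at most its volume. *)
Lemma lattice_count (E E' : set 'cV[R]_n) : measurable E' ->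
  (forall z q, E z -> unit_box 0 q -> E' (z + q)) ->
  forall x, (\esum_(k in [set: 'cV[int]_n]) (\1_E (x - lattice_point k)%R : R)%:E
     <= mu E')%E.
Proof.
move=> mE' sub x; pose f (z : 'cV[R]_n) : \bar R := (\1_E' (z + x) : R)%:E.
have mf : measurable_fun setT f.
  apply/measurable_EFinP; have h := @measurable_indic _ _ R setT _ mE'.
  exact: (measurableT_comp h (measurable_cV_shift _)).
have f0 z : (0 <= f z)%E by rewrite lee_fin.
have -> : mu E' = (\int[mu]_z f z)%E.
  rewrite (@ge0_integral_cV_shift R n x (fun z => (\1_E' z)%:E))//.
    by rewrite integral_indic// setIT.
  by apply/measurable_EFinP; exact: measurable_indic.
rewrite -(@lattice_tiling R n 0 f mf f0); apply: le_esum => k _.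
have [xE|xE] := pselect (E (x - lattice_point k)); last by rewrite indicE memNset//; apply: integral_ge0.
rewrite indicE mem_set//.
rewrite -(@lebesgue_unit_box0 R n) -[leLHS]mul1e -integral_cst; last exact: measurable_unit_box.
apply: ge0_le_integral => //; first exact: measurable_unit_box.
- apply: measurable_funTS; apply: (measurableT_comp mf); exact: measurable_cV_shift.
- move=> q qQ; rewrite /f lee_fin indicE mem_set//.
  by rewrite -addrA addrC (addrC _ x); exact: sub.
Qed.

(** Group the lattice points by the value of [iota]: the growth [a ^+ i] of the counts is beaten by
    [r ^+ i], leaving a geometric series of ratio [r * a]. *)
Lemma lattice_sum_index (S : nat -> set 'cV[R]_n) (iota : 'cV[R]_n -> nat) (c a r : R) :
  0 <= r -> 0 <= c -> 0 <= a -> r * a < 1 ->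
  (forall x, S (iota x) x) ->
  (forall i x, (\esum_(k in [set: 'cV[int]_n]) (\1_(S i) (x - lattice_point k)%R : R)%:E
     <= (c * a ^+ i)%:E)%E) ->
  forall x, (\esum_(k in [set: 'cV[int]_n]) (r ^+ iota (x - lattice_point k)%R)%:E
     <= (c / (1 - r * a))%:E)%E.
Proof.
move=> r0 c0 a0 ra S1 cnt x.
pose t (k : 'cV[int]_n) (i : nat) : \bar R := ((r ^+ i)%:E * (\1_(S i) (x - lattice_point k)%R : R)%:E)%E.
have t0 k i : (0 <= t k i)%E by rewrite mule_ge0// lee_fin// exprn_ge0.
apply: (@le_trans _ _ (\esum_(k in [set: 'cV[int]_n]) \esum_(i in [set: nat]) t k i)).
  apply: le_esum => k _; set z := x - _.
  apply: le_trans (_ : t k (iota z) <= _)%E.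
    by rewrite /t indicE mem_set ?mule1//; exact: S1.
  rewrite -(@esum_set1 R nat (iota z) (t k))//.
  by rewrite [leLHS]esum_mkcond; apply: le_esum => i _; case: ifP.
rewrite (esum_exchange _ _ t0).
apply: (@le_trans _ _ (\esum_(i in [set: nat]) (c * (r * a) ^+ i)%:E)).
  apply: le_esum => i _; rewrite /t.
  rewrite (@esumZl _ _ _ (r ^+ i) (fun k => (\1_(S i) (x - lattice_point k)%R : R)%:E)) ?exprn_ge0//.
  apply: le_trans (_ : (r ^+ i)%:E * (c * a ^+ i)%:E <= _)%E.
    by apply: lee_wpmul2l; rewrite ?lee_fin ?exprn_ge0.
  by rewrite -EFinM lee_fin exprMn mulrCA.
by apply: esum_geometric => //; rewrite mulr_ge0.
Qed.

(** A Bessel inequality for translates that comes from decay alone. Shift the weight across the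
    pairing, so that [f] is multiplied by the translate of [v] and [g] by [w]; apply Cauchy-Schwarz
    to each term, and sum the squares of the translates of [v] under the integral. *)
Lemma lattice_bessel (v w : 'cV[R]_n -> R) (C : R) : 0 <= C ->
  measurable_fun setT v -> (forall x, 0 <= v x <= 1) -> (forall x, v x * w x = 1) ->
  (forall x, (\esum_(k in [set: 'cV[int]_n]) (v (x - lattice_point k)%R ^+ 2)%:E <= C%:E)%E) ->
  forall (f g : fct) (c : 'cV[int]_n -> R[i]), L2 f -> L2 g ->
  L2 (fun x => (w x)%:C%C * g x) -> (forall k, csq (c k) = 1) ->
  (\esum_(k in [set: 'cV[int]_n])
      (fip f (fun x => c k * translate (lattice_point k) g x) ^+ 2)%:E
    <= C%:E * (L2_sqnorm f * L2_sqnorm (fun x => (w x)%:C%C * g x)%R))%E.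
Proof.
move=> C0 mv v01 vw vC f g c Lf Lg; set h := fun x => _ * g x => Lh c1.
have mf := Lf.1; have mg := Lg.1.
have bv : bounded_mul (fun x => (v x)%:C%C).
  split; first exact: cmeasurable_real.
  by move=> x; rewrite csqC; have /andP[? ?] := v01 x; rewrite expr_le1.
pose vk k := translate (lattice_point k) (fun x => (v x)%:C%C : R[i]).
have bvk k : bounded_mul (vk k) by exact: bounded_mul_translate.
have Lvf k : L2 (fun x => vk k x * f x) by exact: L2_Mu.
have Lch k : L2 (fun x => c k * translate (lattice_point k) h x) by exact/L2Z/L2_translate.
have nch k : L2_sqnorm (fun x => c k * translate (lattice_point k) h x) = L2_sqnorm h.
  rewrite -(L2_sqnorm_translate (lattice_point k) (proj1 Lh)) !L2_sqnormE.
  by apply: eq_integral => x _; rewrite csqM c1 mul1r.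
have key k : fip f (fun x => c k * translate (lattice_point k) g x) =
    fip (fun x => vk k x * f x) (fun x => c k * translate (lattice_point k) h x).
  rewrite fip_mul; congr fip; apply/funext => x.
  rewrite /vk /h /translate; have := vw (x - lattice_point k).
  set y := x - _ => e; rewrite mulrCA; congr (_ * _).
  rewrite mulrA; have -> : conjc (v y)%:C%C * (w y)%:C%C = 1 :> R[i].
    by apply: complex_ext; rewrite ?reM ?imM /= ?e; ring.
  by rewrite mul1r.
pose N := fine (L2_sqnorm h).
have NE : L2_sqnorm h = N%:E by rewrite L2_sqnorm_fip// /N fip_sq.
have N0 : 0 <= N by rewrite -lee_fin -NE L2_sqnorm_ge0.
apply: (@le_trans _ _ (\esum_(k in [set: 'cV[int]_n]) (N%:E * L2_sqnorm (fun x => vk k x * f x)%R))%E).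
  apply: le_esum => k _; rewrite key -(ip_toL2 (Lvf k) (Lch k)).
  apply: le_trans (_ : (nsq (toL2 (fun x => vk k x * f x) : H) *
      nsq (toL2 (fun x => c k * translate (lattice_point k) h x) : H))%:E <= _)%E.
    by rewrite lee_fin; exact: ip_cauchy_schwarz.
  by rewrite EFinM (nsq_toL2E (Lvf k)) (nsq_toL2E (Lch k)) nch NE muleC.
rewrite esumZl//; last by move=> k; exact: L2_sqnorm_ge0.
have -> : (C%:E * (L2_sqnorm f * L2_sqnorm h) = N%:E * (C%:E * L2_sqnorm f))%E.
  by rewrite NE muleA muleC.
apply: lee_wpmul2l; first by rewrite lee_fin.
pose F (k : 'cV[int]_n) (x : 'cV[R]_n) : \bar R := ((v (x - lattice_point k) ^+ 2)%:E * (csq (f x))%:E)%E.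
have F0 k x : (0 <= F k x)%E by rewrite mule_ge0// lee_fin ?sqr_ge0// csq_ge0.
have mF k : measurable_fun setT (F k).
  apply: emeasurable_funM; last exact: measurable_csqE.
  apply/measurable_EFinP; apply: measurable_funX.
  exact: (measurableT_comp mv (measurable_cV_shift _)).
have -> : (\esum_(k in [set: 'cV[int]_n]) L2_sqnorm (fun x => vk k x * f x)%R)%E =
    (\esum_(k in [set: 'cV[int]_n]) \int[mu]_x F k x)%E.
  apply: eq_esum => k _; rewrite L2_sqnormE; apply: eq_integral => x _.
  by rewrite csqM /vk /translate csqC EFinM.
have [mE <-] := integral_esum mu mF F0.
rewrite L2_sqnormE -ge0_integralZl//; last 2 first.
- exact: measurable_csqE.
- by move=> x _; rewrite lee_fin csq_ge0.
apply: ge0_le_integral => //.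
- by move=> x _; apply: esum_ge0.
- by apply: measurable_funeM; exact: measurable_csqE.
move=> x _; rewrite /F.
under eq_esum do rewrite muleC.
rewrite esumZl ?csq_ge0//; last by move=> k; rewrite lee_fin sqr_ge0.
by rewrite muleC; apply: lee_wpmul2r; [rewrite lee_fin csq_ge0|exact: vC].
Qed.

End lattice_bounds.

(** * Expansive matrices and quasi-norms *)

Section vector_norm.
Context {R : realType} {n : nat}.
Implicit Types x : 'cV[R]_n.

Lemma cV_norm_le x r : 0 <= r -> (`|x| <= r) <-> (forall i, `|x i ord0| <= r).
Proof.
move=> r0; rewrite [`|x|]/Num.norm /= mx_normrE; split => [h i|h].
  by have /bigmax_leP[_ h'] := h; exact: (h' (i, ord0)).
apply/bigmax_leP; split => // -[i j] _ /=.
by rewrite (ord1 j); exact: h.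
Qed.

Lemma cV_coord_le x i : `|x i ord0| <= `|x|.
Proof. by have [h _] := cV_norm_le x (normr_ge0 x); exact: h. Qed.

Lemma cV_ballE r x : 0 <= r -> cV_ball r x <-> `|x| <= r.
Proof.
move=> r0; rewrite cV_norm_le//; split => h i; have := h i; rewrite /= in_itv /= ler_norml//.
Qed.

Lemma tr_norm (x : 'rV[R]_n) : `|x^T| = `|x|.
Proof.
rewrite [`|x|]/Num.norm [`|x^T|]/Num.norm /= !mx_normrE.
apply/eqP; rewrite eq_le; apply/andP; split.
  apply/bigmax_leP; split => [|[i j] _ /=]; first exact: bigmax_ge_id.
  by rewrite mxE; exact: (le_bigmax _ (fun ij => `|x ij.1 ij.2|) (j, i)).
apply/bigmax_leP; split => [|[i j] _ /=]; first exact: bigmax_ge_id.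
by have := le_bigmax 0 (fun ij => `|x^T ij.1 ij.2|) (j, i); rewrite /= mxE.
Qed.

Lemma mulmx_norm_bound (M : 'M[R]_n) : exists2 K, 1 <= K & forall x, `|M *m x| <= K * `|x|.
Proof.
exists (1 + \sum_i \sum_j `|M i j|).
  by rewrite lerDl; apply: sumr_ge0 => i _; apply: sumr_ge0 => j _.
move=> x; apply/cV_norm_le.
  by rewrite mulr_ge0// addr_ge0//; apply: sumr_ge0 => i _; apply: sumr_ge0 => j _.
move=> i; rewrite mxE; apply: le_trans (ler_norm_sum _ _ _) _.
apply: (@le_trans _ _ ((\sum_j `|M i j|) * `|x|)).
  rewrite mulr_suml; apply: ler_sum => j _; rewrite normrM ler_wpM2l//; exact: cV_coord_le.
apply: ler_wpM2r => //; rewrite [X in _ + X](bigD1 i)//= addrCA lerDl.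
by rewrite addr_ge0//; apply: sumr_ge0 => k _; apply: sumr_ge0 => j _.
Qed.

(** Heine-Borel is applied to row vectors; transposition, which keeps the norm, carries the extrema
    over. *)
Lemma cV_compact_extrema (f : 'cV[R]_n -> R) (r s : R) :
  (forall x, {for x, continuous f}) -> (exists x, r <= `|x| <= s) ->
  (exists2 x, r <= `|x| <= s & forall y, r <= `|y| <= s -> f x <= f y) /\
  exists C, forall y, r <= `|y| <= s -> f y <= C.
Proof.
move=> cf [x0 hx0].
pose K : set 'rV[R]_n := [set v | r <= `|v| <= s].
have cK : compact K.
  apply: bounded_closed_compact.
    exists s; split; first exact: num_real.
    by move=> M sM v /= /andP[_ h]; exact: le_trans h (ltW sM).
  rewrite (_ : K = (fun v : 'rV[R]_n => `|v|) @^-1` `[r, s]%classic).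
    apply: closed_comp; last exact: itv_closed.
    by move=> v _; exact: norm_continuous.
  by apply/seteqP; split => v; rewrite /K /= in_itv.
have cg : {within K, continuous (f \o trmx)}.
  apply: continuous_subspaceT => v; apply: continuous_comp; last exact: cf.
  move=> P [Q /= nQ sQ]; exists (fun i j => Q j i) => [i j|w hw] /=.
    by have := nQ j i; rewrite mxE.
  by apply: sQ => i j; rewrite mxE.
have K0 : K !=set0 by exists x0^T; rewrite /K /= -tr_norm trmxK.
have tK y : r <= `|y| <= s -> y^T \in K by rewrite inE /K /= -tr_norm trmxK.
split.
  have [c cK' hc] := compact_EVT_min K0 cK cg.
  exists c^T; first by move: cK'; rewrite inE /K /= tr_norm.
  by move=> y /tK /hc /=; rewrite trmxK.
have [c _ hc] := compact_EVT_max K0 cK cg.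
by exists (f c^T) => y /tK /hc /=; rewrite trmxK.
Qed.

End vector_norm.

Lemma norm_const1 (R : realType) n : `|const_mx 1 : 'cV[R]_n.+1| = 1.
Proof.
apply/eqP; rewrite eq_le; apply/andP; split.
  by apply/cV_norm_le => // i; rewrite mxE normr1.
by have := cV_coord_le (const_mx 1 : 'cV[R]_n.+1) ord0; rewrite mxE normr1.
Qed.

Section expansive_matrices.
Context {R : realType} {n : nat}.
Variables (A : 'M[R]_n.+1).
Local Notation a := `|\det A|.

(** Up to sign the determinant is the product of the roots of the characteristic polynomial over
    [R[i]], and all of these have modulus greater than 1. *)
Lemma expansive_det : expansive A -> 1 < a.
Proof.
move=> hA; pose AC := map_mx (real_complex R) A.
have [r hr] := closed_field_poly_normal (char_poly AC).
have mon : lead_coef (char_poly AC) = 1 by apply/eqP; rewrite -monicE; exact: char_poly_monic.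
rewrite mon scale1r in hr.
have sz : size r = n.+1.
  by have := size_char_poly AC; rewrite hr size_prod_XsubC => -[].
have h0 : \prod_(z <- r) - z = (-1) ^+ n.+1 * (real_complex R) (\det A).
  rewrite -det_map_mx -/AC -char_poly_det -horner_coef0 hr horner_prod.
  by apply: eq_bigr => z _; rewrite hornerXsubC sub0r.
have h1 : \prod_(z <- r) `|z| = `|(real_complex R) (\det A)|.
  have := congr1 (fun z : R[i] => `|z|) h0; rewrite normrM normrX normrN1 expr1n mul1r => <-.
  by rewrite normr_prod; apply: eq_bigr => z _; rewrite normrN.
have rt z : z \in r -> 1 < `|z|.
  by move=> zr; apply: hA; rewrite eigenvalue_root_char hr root_prod_XsubC.
have h2 : 1 < \prod_(z <- r) `|z|.
  case: r sz rt {hr h0 h1} => // z r _ rt; rewrite big_cons.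
  apply: lt_le_trans (rt z (mem_head _ _)) _; rewrite ler_peMr//.
  have {}rt w : w \in r -> 1 < `|w| by move=> wr; apply: rt; rewrite inE wr orbT.
  elim: r rt => [|w r IH] rt; first by rewrite big_nil.
  rewrite big_cons; apply: mulr_ege1.
    by apply/ltW/rt; exact: mem_head.
  by apply: IH => u ur; apply: rt; rewrite inE ur orbT.
rewrite h1 in h2; move: h2; rewrite normc_def /= expr0n addr0 sqrtr_sqr.
by rewrite ltcR.
Qed.

Variable (rho : 'cV[R]_n.+1 -> R).
Hypotheses (hA : expansive A) (hrho : quasi_norm A rho).
Let a1 : 1 < a := expansive_det hA.
Let a0 : 0 < a. Proof. exact: lt_trans a1. Qed.

Lemma expansive_unit : A \is a GRing.unit.
Proof. by rewrite unitmxE unitfE -normr_gt0. Qed.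

Lemma mulmx_expVr i j (x : 'cV[R]_n.+1) : A ^+ i *m (A^-1 ^+ (i + j) *m x) = A^-1 ^+ j *m x.
Proof. by rewrite mulmxA exprD [A^-1 ^+ i]exprVn mulmxE mulrA mulrV ?mul1r// unitrX// expansive_unit. Qed.

Lemma rho_continuous x : {for x, continuous rho}.
Proof.
have [->|x0] := eqVneq x 0; first exact: quasi_norm_cont0 hrho.
by have [] := quasi_norm_smooth hrho [::] x0.
Qed.

Lemma rho_exp i x : rho (A ^+ i *m x) = a ^+ i * rho x.
Proof.
elim: i => [|i IH]; first by rewrite !expr0 mul1mx mul1r.
by rewrite !exprS -mulmxE -mulmxA (quasi_norm_scale hrho) IH mulrA.
Qed.

Lemma rho_expV i x : a ^+ i * rho (A^-1 ^+ i *m x) = rho x.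
Proof. by rewrite -rho_exp; have := mulmx_expVr i 0 x; rewrite addn0 expr0 mul1mx => ->. Qed.

Lemma bernoulli_ineq (h : R) m : -1 <= h -> 1 + m%:R * h <= (1 + h) ^+ m.
Proof.
move=> h1; elim: m => [|m IH]; first by rewrite expr0 mul0r addr0.
rewrite exprS -natr1; have h0 : 0 <= 1 + h by lra.
apply: le_trans (ler_wpM2l h0 IH).
have : 0 <= m%:R * h ^+ 2 by rewrite mulr_ge0// sqr_ge0.
by rewrite expr2; lra.
Qed.

Lemma expr_unbounded (b C : R) : 1 < b -> exists m, C < b ^+ m.
Proof.
move=> b1; pose m := (Num.truncn (`|C| / (b - 1))).+1; exists m.
have h : -1 <= b - 1 by lra.
apply: lt_le_trans (_ : 1 + m%:R * (b - 1) <= _); last first.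
  by have := bernoulli_ineq m h; rewrite addrCA subrr addr0.
have := truncnS_gt (`|C| / (b - 1)); rewrite -/m ltr_pdivrMr ?subr_gt0// => h'.
by have := ler_norm C; lra.
Qed.

(** The spectrum enters only through [1 < a]; the rest is read from [rho], which is bounded below on
    the unit sphere and above on the ball of radius 2. As soon as [a ^+ m] exceeds the quotient of
    these bounds, [A^-1 ^+ m] halves the norm. *)
Lemma expansive_contraction : exists K lam : R, [/\ 1 <= K, 0 < lam, lam < 1 &
  forall j (x : 'cV[R]_n.+1), `|A^-1 ^+ j *m x| <= K * lam ^+ j * `|x|].
Proof.
have n1 := @norm_const1 R n.
have [[x1 hx1 min1] _] : (exists2 x, 1 <= `|x| <= 1 & forall y, 1 <= `|y| <= 1 -> rho x <= rho y) /\
    exists C, forall y, 1 <= `|y| <= 1 -> rho y <= C.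
  apply: cV_compact_extrema; first exact: rho_continuous.
  by exists (const_mx 1); rewrite n1 lexx.
have c0 : 0 < rho x1.
  have x10 : x1 != 0 by rewrite -normr_gt0; apply: lt_le_trans (_ : 1 <= _) => //; case/andP: hx1.
  by have [] := quasi_norm_sym hrho x10.
have [_ [C hC]] : (exists2 x, 0 <= `|x| <= 2 & forall y, 0 <= `|y| <= 2 -> rho x <= rho y) /\
    exists C, forall y, 0 <= `|y| <= 2 -> rho y <= C.
  apply: cV_compact_extrema; first exact: rho_continuous.
  by exists 0; rewrite normr0 lexx ler0n.
have [m hm] := expr_unbounded (C / rho x1) a1.
have half (x : 'cV[R]_n.+1) : `|A^-1 ^+ m *m x| <= 2^-1 * `|x|.
  have [->|x0] := eqVneq x 0; first by rewrite mulmx0 normr0 mulr0.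
  have xn0 : 0 < `|x| by rewrite normr_gt0.
  rewrite leNgt; apply/negP => hlt.
  set y := A^-1 ^+ m *m x in hlt.
  have yn0 : 0 < `|y| by apply: le_lt_trans hlt; rewrite mulr_ge0.
  have : rho x1 <= rho (`|y|^-1 *: y).
    by apply: min1; rewrite normrZ normfV normr_id mulVf ?lexx// gt_eqF.
  have -> : `|y|^-1 *: y = A^-1 ^+ m *m (`|y|^-1 *: x) by rewrite -scalemxAr.
  set z := `|y|^-1 *: x => h1.
  have z2 : `|z| <= 2.
    rewrite normrZ normfV normr_id mulrC ler_pdivrMr//; lra.
  have := hC z; rewrite normr_ge0 z2 => /(_ isT); rewrite -(rho_expV m z).
  move: hm; rewrite ltr_pdivrMr// => hm h2.
  have := le_lt_trans h2 hm; rewrite ltr_pM2l ?exprn_gt0//; lra.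
have [m' mE] : exists m', m = m'.+1.
  case: m half {hm} => [|m' _]; last by exists m'.
  by move=> /(_ (const_mx 1)); rewrite expr0 mul1mx n1 => h; exfalso; move: h; lra.
have [K1 K11 hK1] := mulmx_norm_bound A^-1.
have K1p r (x : 'cV[R]_n.+1) : `|A^-1 ^+ r *m x| <= K1 ^+ r * `|x|.
  elim: r => [|r IH]; first by rewrite !expr0 mul1mx mul1r.
  rewrite !exprS -mulmxE -mulmxA -mulrA; apply: le_trans (hK1 _) _.
  by apply: ler_wpM2l IH; lra.
(* A stand-in for the [m]-th root of one half: Bernoulli gives [2^-1 <= lam ^+ m], so each halving
   pays for [m] factors [lam]. *)
pose lam : R := 1 - 2^-1 / m%:R.
have m0 : 0 < m%:R :> R by rewrite mE ltr0n.
have lm0 : 0 < 2^-1 / m%:R :> R by rewrite divr_gt0.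
have lm1 : 2^-1 / m%:R <= 2^-1 :> R.
  by rewrite ler_pdivrMr// ler_peMr// mE ler1n.
have l0 : 0 < lam by rewrite /lam; lra.
have l1 : lam < 1 by rewrite /lam; lra.
have lm : 2^-1 <= lam ^+ m.
  have := @bernoulli_ineq (- (2^-1 / m%:R)) m _; rewrite -/lam.
  have -> : m%:R * - (2^-1 / m%:R) = - 2^-1 :> R by field; rewrite gt_eqF.
  by move=> h; apply: le_trans (h _); lra.
have K1m : 1 <= K1 ^+ m by rewrite exprn_ege1.
exists (2 * K1 ^+ m), lam; split => //; first by lra.
move=> j; elim/ltn_ind: j => j IH x.
have [jm|mj] := ltnP j m.
  apply: le_trans (K1p _ _) _; apply: ler_wpM2r => //.
  apply: le_trans (_ : K1 ^+ m <= _); first by apply: ler_weXn2l => //; exact: ltnW.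
  rewrite mulrAC -[leLHS]mul1r; apply: ler_wpM2r; first by lra.
  have : lam ^+ m <= lam ^+ j by apply: ler_wiXn2l; [exact: ltW|exact: ltW|exact: ltnW].
  by lra.
rewrite -(subnKC mj) exprD -mulmxE -mulmxA; apply: le_trans (half _) _.
have jj : (j - m < j)%N by rewrite mE ltn_subrL /=; apply: leq_trans mj; rewrite mE.
apply: le_trans (ler_wpM2l _ (IH _ jj x)) _ => //.
rewrite [X in _ <= _ * X * _]exprD !mulrA; apply: ler_wpM2r => //.
apply: ler_wpM2r; first by rewrite exprn_ge0// ltW.
by rewrite [leRHS]mulrC -mulrA; apply: ler_wpM2r => //; lra.
Qed.

(** Apply [A^-1] until just before the norm drops below 1. The point reached lies in the compact
    shell between radii 1 and [Lam], and [rho] has not increased on the way. *)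
Lemma rho_lower : exists2 c, 0 < c & forall x, 1 <= `|x| -> c <= rho x.
Proof.
have n1 := @norm_const1 R n.
have [K [lam [K1 l0 l1 hK]]] := expansive_contraction.
have [Lam L1 hL] := mulmx_norm_bound A.
have [[x1 hx1 min1] _] : (exists2 x, 1 <= `|x| <= Lam & forall y, 1 <= `|y| <= Lam -> rho x <= rho y) /\
    exists C, forall y, 1 <= `|y| <= Lam -> rho y <= C.
  apply: cV_compact_extrema; first exact: rho_continuous.
  by exists (const_mx 1); rewrite n1 lexx.
exists (rho x1).
  have x10 : x1 != 0 by rewrite -normr_gt0; apply: lt_le_trans (_ : 1 <= _) => //; case/andP: hx1.
  by have [] := quasi_norm_sym hrho x10.
move=> x x1'.
have ex : exists i, `|A^-1 ^+ i *m x| < 1.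
  have li : 1 < lam^-1 by rewrite invf_gt1.
  have [i hi] := expr_unbounded (K * `|x|) li; exists i.
  apply: le_lt_trans (hK i x) _; rewrite mulrAC -ltr_pdivlMr ?exprn_gt0//.
  by rewrite mul1r -exprVn.
case: (ex_minnP ex) => -[|i] hi mini; first by move: hi; rewrite expr0 mul1mx; lra.
have y1 : 1 <= `|A^-1 ^+ i *m x|.
  by rewrite leNgt; apply/negP => /mini; rewrite ltnn.
have y2 : `|A^-1 ^+ i *m x| <= Lam.
  have := mulmx_expVr 1 i x; rewrite add1n expr1 => <-; apply: le_trans (hL _) _.
  by rewrite -[leRHS]mulr1 ler_wpM2l// ?ltW//; lra.
apply: le_trans (min1 _ (introT andP (conj y1 y2))) _.
rewrite -(rho_expV i x) ler_peMl//; first exact: quasi_norm_ge0 hrho _.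
by rewrite exprn_ege1// ltW.
Qed.

End expansive_matrices.

(** * Dilations and affine systems *)

Section complex_orthogonality.
Context {R : realType} {n : nat}.
Local Notation fct := ('cV[R]_n -> R[i]).
Implicit Types f g : fct.

Lemma fip_complexr (c : R[i]) f g : L2 f -> L2 g -> fip f (fun x => c * g x) =
  complex.Re c * fip f g + complex.Im c * fip f (fun x => 'i%C * g x).
Proof.
move=> Lf Lg; have Li := L2Z 'i%C Lg.
have -> : (fun x => c * g x) = (fun x => (complex.Re c)%:C%C * g x +
    (complex.Im c)%:C%C * ('i%C * g x)).
  apply/funext => x; rewrite mulrA -mulrDl; congr (_ * _).
  by apply: complex_ext; rewrite ?reD ?imD ?reM ?imM /=; ring.
rewrite fipC (fipDl (L2Z _ Lg) (L2Z _ Li) Lf) (fipZl _ Lg Lf) (fipZl _ Li Lf).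
by rewrite !(fipC _ f).
Qed.

Lemma inner0_fip (c e : R[i]) f g : L2 f -> L2 g -> L2_inner f g = 0 ->
  fip (fun x => c * f x) (fun x => e * g x) = 0.
Proof.
move=> Lf Lg; rewrite L2_innerE => h.
rewrite fip_mul; have -> : (fun x => conjc c * (e * g x)) = (fun x => (conjc c * e) * g x).
  by apply/funext => x; rewrite mulrA.
rewrite fip_complexr//.
have -> : fip f g = 0 by exact: (congr1 (@complex.Re R) h).
have -> : fip f (fun x => 'i%C * g x) = 0 by exact: (congr1 (@complex.Im R) h).
by rewrite !mulr0 addr0.
Qed.

Lemma closed_span_orth (S : set fct) f g : L2 f -> (forall s, S s -> L2 s) ->
  (forall s (c e : R[i]), S s -> fip (fun x => c * f x) (fun x => e * s x) = 0) ->
  closed_span S g -> forall c e : R[i], fip (fun x => c * f x) (fun x => e * g x) = 0.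
Proof.
move=> Lf SL h gS c e; rewrite fipC fip_mul fipC.
have -> : (fun x => conjc e * (c * f x)) = (fun x => (conjc e * c) * f x).
  by apply/funext => x; rewrite mulrA.
apply: (fip_closed_span (S := S)) => //; first exact: L2Z.
  move=> s Ss; have := h s (conjc e * c) 1 Ss.
  by congr (fip _ _ = _); apply/funext => x; rewrite mul1r.
by move=> s Ss; exact: h.
Qed.

Lemma mem_closed_span (S : set fct) f : L2 f -> S f -> closed_span S f.
Proof.
move=> Lf Sf; split => // e e0; exists 1%N, (fun=> 1), (fun=> f); split => //.
have -> : (fun x => f x - \sum_(i < 1) 1 * f x) = (fun=> 0).
  by apply/funext => x; rewrite big_ord1 mul1r subrr.
by rewrite L2_sqnormE; under eq_integral do rewrite csq0; rewrite integral0 lte_fin.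
Qed.

End complex_orthogonality.

Section frame_indices.
Context {R : realType} {n : nat} {I : countType}.
Local Notation H := (@L2_hilbert R n).
Implicit Types (phi psi : I -> 'cV[R]_n -> R[i]) (p q : pred I).

(** Codes are taken in pairs, [phi i] together with ['i * phi i], so that the projection belongs to
    a complex span. *)
Definition iset p : set nat :=
  [set m | if @pickle_inv (I * bool)%type m is Some j then p j.1 else false].

Lemma mem_iset_pickle p (j : I * bool) : (pickle j \in iset p) = p j.1.
Proof. by apply/idP/idP; rewrite inE /iset /= pickleK_inv. Qed.

Lemma nframe_vanish phi psi (U : H -> H) p q : U 0 = 0 ->
  (forall i b j b', p i -> q j ->
     ip (U (toL2 (rframe phi (i, b)))) (toL2 (rframe psi (j, b')) : H) = 0) ->
  forall m k, m \in iset p -> k \in iset q -> ip (U (nframe phi m)) (nframe psi k) = 0.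
Proof.
move=> U0 h m k; rewrite !inE /iset /nframe /=.
case: (@pickle_inv _ m) => [[i b]|]//= pi.
by case: (@pickle_inv _ k) => [[j b']|]//= qj; exact: h.
Qed.

Lemma notin_iset p m phi : m \notin iset p ->
  m \in iset (fun i => ~~ p i) \/ nframe phi m = 0.
Proof.
rewrite notin_setE /iset /nframe inE /=.
by case: (@pickle_inv _ m) => [[i b]|] /= h; [left; exact/negP|right].
Qed.

Lemma nframe_intertwine phi psi b p q (U U' : H -> H) :
  biorthogonal (nframe phi) (nframe psi) b -> adj U U' ->
  (forall i b j b', p i -> ~~ q j ->
     ip (U (toL2 (rframe phi (i, b)))) (toL2 (rframe psi (j, b')) : H) = 0) ->
  (forall i b j b', ~~ p i -> q j ->
     ip (U (toL2 (rframe phi (i, b)))) (toL2 (rframe psi (j, b')) : H) = 0) ->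
  forall f, U (bproj (nframe phi) (nframe psi) (iset p) f) =
    bproj (nframe phi) (nframe psi) (iset q) (U f).
Proof.
move=> bio hU h1 h2; have U0 := adj0 hU.
apply: (bproj_intertwine bio hU) => i m.
  move=> ip_ /(@notin_iset _ _ psi) [mq|->]; last by rewrite ip0r.
  exact: (nframe_vanish U0 h1 ip_ mq).
move=> /(@notin_iset _ _ phi) [iq|->] mq; last by rewrite U0 ip0l.
exact: (nframe_vanish U0 h2 iq mq).
Qed.

End frame_indices.

Section dilations.
Context {R : realType} {n : nat}.
Local Notation mu := (@lebesgue_cV R n).
Local Notation H := (@L2_hilbert R n).
Implicit Types (P : 'M[R]_n) (f g : 'cV[R]_n -> R[i]).

Lemma cmeasurable_dilate P f : cmeasurable f -> cmeasurable (dilate P f).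
Proof.
move=> mf; apply: cmeasurableM; first exact: cmeasurable_cst.
by apply: (cmeasurable_comp _ mf); exact: measurable_cV_mulmx.
Qed.

Lemma dilate_sqnorm P (c : R) f : 0 <= c ->
  (forall E, measurable E -> mu ((fun x => P *m x) @^-1` E) = (c%:E * mu E)%E) ->
  cmeasurable f -> L2_sqnorm (dilate P f) = ((`|\det P| * c)%:E * L2_sqnorm f)%E.
Proof.
move=> c0 hc mf; rewrite !L2_sqnormE EFinM -muleA.
have m1 := measurable_csqE mf.
rewrite -(ge0_integral_cV_mulmx c0 hc m1); last by move=> x; rewrite lee_fin csq_ge0.
rewrite -ge0_integralZl//.
- apply: eq_integral => x _; rewrite /dilate csqM csqC sqr_sqrtr ?normr_ge0//.
- by apply: (measurableT_comp m1); exact: measurable_cV_mulmx.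
- by move=> x _; rewrite lee_fin csq_ge0.
Qed.

(** The change-of-variables formula as a property of [P]; for the powers of [A] it will follow from
    biorthogonality. *)
Definition scales_volume P := P \in unitmx /\
  forall E, measurable E -> mu ((fun x => P *m x) @^-1` E) = ((`|\det P|^-1)%:E * mu E)%E.

Lemma scales_volume_sqnorm P f : scales_volume P -> cmeasurable f ->
  L2_sqnorm (dilate P f) = L2_sqnorm f.
Proof.
move=> [uP h] mf; rewrite (dilate_sqnorm _ h) ?invr_ge0//.
by rewrite mulfV ?mul1e// normr_eq0 -unitfE -unitmxE.
Qed.

Lemma dilate_preserving P : scales_volume P -> L2_preserving (dilate P : _ -> 'cV[R]_n -> R[i]).
Proof.
move=> hP; apply: (@L2_preserving_bound _ _ _ 1) => //; first exact: cmeasurable_dilate.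
  by move=> f g; apply/funext => x; rewrite /dilate mulrBr.
by move=> f mf; rewrite mul1e scales_volume_sqnorm.
Qed.

Definition Di P : H -> H := L2op (dilate P).

Lemma DiE P f : scales_volume P -> L2 f -> Di P (toL2 f) = toL2 (dilate P f).
Proof. by move=> hP; apply: L2opE; exact: dilate_preserving. Qed.

Lemma L2_dilate P f : scales_volume P -> L2 f -> L2 (dilate P f).
Proof. by move=> /dilate_preserving [h _]; exact: h. Qed.

Lemma Di_nsq P x : scales_volume P -> nsq (Di P x) = nsq x.
Proof.
move=> hP; move: x; apply: toL2_ind => f Lf.
rewrite (DiE hP Lf) (nsq_toL2 (L2_dilate hP Lf)) (nsq_toL2 Lf).
by case: Lf => mf _; rewrite (scales_volume_sqnorm hP mf).
Qed.

Lemma DiD P (x y : H) : scales_volume P -> Di P (x + y) = Di P x + Di P y.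
Proof.
move=> hP; move: x; apply: toL2_ind => f Lf; move: y; apply: toL2_ind => g Lg.
rewrite [_ + _]toL2_add// (DiE hP (L2D Lf Lg)) (DiE hP Lf) (DiE hP Lg).
rewrite [RHS](toL2_add (L2_dilate hP Lf) (L2_dilate hP Lg)).
by congr toL2; apply/funext => x; rewrite /dilate mulrDr.
Qed.

Lemma dilate_comp P P' f : dilate P (dilate P' f) = dilate (P' *m P) f.
Proof.
apply/funext => x; rewrite /dilate mulrA mulmxA; congr (_ * _).
by rewrite -rmorphM /= -sqrtrM// det_mulmx normrM mulrC.
Qed.

Lemma dilate1 f : dilate 1%:M f = f.
Proof. by apply/funext => x; rewrite /dilate det1 normr1 sqrtr1 mul1r mul1mx. Qed.

Lemma dilate_translate P y f : P \in unitmx ->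
  dilate P (translate y f) = translate (invmx P *m y) (dilate P f).
Proof.
by move=> uP; apply/funext => x; rewrite /dilate /translate mulmxBr mulKVmx.
Qed.

Lemma dilateZ P (c : R[i]) f : dilate P (fun x => c * f x) = fun x => c * dilate P f x.
Proof. by apply/funext => x; rewrite /dilate mulrCA. Qed.

Lemma Di_inv P P' x : scales_volume P -> scales_volume P' -> P *m P' = 1%:M ->
  Di P' (Di P x) = x.
Proof.
move=> hP hP' PP; move: x; apply: toL2_ind => f Lf.
by rewrite (DiE hP Lf) (DiE hP' (L2_dilate hP Lf)) dilate_comp PP dilate1.
Qed.

Lemma Di_adj P P' : scales_volume P -> scales_volume P' -> P *m P' = 1%:M ->
  adj (Di P) (Di P').
Proof.
move=> hP hP' PP; apply: adj_isometry.
- by move=> x y; exact: DiD.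
- by move=> x; exact: Di_nsq.
- move=> x; apply: Di_inv => //; exact: mulmx1C.
Qed.

(** With [c] the unknown volume factor, [dilate P] multiplies squared norms by [|det P| * c], and by
    polarization it multiplies [fip] likewise; two pairings equal to 1 force this product to be
    1. *)
Lemma biorthogonal_scales_volume P f g : P \in unitmx -> L2 f -> L2 g -> fip f g = 1 ->
  fip (dilate P f) (dilate P g) = 1 -> L2 (dilate P f) -> L2 (dilate P g) -> scales_volume P.
Proof.
move=> uP Lf Lg fg dfg Ldf Ldg; split => //; have [c c0 hc] := lebesgue_cV_mulmx uP.
have d0 : 0 < `|\det P| by rewrite normr_gt0 -unitfE -unitmxE.
suff k1 : `|\det P| * c = 1.
  by move=> E mE; rewrite hc// -[c]mul1r -(mulVf (lt0r_neq0 d0)) -mulrA k1 mulr1.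
have k h : L2 h -> L2 (dilate P h) -> nsq (toL2 (dilate P h) : H) = `|\det P| * c * nsq (toL2 h : H).
  move=> Lh Ldh; rewrite (nsq_toL2 Lh) (nsq_toL2 Ldh) (dilate_sqnorm c0 hc (proj1 Lh)).
  by rewrite fineM// ge0_fin_numE ?L2_sqnorm_ge0//; case: Lh.
have aD h h' : L2 h -> L2 h' -> (toL2 h : H) + toL2 h' = toL2 (fun t => h t + h' t) by exact: toL2_add.
rewrite -dfg -(ip_toL2 Ldf Ldg) ip_polar (aD _ _ Ldf Ldg) (toL2B Ldf Ldg).
have -> : (fun t => dilate P f t + dilate P g t) = dilate P (fun t => f t + g t).
  by apply/funext => x; rewrite /dilate mulrDr.
have -> : (fun t => dilate P f t - dilate P g t) = dilate P (fun t => f t - g t).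
  by apply/funext => x; rewrite /dilate mulrBr.
have := ip_polar (toL2 f : H) (toL2 g); rewrite (aD _ _ Lf Lg) (toL2B Lf Lg) (ip_toL2 Lf Lg) fg.
have LD := L2D Lf Lg; have LB := L2B Lf Lg.
have LdD : L2 (dilate P (fun t => f t + g t)).
  by have := L2D Ldf Ldg; congr L2; apply/funext => x; rewrite /dilate mulrDr.
have LdB : L2 (dilate P (fun t => f t - g t)).
  by have := L2B Ldf Ldg; congr L2; apply/funext => x; rewrite /dilate mulrBr.
rewrite (k _ LD LdD) (k _ LB LdB); set x := nsq _; set y := nsq _ => e.
by rewrite -mulrBr -mulrA -e mulr1.
Qed.

End dilations.

(** * Commutation of the projections with translations and dilations *)

Section affine_projections.
Context {R : realType} {n L : nat}.
Variable A : 'M[R]_n.+1.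
Local Notation H := (@L2_hilbert R n.+1).
Local Notation idx := (int * 'cV[int]_n.+1 * 'I_L)%type.
Local Notation fct := ('cV[R]_n.+1 -> R[i]).
Local Notation lp := (@lattice_point R n.+1).
Implicit Types (phi psi : 'I_L -> fct) (f : H).
Hypothesis uA : A \is a GRing.unit.
Hypothesis svA : forall j : int, scales_volume (A ^ j).

Let svA1 : scales_volume A. Proof. by have := svA 1; rewrite expr1z. Qed.
Let svAV : scales_volume (invmx A). Proof. by have := svA (- 1); rewrite exprN1. Qed.
Let uAm : A \in unitmx. Proof. by []. Qed.

Lemma affine_dilate phi j k l :
  dilate A (affine_system A phi (j, k, l)) = affine_system A phi (j + 1, k, l).
Proof. by rewrite /affine_system dilate_comp mulmxE exprzDr// expr1z. Qed.

Lemma affine_translate0 phi k k' l : translate (lp k) (affine_system A phi (0, k', l)) =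
  affine_system A phi (0, k + k', l).
Proof.
rewrite /affine_system expr0z !dilate1; apply/funext => x; rewrite /translate.
by rewrite /lattice_point map_mxD opprD addrA.
Qed.

Lemma L2_affine phi i : (forall l, L2 (phi l)) -> L2 (affine_system A phi i).
Proof. by move=> Lp; case: i => [[j k] l]; apply: L2_dilate => //; exact: L2_translate. Qed.

Definition below (J : int) : pred idx := fun i => i.1.1 < J.

(** For a negative layer the translate stays in the space of negative dilates, which is orthogonal
    to all duals with [j >= 0]. Layer 0, which occurs only for [J = 1], is permuted by the
    translation. *)
Lemma translate_orth phi psi (J : int) k i j (c e : R[i]) : J = 0 \/ J = 1 ->
  (forall l, L2 (phi l)) -> (forall l, L2 (psi l)) ->
  (forall i j, L2_inner (affine_system A phi i) (affine_system A psi j) = (i == j)%:R) ->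
  shift_invariant (negative_dilates A phi) ->
  below J i -> ~~ below J j ->
  fip (fun x => c * translate (lp k) (affine_system A phi i) x)
      (fun x => e * affine_system A psi j x) = 0.
Proof.
move=> J01 Lp Lq bi sh iJ jJ.
have Lpi i' := L2_affine i' Lp; have Lqi i' := L2_affine i' Lq.
have [i0|i0] := boolP (below 0 i).
  have gV : negative_dilates A phi (affine_system A phi i).
    by apply: mem_closed_span => //; exists i.
  have {}gV := sh k _ gV; rewrite fipC.
  apply: (closed_span_orth _ _ _ gV) => //.
    by move=> _ [i' _ <-].
  move=> _ c' e' [i' i'0 <-]; rewrite fipC; apply: inner0_fip => //; rewrite bi.
  case: eqP => // ij; move: jJ; rewrite -ij /below; move: i'0 => /=.
  by case: J01 => ->; [move=> ->|move=> h; rewrite (lt_trans h)].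
have iE : i.1.1 = 0.
  move: i0 iJ; rewrite /below; case: J01 => ->; first by move=> /negP.
  by rewrite -leNgt -[1]add0r ltzD1 => h1 h2; apply/eqP; rewrite eq_le h2.
case: i iE {i0} iJ => [[i1 k'] l] /= -> iJ; rewrite affine_translate0.
apply: inner0_fip => //; rewrite bi; case: eqP => // ij; move: jJ; rewrite -ij.
by move: iJ; rewrite /below /= => ->.
Qed.

Variables (phi psi : 'I_L -> fct) (b : R).
Hypotheses (Lphi : forall l, L2 (phi l)) (Lpsi : forall l, L2 (psi l)).
Let F := nframe (affine_system A phi : idx -> fct).
Let G := nframe (affine_system A psi : idx -> fct).
Hypothesis bi : forall i j,
  L2_inner (affine_system A phi i) (affine_system A psi j) = (i == j)%:R.
Hypothesis bi' : forall i j,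
  L2_inner (affine_system A psi i) (affine_system A phi j) = (i == j)%:R.
Hypothesis bio : biorthogonal F G b.
Hypothesis sh : shift_invariant (negative_dilates A phi).
Hypothesis sh' : shift_invariant (negative_dilates A psi).

Let P J := bproj F G (iset (below J)).
Let Lr chi (j : idx * bool) : (forall l, L2 (chi l)) -> L2 (rframe (affine_system A chi) j).
Proof. by move=> Lc; apply: L2_rframe => i; exact: L2_affine. Qed.

Lemma bproj_shift J k f : J = 0 \/ J = 1 -> Tr (lp k) (P J f) = P J (Tr (lp k) f).
Proof.
move=> J01; apply: (nframe_intertwine bio (Tr_adj _)) => i c j e iJ jJ.
  rewrite (TrE _ (Lr (i, c) Lphi)) (ip_toL2 (L2_translate _ (Lr (i, c) Lphi)) (Lr (j, e) Lpsi)).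
  exact: (translate_orth k (cunit c) (cunit e) J01 Lphi Lpsi bi sh iJ jJ).
rewrite Tr_adj (TrE _ (Lr (j, e) Lpsi)) (ip_toL2 (Lr (i, c) Lphi) (L2_translate _ (Lr (j, e) Lpsi))).
rewrite fipC -[- lp k](_ : lp (- k) = _); last by rewrite /lattice_point map_mxN.
exact: (translate_orth (- k) (cunit e) (cunit c) J01 Lpsi Lphi bi' sh' jJ iJ).
Qed.

Lemma bproj_dilate J f : Di A (P J f) = P (J + 1) (Di A f).
Proof.
have key i j (c e : bool) : (i.1.1 + 1, i.1.2, i.2) <> j ->
    ip (Di A (toL2 (rframe (affine_system A phi) (i, c))))
       (toL2 (rframe (affine_system A psi) (j, e)) : H) = 0.
  case: i => [[j1 k] l] /= ij.
  rewrite (DiE svA1 (Lr (j1, k, l, c) Lphi)).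
  rewrite (ip_toL2 (L2_dilate svA1 (Lr (j1, k, l, c) Lphi)) (Lr (j, e) Lpsi)).
  rewrite [rframe (affine_system A phi) _]/rframe dilateZ affine_dilate.
  apply: inner0_fip; [exact: L2_affine|exact: L2_affine|].
  by rewrite bi; case: eqP.
apply: (nframe_intertwine bio (Di_adj svA1 svAV (mulmxV uAm))) => i c j e; rewrite /below => iJ jJ;
  apply: key => ij; move: iJ jJ; rewrite -ij /= ltrD2r.
  by move=> ->.
by move=> /negPf ->.
Qed.

Lemma Di_Tr y x : Di A (Tr y x) = Tr (invmx A *m y) (Di A x).
Proof.
move: x; apply: toL2_ind => f Lf.
rewrite (TrE y Lf) (DiE svA1 (L2_translate y Lf)) (DiE svA1 Lf) (TrE _ (L2_dilate svA1 Lf)).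
by rewrite dilate_translate.
Qed.

Lemma Di_inj x y : Di A x = Di A y -> x = y.
Proof. by move=> h; rewrite -(Di_inv x svA1 svAV (mulmxV uAm)) h Di_inv// mulmxV. Qed.

Lemma bproj_shift_mul k f : Tr (A *m lp k) (P 0 f) = P 0 (Tr (A *m lp k) f).
Proof.
apply: Di_inj; rewrite Di_Tr !bproj_dilate Di_Tr mulKmx// add0r.
by rewrite bproj_shift//; right.
Qed.

Lemma bproj0_shift k k' f :
  Tr (lp k + A *m lp k') (P 0 f) = P 0 (Tr (lp k + A *m lp k') f).
Proof.
rewrite -!TrTr bproj_shift_mul.
by rewrite bproj_shift//; left.
Qed.

(** Supplies [P 1] with arbitrarily small translations: conjugation by the dilation carries those of
    [P 0] over through [invmx A]. *)
Lemma bproj1_shift y : (forall f, Tr y (P 0 f) = P 0 (Tr y f)) ->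
  forall f, Tr (invmx A *m y) (P 1 f) = P 1 (Tr (invmx A *m y) f).
Proof.
move=> h f; have fE : f = Di A (Di (invmx A) f) by rewrite Di_inv// mulVmx.
by rewrite fE -[1]add0r -bproj_dilate -!Di_Tr -bproj_dilate h.
Qed.

End affine_projections.

(** * Characters and the decay of the dual wavelets *)

Section unimodular_characters.
Context {R : realType}.
Implicit Types t u : R.

Definition cis t : R[i] := Complex (cos t) (sin t).

Lemma cisD t u : cis (t + u) = cis t * cis u.
Proof. by apply: complex_ext; rewrite ?reM ?imM /= ?cosD ?sinD; ring. Qed.

Lemma cis_conj t : conjc (cis t) = cis (- t).
Proof. by rewrite /cis cosN sinN. Qed.

Lemma cis0 : cis 0 = 1.
Proof. by rewrite /cis cos0 sin0. Qed.

Lemma csq_cis t : csq (cis t) = 1.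
Proof. by rewrite /csq /= cos2Dsin2. Qed.

Lemma cos_ge1B t : 1 - `|t| <= cos t.
Proof.
wlog t0 : t / 0 < t.
  move=> h; have [t0|t0|->] := ltgtP t 0; last by rewrite normr0 cos0 subr0.
    by rewrite -cosN -normrN; apply: h; rewrite oppr_gt0.
  exact: h.
have [c] := @MVT R cos (fun x => - sin x) 0 t t0 (fun x _ => is_derive_cos x)
  (continuous_subspaceT (@continuous_cos R)).
rewrite in_itv /= => /andP[c0 ct]; rewrite cos0 subr0 gtr0_norm// => e.
have := sin_le1 c; have : sin c * t <= t -> 1 - t <= cos t by lra.
by move=> h h1; apply: h; rewrite ger_pMl.
Qed.

(** The left side is at most 4 and at most [2 * |t|], and [X ^+ N <= X] when [X < 1]. The exponent
    [N] allows a phase that grows fast to be charged to an [N]-th root of its size. *)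
Lemma csq_cisB1 t (X : R) N : (0 < N)%N -> `|t| <= X ^+ N -> 0 <= X -> csq (cis t - 1) <= 4 * X.
Proof.
move=> N0 tX X0; have e : csq (cis t - 1) = 2 - 2 * cos t.
  rewrite /csq reD imD reN imN /=; have := cos2Dsin2 t; lra.
rewrite e; have := cos_ge1B t; have := cos_geN1 t.
have [X1|X1] := leP 1 X; first by lra.
have : X ^+ N <= X by case: N N0 {tX} => // N _; rewrite exprS ler_piMr// exprn_ile1// ltW.
by lra.
Qed.

End unimodular_characters.

(** The integral of a nonnegative function is a supremum over the simple functions below it, and a
    larger function admits more of them. *)
Lemma ge0_integral_mono {d} {T : measurableType d} {R : realType}
    (m : {measure set T -> \bar R}) (f g : T -> \bar R) :
  (forall x, 0 <= f x)%E -> (forall x, f x <= g x)%E ->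
  (\int[m]_x f x <= \int[m]_x g x)%E.
Proof.
move=> f0 fg; have g0 x : (0 <= g x)%E by exact: le_trans (fg x).
rewrite !ge0_integralTE//; apply: ereal_sup_le => _ [h /= hf <-].
by exists h => // x; exact: le_trans (fg x).
Qed.

Section decay.
Context {R : realType} {n : nat}.
Variables (A : 'M[R]_n.+1) (rho : 'cV[R]_n.+1 -> R).
Hypotheses (hA : expansive A) (hrho : quasi_norm A rho).
Hypothesis svA : forall j : int, scales_volume (A ^ j).
Local Notation a := `|\det A|.
Local Notation B := A^-1.
Local Notation mu := (@lebesgue_cV R n.+1).
Let a1 : 1 < a := expansive_det hA.
Let a0 : 0 < a. Proof. exact: lt_trans a1. Qed.
Let uA : A \is a GRing.unit := expansive_unit hA.

(** The image of a ball under [A ^+ i], written as a preimage for the sake of measurability. *)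
Definition dilated_ball (r : R) (i : nat) : set 'cV[R]_n.+1 :=
  [set x | cV_ball r (B ^+ i *m x)].

Lemma measurable_dilated_ball r i : measurable (dilated_ball r i).
Proof.
rewrite -[dilated_ball r i]setTI; apply: measurable_cV_mulmx => //.
exact: measurable_cV_ball.
Qed.

Lemma lebesgue_dilated_ball r i : 0 <= r ->
  mu (dilated_ball r i) = (a ^+ i * (r + r) ^+ n.+1)%:E.
Proof.
move=> r0; have [_ h] := svA (- i%:Z); have := h (cV_ball r) (measurable_cV_ball r).
have -> : A ^ (- i%:Z) = B ^+ i by rewrite -exprnN -exprVn.
rewrite lebesgue_cV_ball// -EFinM => ->; congr ((_ * _)%:E).
have e : \det (A ^+ i) * \det (B ^+ i) = 1.
  by rewrite -det_mulmx mulmxE exprVn mulrV ?det1// unitrX.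
have ai : \det (A ^+ i) = (\det A) ^+ i.
  by elim: (i) => [|k IH]; rewrite ?expr0 ?det1// !exprS -mulmxE det_mulmx IH.
have d0 : \det (A ^+ i) != 0 by rewrite ai expf_neq0// -normr_gt0.
have -> : \det (B ^+ i) = (\det (A ^+ i))^-1.
  by apply: (mulfI d0); rewrite e mulfV.
by rewrite normfV invrK ai normrX.
Qed.

(** [A^-1 ^+ i] maps the unit box into a ball of radius [K], uniformly in [i]. So thickening the
    dilated unit ball by a box stays within the dilated ball of radius [1 + K], whose volume is
    proportional to [a ^+ i]. *)
Lemma dilated_ball_count : exists2 c : R, 0 <= c & forall i x,
  (\esum_(k in [set: 'cV[int]_n.+1]) (\1_(dilated_ball 1 i) (x - lattice_point k)%R : R)%:E
     <= (c * a ^+ i)%:E)%E.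
Proof.
have [K [lam [K1 l0 l1 hK]]] := expansive_contraction hA hrho.
have K0 : 0 <= 1 + K by lra.
exists ((1 + K + (1 + K)) ^+ n.+1); first by rewrite exprn_ge0// addr_ge0.
move=> i x; rewrite mulrC -lebesgue_dilated_ball//.
apply: lattice_count; first exact: measurable_dilated_ball.
move=> z q zE qQ; rewrite /dilated_ball /=; apply/cV_ballE => //.
rewrite mulmxDr; apply: le_trans (ler_normD _ _) _; apply: lerD.
  by apply/cV_ballE.
apply: le_trans (hK i q) _.
have q1 : `|q| <= 1.
  apply/cV_norm_le => // j; have := qQ j; rewrite /= in_itv /= add0r => /andP[q0 q1].
  by rewrite ger0_norm// ltW.
have li : lam ^+ i <= 1 by rewrite exprn_ile1// ltW.
rewrite -[leRHS]mulr1; apply: ler_pM => //.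
- by rewrite mulr_ge0// ?exprn_ge0 ?ltW//; lra.
- by rewrite ler_piMr//; lra.
Qed.

Lemma dilated_ball_cover x : exists i, dilated_ball 1 i x.
Proof.
have [K [lam [K1 l0 l1 hK]]] := expansive_contraction hA hrho.
have li : 1 < lam^-1 by rewrite invf_gt1.
have [i hi] := expr_unbounded (K * `|x|) li; exists i; apply/cV_ballE => //.
apply: le_trans (hK i x) _; rewrite mulrAC -ler_pdivlMr ?exprn_gt0//.
by rewrite mul1r -exprVn ltW.
Qed.

(** One index before the first hit, [A^-1 ^+ i *m x] is still outside the open unit ball, where
    [rho] is at least [c0]. The missing step costs the factor [a], and the minimum with 1 covers
    [iota x = 0]. *)
Lemma rho_growth (iota : 'cV[R]_n.+1 -> nat) :
  (forall x i, (i < iota x)%N -> ~ dilated_ball 1 i x) ->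
  exists2 c : R, 0 < c & forall x, c * a ^+ iota x <= 1 + rho x.
Proof.
move=> miniota; have [c0 c00 hc] := rho_lower hA hrho.
have r0 x : 0 <= rho x by exact: quasi_norm_ge0 hrho x.
have m0 : 0 < Num.min 1 (c0 / a) by rewrite lt_min ltr01 divr_gt0.
exists (Num.min 1 (c0 / a)) => // x.
case e : (iota x) => [|i].
  by rewrite expr0 mulr1; apply: le_trans (_ : 1 <= _); rewrite ?ge_min ?lexx// lerDl.
have nb : 1 <= `|B ^+ i *m x|.
  rewrite leNgt; apply/negP => h; apply: (miniota x i); first by rewrite e.
  by apply/cV_ballE => //; exact: ltW.
have : c0 * a ^+ i <= rho x.
  by rewrite -(rho_expV hA hrho i x) mulrC ler_pM2l ?exprn_gt0//; exact: hc.
have : Num.min 1 (c0 / a) * a ^+ i.+1 <= c0 * a ^+ i.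
  rewrite exprS mulrA; apply: ler_wpM2r; first by rewrite exprn_ge0.
  by rewrite -ler_pdivlMr// ge_min lexx orbT.
lra.
Qed.

(* The weight [v] is summable over the lattice, and the decay of [psi] exceeds
   [v ^ -2] by the factor needed to absorb the oscillation of the character
   [x |-> cis (t * x i0)]. *)
Lemma decay_weights (L : nat) (psi : 'I_L -> 'cV[R]_n.+1 -> R[i]) (eta : R) (i0 : 'I_n.+1) :
  1 < eta -> (forall l, weighted_L2 (fun x => (1 + rho x) `^ eta) (psi l)) ->
  exists (v w : 'cV[R]_n.+1 -> R) (C : R) (W lam : R),
    [/\ [/\ measurable_fun setT v, forall x, 0 <= v x <= 1 & forall x, v x * w x = 1],
        0 <= C /\ (forall x, (\esum_(k in [set: 'cV[int]_n.+1]) (v (x - lattice_point k)%R ^+ 2)%:E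
          <= C%:E)%E),
        [/\ 0 <= W, 0 <= lam & lam < 1],
        measurable_fun setT w &
        forall d : R, 0 < d -> exists2 t0 : R, 0 < t0 & forall (t : R) l (j : nat), `|t| <= t0 ->
          (L2_sqnorm (fun x => (w x)%:C%C * ((cis (t * (B ^+ j *m x) i0 ord0) - 1) * psi l x))%R
             <= (d * lam ^+ j * W)%:E)%E].
Proof.
move=> eta1 hpsi.
have [iota [S1 S2 miota]] := first_index (measurable_dilated_ball 1) dilated_ball_cover.
have [cc cc0 hcc] := dilated_ball_count.
have [cr cr0 hcr] := rho_growth S2.
have [K [lam [K1 l0 l1 hK]]] := expansive_contraction hA hrho.
have [Lam L1 hL] := mulmx_norm_bound A; have L0 := le_trans ler01 L1.
(* The excess decay is split in two: [a * p * p] is [a] to the power [eta]. One [p] makes [v ^+ 2],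
   a power of [(a * p)^-1], summable against counts growing like [a ^+ i]; the other pays for the
   oscillation. *)
pose p := a `^ ((eta - 1) / 2).
have e2 : 0 < (eta - 1) / 2 by rewrite divr_gt0// subr_gt0.
have p1 : 1 < p.
  rewrite /p; have := @gt0_ltr_powR R _ e2 1 a; rewrite powR1; apply; rewrite ?nnegrE ?ler01//.
have p0 : 0 < p by exact: lt_trans p1.
have ap : a * p * p = a `^ eta.
  rewrite -mulrA /p -powRD; last by rewrite (gt_eqF a0) implybT.
  rewrite -{1}[a]powRr1 ?ltW// -powRD; last by rewrite (gt_eqF a0) implybT.
  by congr (_ `^ _); lra.
pose s := Num.sqrt (a * p)^-1.
have ap0 : 0 < a * p by rewrite mulr_gt0.
have ap1 : 1 < a * p by apply: mulr_egt1.
have s0 : 0 < s by rewrite sqrtr_gt0 invr_gt0.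
have s2 : s ^+ 2 = (a * p)^-1 by rewrite sqr_sqrtr// invr_ge0 ltW.
have s1 : s <= 1.
  rewrite -(@expr_le1 _ 2)//; last exact: ltW.
  by rewrite s2 invf_le1// ltW.
have aeta0 : 0 <= a `^ eta by exact: powR_ge0.
pose om x := (a `^ eta) ^+ iota x.
have om0 x : 0 <= om x by rewrite exprn_ge0.
have mom : measurable_fun setT om := miota _ _ (fun i => (a `^ eta) ^+ i : measurableTypeR R).
have cmpsi l : cmeasurable (psi l) by case: (hpsi l).
have mg l : measurable_fun setT (fun x => (om x * csq (psi l x))%:E).
  by apply/measurable_EFinP; apply: measurable_funM => //; exact: measurable_csq.
have g0 l x : (0 <= (om x * csq (psi l x))%:E :> \bar R)%E by rewrite lee_fin mulr_ge0// csq_ge0.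
pose Wl l := (\int[mu]_x (om x * csq (psi l x))%:E)%E.
have Wl0 l : (0 <= Wl l)%E by apply: integral_ge0 => x _; exact: g0.
have Wfin l : (Wl l < +oo)%E.
  have ce0 : 0 < cr `^ eta by exact: powR_gt0.
  suff h : ((cr `^ eta)%:E * Wl l < +oo)%E.
    move: h; case: (Wl l) (Wl0 l) => [r _ _| |]//=; first by rewrite ltry.
    by rewrite gt0_muley ?lte_fin.
  have [_ hw] := hpsi l; apply: le_lt_trans hw.
  rewrite /Wl -ge0_integralZl//; last by rewrite lee_fin ltW.
  apply: ge0_integral_mono => x.
    by rewrite mule_ge0// lee_fin ltW.
  rewrite -EFinM lee_fin csqE mulrA mulrC; apply: ler_wpM2l; first exact: csq_ge0.
  have -> : cr `^ eta * om x = (cr * a ^+ iota x) `^ eta.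
    rewrite powRM; [|exact: ltW|by rewrite exprn_ge0// ltW]; congr (_ * _).
    rewrite /om -powR_mulrn// -powRrM mulrC powRrM powR_mulrn// ltW//.
  apply: ge0_ler_powR; rewrite ?nnegrE.
  - by apply: le_trans (ltW eta1).
  - by rewrite mulr_ge0 ?exprn_ge0 ?ltW.
  - by rewrite addr_ge0//; exact: quasi_norm_ge0 hrho x.
  - exact: hcr.
(* The norm of [x] may grow like [Lam ^+ iota x], which is within the [N]-th power of the affordable
   [p ^+ iota x]. *)
have [N0 hN0] := expr_unbounded Lam p1.
pose N := N0.+1.
have hN : Lam <= p ^+ N.
  by apply: ltW; apply: lt_le_trans hN0 _; rewrite exprS ler_peMl ?exprn_ge0 ?ltW.
have Nr : 0 < N%:R :> R by rewrite ltr0n.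
have N1 : 1 <= N%:R :> R by rewrite ler1n.
(* A substitute for the [N]-th root of [lam], again by Bernoulli. *)
pose lam' := 1 - (1 - lam) / N%:R.
have lN0 : 0 < (1 - lam) / N%:R by rewrite divr_gt0// subr_gt0.
have lN1 : (1 - lam) / N%:R <= 1 - lam by rewrite ler_pdivrMr// ler_peMr// subr_ge0 ltW.
have hlam' : lam <= lam' ^+ N.
  have := @bernoulli_ineq R (- ((1 - lam) / N%:R)) N _; rewrite -/lam'.
  have -> : N%:R * - ((1 - lam) / N%:R) = lam - 1 by field; rewrite gt_eqF.
  by move=> h; apply: le_trans (h _); lra.
exists (fun x => s ^+ iota x), (fun x => s^-1 ^+ iota x), (cc / (1 - (a * p)^-1 * a)).
exists (4 * \sum_l fine (Wl l)), lam'.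
have ra : (a * p)^-1 * a = p^-1 by field; rewrite !gt_eqF.
split.
- split.
  + exact: (miota _ _ (fun i => s ^+ i : measurableTypeR R)).
  + by move=> x; apply/andP; split; [exact/exprn_ge0/ltW|apply: exprn_ile1 => //; exact: ltW].
  + by move=> x; rewrite -exprMn mulfV ?expr1n// gt_eqF.
- split; first by rewrite divr_ge0// subr_ge0 ra invf_le1// ltW.
  move=> x; have ap0' : 0 <= (a * p)^-1 by rewrite invr_ge0 ltW.
  have r1 : (a * p)^-1 * a < 1 by rewrite ra invf_lt1.
  have := lattice_sum_index ap0' cc0 (ltW a0) r1 S1 hcc x.
  congr (_ <= _)%E; apply: eq_esum => k _.
  by rewrite -exprM mulnC exprM s2.
- split; last by rewrite /lam'; lra.
    by rewrite mulr_ge0// sumr_ge0// => l _; exact: fine_ge0.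
  by rewrite /lam'; lra.
- exact: (miota _ _ (fun i => s^-1 ^+ i : measurableTypeR R)).
(* With this threshold the phase is at most the [N]-th power of [d * lam' ^+ j * p ^+ iota x]; the
   divisor cancels the constant of the contraction. *)
move=> d d0; exists (d ^+ N / K); first by rewrite divr_gt0 ?exprn_gt0//; lra.
move=> t l j tt0.
have lam'0 : 0 <= lam' by rewrite /lam'; lra.
have X0 x : 0 <= d * lam' ^+ j * p ^+ iota x.
  by rewrite !mulr_ge0 ?exprn_ge0// ltW.
have osc x : csq (cis (t * (B ^+ j *m x) i0 ord0) - 1) <= 4 * (d * lam' ^+ j * p ^+ iota x).
  apply: (@csq_cisB1 _ _ _ N) => //; rewrite normrM.
  have hx : `|x| <= Lam ^+ iota x.
    have hLe i (y : 'cV[R]_n.+1) : `|A ^+ i *m y| <= Lam ^+ i * `|y|.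
      elim: i => [|i IH]; first by rewrite !expr0 mul1mx mul1r.
      rewrite !exprS -mulmxE -mulmxA -mulrA; apply: le_trans (hL _) _.
      by apply: ler_wpM2l IH; lra.
    have := mulmx_expVr hA (iota x) 0 x; rewrite addn0 expr0 mul1mx => xE.
    rewrite -[leLHS](congr1 Num.norm xE); apply: le_trans (hLe _ _) _; rewrite -[leRHS]mulr1.
    apply: ler_wpM2l; first by rewrite exprn_ge0//; lra.
    by apply/cV_ballE => //; exact: S1.
  have h1 : `|(B ^+ j *m x) i0 ord0| <= K * lam ^+ j * Lam ^+ iota x.
    apply: le_trans (cV_coord_le _ _) _; apply: le_trans (hK j x) _.
    by apply: ler_wpM2l => //; rewrite mulr_ge0 ?exprn_ge0 ?ltW//; lra.
  apply: le_trans (_ : d ^+ N / K * (K * lam ^+ j * Lam ^+ iota x) <= _).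
    by apply: ler_pM.
  have -> : d ^+ N / K * (K * lam ^+ j * Lam ^+ iota x) = d ^+ N * (lam ^+ j * Lam ^+ iota x).
    by field; rewrite gt_eqF//; lra.
  rewrite -mulrA exprMn; apply: ler_wpM2l; first by rewrite exprn_ge0// ltW.
  rewrite exprMn -!exprM ![(_ * N)%N]mulnC !exprM; apply: ler_pM.
  - by rewrite exprn_ge0// ltW.
  - by rewrite exprn_ge0//; lra.
  - by apply: lerXn2r; rewrite ?nnegrE ?exprn_ge0//; exact: ltW.
  - by apply: lerXn2r; rewrite ?nnegrE ?exprn_ge0//; exact: ltW.
have si x : (s^-1 ^+ iota x) ^+ 2 = (a * p) ^+ iota x.
  by rewrite -exprM mulnC exprM exprVn s2 invrK.
apply: (@le_trans _ _ ((4 * d * lam' ^+ j)%:E * Wl l)%E); last first.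
  have -> : Wl l = (fine (Wl l))%:E by rewrite fineK// ge0_fin_numE.
  rewrite -EFinM lee_fin; have -> : 4 * d * lam' ^+ j * fine (Wl l) = d * lam' ^+ j * (4 * fine (Wl l)) by ring.
  apply: ler_wpM2l; first by rewrite mulr_ge0 ?exprn_ge0// ltW.
  rewrite ler_pM2l// (bigD1 l)//= lerDl sumr_ge0// => k _; exact: fine_ge0.
rewrite L2_sqnormE /Wl -ge0_integralZl//; last first.
  by rewrite lee_fin !mulr_ge0 ?exprn_ge0// ltW.
apply: ge0_integral_mono => x; first by rewrite lee_fin csq_ge0.
rewrite -EFinM lee_fin !csqM csqC si.
have -> : 4 * d * lam' ^+ j * (om x * csq (psi l x)) =
    (a * p) ^+ iota x * (4 * (d * lam' ^+ j * p ^+ iota x) * csq (psi l x)).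
  by rewrite /om -ap exprMn; ring.
apply: ler_wpM2l; first by rewrite exprn_ge0// ltW.
by apply: ler_wpM2r; rewrite ?csq_ge0.
Qed.

End decay.

Section esum_indices.
Context {R : realType}.
Local Open Scope ereal_scope.

Lemma esum_nat_pickle (I : countType) (F : nat -> \bar R) : (forall m, 0 <= F m) ->
  (forall m, @pickle_inv I m = None -> F m = 0) ->
  \esum_(m in [set: nat]) F m = \esum_(i in [set: I]) F (pickle i).
Proof.
move=> F0 h; rewrite (esum_pickle (F := fun i => F (pickle i)))//.
rewrite -nneseries_esumT//; apply: eq_eseriesr => m _.
case e : pickle_inv => [i|] /=; last exact: h.
by have := @pickle_invK I m; rewrite e /= => ->.
Qed.

Lemma esum_prod (T1 T2 : choiceType) (F : T1 * T2 -> \bar R) : (forall x, 0 <= F x) ->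
  \esum_(x in [set: T1 * T2]) F x = \esum_(x1 in [set: T1]) \esum_(x2 in [set: T2]) F (x1, x2).
Proof.
move=> F0; rewrite (@esum_esum R T1 T2 setT (fun=> setT) (fun x y => F (x, y)))//.
have -> : [set: T1] `*`` (fun=> [set: T2]) = [set: T1 * T2] by apply/seteqP.
by apply: eq_esum => -[].
Qed.

Lemma esum_fin (T : finType) (F : T -> \bar R) : (forall x, 0 <= F x) ->
  \esum_(x in [set: T]) F x = \sum_x F x.
Proof.
move=> F0; rewrite esum_fset//; last exact: finite_finset.
have -> : [set: T] = [set` index_enum T].
  by apply/seteqP; split => x //= _; exact: mem_index_enum.
by rewrite -fsbig_seq ?index_enum_uniq.
Qed.

Lemma esum_int_ge0 (F : int -> \bar R) : (forall j, 0 <= F j) ->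
  (forall j, (j < 0)%R -> F j = 0) ->
  \esum_(j in [set: int]) F j = \esum_(i in [set: nat]) F i%:Z.
Proof.
move=> F0 h; have inj : set_inj [set: nat] (fun i : nat => i%:Z) by move=> i k _ _ [].
rewrite -(esum_image _ _ F inj) [RHS]esum_mkcond; apply: eq_esum => j _.
case: ifPn => // /negP; rewrite inE /= => nj; apply: h; case: j nj => // j nj.
by exfalso; apply: nj; exists j.
Qed.

End esum_indices.

(** * Leak of a modulated vector out of the range of the projection *)

Section leak.
Context {R : realType} {n L : nat}.
Variables (A : 'M[R]_n.+1).
Hypothesis uA : A \is a GRing.unit.
Hypothesis svA : forall j : int, scales_volume (A ^ j).
Local Notation H := (@L2_hilbert R n.+1).
Local Notation idx := (int * 'cV[int]_n.+1 * 'I_L)%type.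
Local Notation fct := ('cV[R]_n.+1 -> R[i]).
Local Notation lp := (@lattice_point R n.+1).
Local Notation B := A^-1.
Implicit Types (phi psi : 'I_L -> fct).

Lemma esum_affine_index (F : idx * bool -> \bar R) : (forall x, 0 <= F x)%E ->
  (\esum_(x in [set: idx * bool]) F x = \esum_(e in [set: bool]) \esum_(l in [set: 'I_L])
     \esum_(j in [set: int]) \esum_(k in [set: 'cV[int]_n.+1]) F (j, k, l, e))%E.
Proof.
move=> F0; rewrite esum_prod// esum_exchange//; apply: eq_esum => e _.
rewrite esum_prod// esum_exchange//; apply: eq_esum => l _.
by rewrite esum_prod.
Qed.

Definition char (i0 : 'I_n.+1) (t : R) : fct := fun x => cis (t * x i0 ord0).

Lemma charD i0 t x y : char i0 t (x + y) = char i0 t x * char i0 t y.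
Proof. by rewrite /char mxE mulrDr cisD. Qed.

Lemma char_conj i0 t x : conjc (char i0 t x) = char i0 (- t) x.
Proof. by rewrite /char cis_conj mulNr. Qed.

Lemma cmeasurable_char i0 t : cmeasurable (char i0 t).
Proof.
have m1 : measurable_fun setT (fun x : 'cV[R]_n.+1 => t * cV_coord i0 x).
  by apply: measurable_funM => //; exact: measurable_cV_coord.
split.
  have mc := continuous_measurable_fun (@continuous_cos R); exact: (measurableT_comp mc m1).
have mc := continuous_measurable_fun (@continuous_sin R); exact: (measurableT_comp mc m1).
Qed.

Lemma bounded_char i0 t : bounded_mul (char i0 t).
Proof. by split; [exact: cmeasurable_char|move=> x; rewrite csq_cis]. Qed.

Lemma fip_dilate_adj (P P' : 'M[R]_n.+1) (f g : fct) : scales_volume P -> scales_volume P' ->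
  P *m P' = 1%:M -> L2 f -> L2 g -> fip f (dilate P g) = fip (dilate P' f) g.
Proof.
move=> hP hP' PP Lf Lg.
rewrite -(ip_toL2 Lf (L2_dilate hP Lg)) -(ip_toL2 (L2_dilate hP' Lf) Lg).
by rewrite -(DiE hP Lg) -(DiE hP' Lf) ipC (Di_adj hP hP' PP) ipC.
Qed.

(** In the coordinates of layer [j] the character is its value at the lattice point times its value
    at the displacement. Since [F0] is orthogonal to the layer, 1 may be subtracted from the second
    factor, and [lattice_bessel] applies to the small remainder. *)
Lemma modulated_coefficients psi (v w : 'cV[R]_n.+1 -> R) (C : R) i0 t (F0 : fct) (j : nat) l e :
  0 <= C -> measurable_fun setT v -> (forall x, 0 <= v x <= 1) -> (forall x, v x * w x = 1) ->
  (forall x, (\esum_(k in [set: 'cV[int]_n.+1]) (v (x - lp k) ^+ 2)%:E <= C%:E)%E) ->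
  L2 F0 -> L2 (psi l) ->
  L2 (fun x => (w x)%:C%C * ((cis (- t * (B ^+ j *m x) i0 ord0) - 1) * psi l x)) ->
  (forall k (c : R[i]), fip F0 (fun x => c * affine_system A psi (j%:Z, k, l) x) = 0) ->
  (\esum_(k in [set: 'cV[int]_n.+1])
     (fip (fun x => char i0 t x * F0 x) (rframe (affine_system A psi) ((j%:Z, k, l), e)) ^+ 2)%:E <=
   C%:E * (L2_sqnorm F0 * L2_sqnorm
     (fun x => (w x)%:C%C * ((cis (- t * (B ^+ j *m x) i0 ord0) - 1) * psi l x))%R))%E.
Proof.
move=> C0 mv v01 vw vC LF Lp Lw orth.
pose th (x : 'cV[R]_n.+1) : R[i] := cis (- t * (B ^+ j *m x) i0 ord0).
have thE x : th x = char i0 (- t) (B ^+ j *m x) by [].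
pose g x := (th x - 1) * psi l x.
have mth : cmeasurable th.
  apply: (cmeasurable_comp (f := char i0 (- t)) (T := fun x => B ^+ j *m x)).
    exact: measurable_cV_mulmx.
  exact: cmeasurable_char.
have Lg : L2 g.
  apply: (@L2_mul _ _ _ _ 4) => //.
    by apply: cmeasurableD => //; exact: cmeasurable_cst.
  move=> x; rewrite /csq reD imD reN imN /=.
  set u := - t * _; have := cos2Dsin2 u; have := cos_geN1 u; lra.
have AB : A ^ j%:Z *m A ^ (- j%:Z) = 1%:M.
  by rewrite -exprnN mulmxE mulrV// unitrX.
have ABE : A ^ (- j%:Z) = B ^+ j by rewrite -exprnN exprVn.
have LD := L2_dilate (svA (- j%:Z)) LF.
pose c k : R[i] := cunit e * th (lp k).
have c1 k : csq (c k) = 1 by rewrite csqM csq_cunit mul1r csq_cis.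
have key k : fip (fun x => char i0 t x * F0 x) (rframe (affine_system A psi) ((j%:Z, k, l), e)) =
    fip (dilate (A ^ (- j%:Z)) F0) (fun x => c k * translate (lp k) g x).
  have La : L2 (affine_system A psi (j%:Z, k, l)).
    exact: (L2_dilate (svA _) (L2_translate _ Lp)).
  have Lcg : L2 (fun x => c k * translate (lp k) g x) by exact/L2Z/L2_translate.
  have Ld := L2_dilate (svA j%:Z) Lcg.
  rewrite -(fip_dilate_adj (svA j%:Z) (svA (- j%:Z)) AB LF Lcg) fip_mul.
  have -> : (fun x => conjc (char i0 t x) * rframe (affine_system A psi) ((j%:Z, k, l), e) x) =
      (fun x => dilate (A ^ j%:Z) (fun x => c k * translate (lp k) g x) x +
        c k * affine_system A psi (j%:Z, k, l) x).
    apply/funext => x; rewrite char_conj /rframe /affine_system /dilate /translate /=.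
    set y := A ^ j%:Z *m x; have -> : char i0 (- t) x = th (lp k) * th (y - lp k).
      rewrite !thE -charD -mulmxDr addrC subrK /y -ABE mulmxA.
      by rewrite (mulmx1C AB) mul1mx.
    by rewrite /g /c /y; ring.
  rewrite fipC (fipDl Ld (L2Z (c k) La) LF) [X in _ + X]fipC orth addr0.
  exact: fipC.
apply: le_trans (_ : \esum_(k in [set: 'cV[int]_n.+1])
    (fip (dilate (A ^ (- j%:Z)) F0) (fun x => c k * translate (lp k) g x) ^+ 2)%:E <= _)%E.
  by apply: le_esum => k _; rewrite key.
have := lattice_bessel C0 mv v01 vw vC LD Lg Lw c1.
by rewrite (scales_volume_sqnorm (svA (- j%:Z)) (proj1 LF)).
Qed.

Variables (phi psi : 'I_L -> fct) (b : R).
Hypotheses (Lphi : forall l, L2 (phi l)) (Lpsi : forall l, L2 (psi l)).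
Let F := nframe (affine_system A phi : idx -> fct).
Let G := nframe (affine_system A psi : idx -> fct).
Hypothesis bio : biorthogonal F G b.
Let P J := bproj F G (iset (@below n L J)).

(** What leaves the range of [P J] is seen by the layers [j >= J] only. These are nonnegative, so
    their wavelets are contracted by [A^-1 ^+ j], the character hardly varies on them, and the
    contributions sum geometrically. *)
Lemma modulation_leak (rho : 'cV[R]_n.+1 -> R) (eta : R) i0 (J : int) :
  expansive A -> quasi_norm A rho -> 1 < eta ->
  (forall l, weighted_L2 (fun x => (1 + rho x) `^ eta) (psi l)) -> 0 <= J ->
  forall eps : R, 0 < eps -> exists2 t0 : R, 0 < t0 & forall t (f : H), `|t| <= t0 ->
    nsq (Mu (char i0 t) (P J f) - P J (Mu (char i0 t) (P J f))) <= eps * nsq (P J f).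
Proof.
move=> hA hrho eta1 hpsi J0 eps eps0.
have [v [w [C [W [lam [[mv v01 vw] [C0 vC] [W0 lam0 lam1] mw hd]]]]]] :=
  decay_weights hA hrho svA i0 eta1 hpsi.
have b0 : 0 <= b := biorth_ge0 bio.
(* The leak will be at most [Z * d * nsq x]: the frame bound, two real vectors per complex one, [L]
   generators, and the geometric sum over the layers. *)
pose Z := b * (2 * L%:R * (C * W / (1 - lam))).
have Z0 : 0 <= Z by rewrite /Z !mulr_ge0 ?invr_ge0 ?subr_ge0// ltW.
pose d := eps / (Z + 1).
have d0 : 0 < d by rewrite divr_gt0// ltr_wpDl.
have [t0 t00 ht] := hd d d0; exists t0 => // t f tt0.
pose x := P J f; pose F0 : fct := l2fun x; have LF : L2 F0 := L2_l2fun x.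
have xE : toL2 F0 = x := l2funK x.
have bc := bounded_char i0 t.
have Lm : L2 (fun y => char i0 t y * F0 y) := L2_Mu bc LF.
have mE : Mu (char i0 t) x = toL2 (fun y => char i0 t y * F0 y) by rewrite -{1}xE (MuE bc LF).
have nE : L2_sqnorm F0 = (nsq x)%:E by rewrite -(nsq_toL2E LF) xE.
have Lr (j : idx * bool) : L2 (rframe (affine_system A psi) j).
  by apply: L2_rframe => i; exact: L2_affine.
have orth j k l (c : R[i]) : J <= j -> fip F0 (fun y => c * affine_system A psi (j, k, l) y) = 0.
  move=> Jj; have La : L2 (affine_system A psi (j, k, l)) by exact: L2_affine.
  have h e : fip F0 (rframe (affine_system A psi) ((j, k, l), e)) = 0.
    rewrite -(ip_toL2 LF (Lr _)) xE -nframe_pickle (bproj_coef bio) mem_iset_pickle.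
    by rewrite /below /= ltNge Jj.
  rewrite fip_complexr//.
  have -> : fip F0 (affine_system A psi (j, k, l)) = 0.
    by rewrite -(h false) /rframe /=; congr fip; apply/funext => y; rewrite mul1r.
  by have := h true; rewrite /rframe /= => ->; rewrite !mulr0 addr0.
have K0 : 0 <= C * nsq x * d * W.
  exact: (mulr_ge0 (mulr_ge0 (mulr_ge0 C0 (nsq_ge0 x)) (ltW d0)) W0).
rewrite -/x mE (bproj_compl bio) -lee_fin.
apply: le_trans (bproj_bound_esum bio _ _) _.
pose a (y : idx * bool) : \bar R := (if below J y.1 then 0
  else (fip (fun y => char i0 t y * F0 y) (rframe (affine_system A psi) y) ^+ 2)%:E)%E.
have a0 y : (0 <= a y)%E by rewrite /a; case: ifP => // _; rewrite lee_fin sqr_ge0.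
have -> : (\esum_(i in ~` iset (@below n L J)) (ip (toL2 (fun y => char i0 t y * F0 y) : H) (G i) ^+ 2)%:E =
    \esum_(y in [set: idx * bool]) a y)%E.
  rewrite esum_mkcond (@esum_nat_pickle _ (idx * bool)%type); last 2 first.
  - by move=> m; case: ifP => // _; rewrite lee_fin sqr_ge0.
  - by move=> m hm; rewrite /G /nframe hm /= ip0r expr0n if_same.
  apply: eq_esum => y _; rewrite in_setC mem_iset_pickle /a.
  by case: ifP; case: ifP => // _ _; rewrite /G nframe_pickle (ip_toL2 Lm (Lr y)).
rewrite esum_affine_index//.
apply: (@le_trans _ _ (b%:E * \esum_(e in [set: bool]) \esum_(l in [set: 'I_L])
    (C * nsq x * d * W / (1 - lam))%:E)%E); last first.
  have q0 : (0 <= (C * nsq x * d * W / (1 - lam))%:E :> \bar R)%E.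
    by rewrite lee_fin divr_ge0// subr_ge0 ltW.
  under eq_esum do rewrite esum_fin//.
  rewrite esum_fin; last by move=> _; apply: sume_ge0.
  under eq_bigr do rewrite sumEFin.
  rewrite sumEFin big_bool -EFinM lee_fin sumr_const card_ord -mulr_natl.
  have -> : b * (L%:R * (C * nsq x * d * W / (1 - lam)) + L%:R * (C * nsq x * d * W / (1 - lam))) =
     (Z * d) * nsq x by rewrite /Z; ring.
  apply: ler_wpM2r; first exact: nsq_ge0.
  rewrite /d mulrCA ger_pMr// ler_pdivrMr ?ltr_wpDl// mul1r lerDl//.
apply: lee_wpmul2l; first by rewrite lee_fin.
apply: le_esum => e _; apply: le_esum => l _.
rewrite esum_int_ge0; last 2 first.
- by move=> j; apply: esum_ge0.
- by move=> j j0; rewrite esum1// => k _; rewrite /a /below /= (lt_le_trans j0).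
apply: le_trans (_ : \esum_(i in [set: nat]) (C * nsq x * d * W * lam ^+ i)%:E <= _)%E; last first.
  exact: esum_geometric.
apply: le_esum => j _.
have [jJ|Jj] := ltP j%:Z J.
  rewrite esum1; first by rewrite lee_fin mulr_ge0// exprn_ge0.
  by move=> k _; rewrite /a /below /= jJ.
have tt0' : `|- t| <= t0 by rewrite normrN.
have hw := ht _ l j tt0'.
set g := (fun y => _) in hw.
have Lw : L2 g.
  split; last by apply: le_lt_trans hw _; exact: ltry.
  apply: cmeasurableM; first exact: cmeasurable_real.
  apply: cmeasurableM; last by case: (Lpsi l).
  apply: cmeasurableD; last exact: cmeasurable_cst.
  apply: (cmeasurable_comp (f := char i0 (- t)) (T := fun x => B ^+ j *m x)).
    exact: measurable_cV_mulmx.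
  exact: cmeasurable_char.
have orth' k (c : R[i]) := orth j%:Z k l c Jj.
have := modulated_coefficients e C0 mv v01 vw vC LF (Lpsi l) Lw orth'.
have aE k : a (j%:Z, k, l, e) = (fip (fun y => char i0 t y * F0 y)
    (rframe (affine_system A psi) (j%:Z, k, l, e)) ^+ 2)%:E.
  by rewrite /a /below /= ltNge Jj.
rewrite (eq_esum (fun k _ => aE k)) => h; apply: le_trans h _; rewrite nE.
apply: le_trans (_ : C%:E * ((nsq x)%:E * (d * lam ^+ j * W)%:E) <= _)%E.
  apply: lee_wpmul2l; first by rewrite lee_fin.
  by apply: lee_wpmul2l; first by rewrite lee_fin nsq_ge0.
rewrite -!EFinM lee_fin; have -> : C * (nsq x * (d * lam ^+ j * W)) = C * nsq x * d * W * lam ^+ j by ring.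
exact: lexx.
Qed.

End leak.

(** * Hilbert-Schmidt bound for the projections over a unit box *)

Section hilbert_schmidt_finiteness.
Context {R : realType} {n L : nat}.
Variables (A : 'M[R]_n.+1) (rho : 'cV[R]_n.+1 -> R).
Hypotheses (hA : expansive A) (hrho : quasi_norm A rho).
Hypothesis svA : forall j : int, scales_volume (A ^ j).
Local Notation H := (@L2_hilbert R n.+1).
Local Notation idx := (int * 'cV[int]_n.+1 * 'I_L)%type.
Local Notation fct := ('cV[R]_n.+1 -> R[i]).
Local Notation lp := (@lattice_point R n.+1).
Local Notation mu := (@lebesgue_cV R n.+1).
Local Notation B := A^-1.
Implicit Types (phi psi : 'I_L -> fct).
Let uA : A \is a GRing.unit := expansive_unit hA.

Definition box_preimage (i : nat) : set 'cV[R]_n.+1 := [set w | unit_box 1 (A ^+ i *m w)].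

Lemma measurable_box_preimage i : measurable (box_preimage i).
Proof.
rewrite -[box_preimage i]setTI; apply: measurable_cV_mulmx => //.
exact: measurable_unit_box.
Qed.

Lemma mulmx_exprK i (x : 'cV[R]_n.+1) : B ^+ i *m (A ^+ i *m x) = x.
Proof. by rewrite mulmxA exprVn mulmxE mulVr ?unitrX// mul1mx. Qed.

(* [unit_box 1] stays away from the origin, so its dilates overlap boundedly. *)
Lemma box_preimage_overlap : exists m r : nat, forall w,
  (\esum_(i in [set: nat]) (\1_(box_preimage i) w : R)%:E <=
   (m%:R * \1_(cV_ball r%:R) w : R)%:E)%E.
Proof.
have [K [lam [K1 l0 l1 hK]]] := expansive_contraction hA hrho.
have li : 1 < lam^-1 by rewrite invf_gt1.
(* A point of the box has norm at most 2, so [m] or more applications of [A^-1] bring it below norm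
   1 and out of the box; hence all indices that count lie among [m] consecutive ones. *)
have [m hm] := expr_unbounded (2 * K) li.
have hm' : K * lam ^+ m * 2 < 1.
  by rewrite mulrAC -ltr_pdivlMr ?exprn_gt0// mul1r -exprVn mulrC.
have [r hr] : exists r : nat, 2 * K <= r%:R.
  by exists (Num.truncn (2 * K)).+1; exact/ltW/truncnS_gt.
have bd (x : 'cV[R]_n.+1) : unit_box 1 x -> 1 <= `|x| <= 2.
  move=> h; apply/andP; split.
    have := h ord0; rewrite /= in_itv /= => /andP[h1 _].
    by apply: le_trans (cV_coord_le x ord0); apply: le_trans (ler_norm _).
  apply/cV_norm_le => // i; have := h i; rewrite /= in_itv /= => /andP[h1 h2].
  by rewrite ger0_norm; lra.
exists m, r => w.
have [wr|wr] := pselect (cV_ball r%:R w); last first.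
  rewrite esum1; first by rewrite indicE memNset// mulr0.
  move=> i _; rewrite indicE memNset// => /bd /andP[_ h]; apply: wr.
  apply/cV_ballE; rewrite ?ler0n//; apply: le_trans hr.
  rewrite -(mulmx_exprK i w); apply: le_trans (hK _ _) _.
  rewrite mulrC; apply: ler_pM => //; first by rewrite mulr_ge0 ?exprn_ge0 ?ltW//; lra.
  rewrite ler_piMr//; first by lra.
  by apply: exprn_ile1; exact: ltW.
rewrite [X in (_ <= (_ * X)%:E)%E]indicE mem_set// mulr1.
have [[i1 hi1]|none] := pselect (exists i, box_preimage i w); last first.
  rewrite esum1 ?lee_fin ?ler0n// => i _; rewrite indicE memNset// => h; apply: none.
  by exists i.
have ex : exists i, `[< box_preimage i w >] by exists i1; exact/asboolP.
case: (ex_minnP ex) => {i1 hi1}i1 /asboolP hi1 mini.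
have zero i : ~~ (i1 <= i < i1 + m)%N -> \1_(box_preimage i) w = 0 :> R.
  move=> hi; rewrite indicE memNset// => h; move: hi.
  rewrite negb_and -ltnNge -leqNgt => /orP[ii1|ii1].
    by have := mini i (introT (asboolP _) h); rewrite leqNgt ii1.
  have e : A ^+ i1 *m w = B ^+ (i - i1) *m (A ^+ i *m w).
    by rewrite -{2}(subnK (leq_trans (leq_addr m i1) ii1)) exprD -mulmxE -mulmxA mulmx_exprK.
  have /bd /andP[h1 _] := hi1; have /bd /andP[_ h2] := h.
  have h3 := hK (i - i1)%N (A ^+ i *m w); rewrite -e in h3.
  have h4 : lam ^+ (i - i1) <= lam ^+ m.
    by apply: ler_wiXn2l; [exact: ltW|exact: ltW|rewrite leq_subRL// (leq_trans (leq_addr m i1) ii1)].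
  have h5 : K * lam ^+ (i - i1) * `|A ^+ i *m w| <= K * lam ^+ m * 2.
    apply: ler_pM => //; first by rewrite mulr_ge0 ?exprn_ge0 ?ltW//; lra.
    by apply: ler_wpM2l => //; lra.
  lra.
apply: esum_le_partial => [i|N]; first by rewrite indicE.
rewrite lee_fin -(big_mkord xpredT (fun i => \1_(box_preimage i) w : R)).
apply: (@le_trans _ _ (\sum_(0 <= i < i1 + m + N) (\1_(box_preimage i) w : R))).
  rewrite [leRHS](big_cat_nat _ (n := N)) ?leq_addl//= lerDl.
  by apply: sumr_ge0 => i _; rewrite indicE.
rewrite (big_cat_nat _ (n := i1 + m)) ?leq_addr//= (big_cat_nat _ (n := i1)) ?leq_addr//=.
rewrite big_nat_cond big1 ?add0r; last first.
  by move=> i /andP[/andP[_ h] _]; apply: zero; rewrite negb_and -ltnNge h.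
rewrite [X in _ + X]big_nat_cond [X in _ + X]big1 ?addr0; last first.
  by move=> i /andP[/andP[h _] _]; apply: zero; rewrite negb_and -leqNgt h orbT.
apply: (@le_trans _ _ (\sum_(i1 <= i < i1 + m) (1 : R))).
  by apply: ler_sum => i _; rewrite indicE; case: (_ \in _).
by rewrite sumr_const_nat addKn.
Qed.

(** A change of variables moves the dilation onto the box. The sum becomes the integral of
    [csq (psi l x)] against the number of pairs of [i] and [k] with [x + k] in the [i]-th preimage,
    and this is at most the overlap times a lattice count. *)
Lemma box_mass : exists2 c : R, 0 <= c & forall psi l, L2 (psi l) ->
  (\esum_(i in [set: nat]) \esum_(k in [set: 'cV[int]_n.+1])
     L2_sqnorm (fun x => indC (unit_box 1) x * affine_system A psi (- i%:Z, k, l) x)%R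
   <= c%:E * L2_sqnorm (psi l))%E.
Proof.
have [m [r hov]] := box_preimage_overlap.
pose N := fine (mu (cV_ball (r%:R + 1))).
have Nfin : mu (cV_ball (r%:R + 1)) = N%:E.
  by rewrite /N lebesgue_cV_ball// addr_ge0.
have N0 : 0 <= N by rewrite /N fine_ge0.
exists (m%:R * N); first by rewrite mulr_ge0.
move=> psi l Lp; have [mp _] := Lp.
have mc := measurable_csqE mp.
have ABE i : A ^ (- i%:Z) = B ^+ i by rewrite -exprnN exprVn.
pose g i k (x : 'cV[R]_n.+1) : \bar R :=
  ((\1_(box_preimage i) (x + lp k)%R : R)%:E * (csq (psi l x))%:E)%E.
have mI i k : measurable_fun setT (fun x : 'cV[R]_n.+1 => (\1_(box_preimage i) (x + lp k)%R : R)%:E).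
  apply/measurable_EFinP; have h := @measurable_indic _ _ R setT _ (measurable_box_preimage i).
  exact: (measurableT_comp h (measurable_cV_shift _)).
have mg i k : measurable_fun setT (g i k) by exact: emeasurable_funM.
have g0 i k x : (0 <= g i k x)%E by rewrite mule_ge0// lee_fin ?csq_ge0// indicE.
have key i k : L2_sqnorm (fun x => indC (unit_box 1) x * affine_system A psi (- i%:Z, k, l) x)%R =
    (\int[mu]_x g i k x)%E.
  have -> : (fun x => indC (unit_box 1) x * affine_system A psi (- i%:Z, k, l) x) =
      dilate (A ^ (- i%:Z)) (fun x => indC (box_preimage i) x * translate (lp k) (psi l) x).
    apply/funext => x; rewrite /affine_system /dilate mulrCA; congr (_ * (_ * _)).
    rewrite /indC !indicE; congr ((_ %:R)%:C%C); congr nat_of_bool.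
    have e : A ^+ i *m (A ^ (- i%:Z) *m x) = x.
      by have := mulmx_expVr hA i 0 x; rewrite addn0 expr0 mul1mx ABE.
    by apply/idP/idP; rewrite !inE /box_preimage /= e.
  have mIc : cmeasurable (indC (box_preimage i)).
    by case: (bounded_indC (measurable_box_preimage i)).
  have mt := cmeasurable_translate (lp k) mp.
  rewrite (scales_volume_sqnorm (svA _) (cmeasurableM mIc mt)) L2_sqnormE.
  rewrite -(@ge0_integral_cV_shift R n.+1 (lp k)); last 2 first.
  - by apply: measurable_csqE; exact: cmeasurableM.
  - by move=> x; rewrite lee_fin csq_ge0.
  apply: eq_integral => x _; rewrite csqM /translate addrK EFinM /g; congr (_ * _)%E.
  by rewrite /indC csqC indicE; case: (_ \in _); rewrite ?expr1n ?expr0n.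
under eq_esum => i _ do under eq_esum => k _ do rewrite key.
rewrite esum_exchange; last by move=> i k; apply: integral_ge0.
pose h k (x : 'cV[R]_n.+1) : \bar R :=
  ((m%:R * \1_(cV_ball r%:R) (x + lp k)%R : R)%:E * (csq (psi l x))%:E)%E.
have mh k : measurable_fun setT (h k).
  apply: emeasurable_funM => //; apply/measurable_EFinP; apply: measurable_funM => //.
  have hh := @measurable_indic _ _ R setT _ (@measurable_cV_ball R n.+1 r%:R).
  exact: (measurableT_comp hh (measurable_cV_shift _)).
have h0 k x : (0 <= h k x)%E.
  by rewrite mule_ge0// lee_fin ?csq_ge0// mulr_ge0// indicE.
apply: (@le_trans _ _ (\esum_(k in [set: 'cV[int]_n.+1]) \int[mu]_x h k x)%E).
  apply: le_esum => k _.
  have [_ <-] := integral_esum mu (fun i => mg i k) (fun i => g0 i k).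
  apply: ge0_integral_mono => x; first exact: esum_ge0.
  rewrite /g; under eq_esum do rewrite muleC.
  rewrite esumZl ?csq_ge0//.
  by rewrite muleC; apply: lee_wpmul2r; [rewrite lee_fin csq_ge0|exact: hov].
have [_ <-] := integral_esum mu mh h0.
rewrite L2_sqnormE -ge0_integralZl//; last 2 first.
- by move=> x _; rewrite lee_fin csq_ge0.
- by rewrite lee_fin mulr_ge0.
apply: ge0_integral_mono => x; first exact: esum_ge0.
have cnt : (\esum_(k in [set: 'cV[int]_n.+1]) (\1_(cV_ball r%:R) (x + lp k)%R : R)%:E <= N%:E)%E.
  have sub (z q : 'cV[R]_n.+1) : cV_ball r%:R z -> unit_box 0 q -> cV_ball (r%:R + 1) (z + q).
    move=> zE qQ; apply/cV_ballE; first by rewrite addr_ge0.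
    apply: le_trans (ler_normD _ _) _; apply: lerD; first exact/cV_ballE.
    apply/cV_norm_le => // j; have := qQ j; rewrite /= in_itv /= add0r => /andP[q0 q1].
    by rewrite ger0_norm// ltW.
  have := lattice_count (measurable_cV_ball _) sub (- x); rewrite Nfin; apply: le_trans.
  apply: le_esum => k _; rewrite lee_fin !indicE -opprD.
  rewrite (_ : (- (x + lp k) \in cV_ball r%:R) = (x + lp k \in cV_ball r%:R))//.
  by apply/idP/idP; rewrite !inE !cV_ballE// normrN.
have -> : (\esum_(k in [set: 'cV[int]_n.+1]) h k x = (m%:R * csq (psi l x))%:E *
    \esum_(k in [set: 'cV[int]_n.+1]) (\1_(cV_ball r%:R) (x + lp k)%R : R)%:E)%E.
  rewrite -esumZl; last 2 first.
  - by rewrite mulr_ge0// csq_ge0.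
  - by move=> k; rewrite lee_fin indicE.
  by apply: eq_esum => k _; rewrite /h -!EFinM; congr (_%:E); ring.
apply: le_trans (_ : (m%:R * csq (psi l x))%:E * N%:E <= _)%E.
  by apply: lee_wpmul2l => //; rewrite lee_fin mulr_ge0// csq_ge0.
by rewrite -!EFinM lee_fin mulrAC.
Qed.

Variables (phi psi : 'I_L -> fct) (b : R).
Hypotheses (Lphi : forall l, L2 (phi l)) (Lpsi : forall l, L2 (psi l)).
Let F := nframe (affine_system A phi : idx -> fct).
Let G := nframe (affine_system A psi : idx -> fct).
Hypothesis bio : biorthogonal F G b.

(** After exchanging sums, Parseval over the [e i] leaves the mass of the dual wavelets on the box,
    and [J <= 1] restricts it to the layers [j <= 0] summed in [box_mass]. *)
Lemma hsn_bproj_fin (e : nat -> H) (J : int) : J <= 1 ->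
  (forall f, (\esum_(i in [set: nat]) (ip f (e i) ^+ 2)%:E =
     (nsq (Mu (indC (unit_box 1)) f))%:E)%E) ->
  (hsn e (bproj F G (iset (@below n L J))) < +oo)%E.
Proof.
move=> J1 pars; have [c c0 hc] := box_mass; have b0 : 0 <= b := biorth_ge0 bio.
have bQ := bounded_indC (@measurable_unit_box R n.+1 1).
pose S := iset (@below n L J).
apply: (@le_lt_trans _ _ (b%:E * \esum_(m in S) (nsq (Mu (indC (unit_box 1)) (G m)))%:E)%E).
  rewrite /hsn.
  apply: (@le_trans _ _ (\esum_(i in [set: nat]) (b%:E * \esum_(m in S) (ip (e i) (G m) ^+ 2)%:E))%E).
    by apply: le_esum => i _; exact: (bproj_bound_esum bio).
  rewrite esumZl//; last by move=> i; apply: esum_ge0 => m _; rewrite lee_fin sqr_ge0.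
  apply: lee_wpmul2l; first by rewrite lee_fin.
  rewrite esum_exchange; last by move=> i j; rewrite lee_fin sqr_ge0.
  by apply: le_esum => m _; rewrite -pars; apply: le_esum => i _; rewrite ipC.
suff h : (\esum_(m in S) (nsq (Mu (indC (unit_box 1)) (G m)))%:E <=
    (\sum_(e : bool) \sum_(l < L) c * fine (L2_sqnorm (psi l)))%:E)%E.
  apply: le_lt_trans (lee_wpmul2l _ h) _; first by rewrite lee_fin.
  by rewrite -EFinM ltry.
have Lr y : L2 (rframe (affine_system A psi : idx -> fct) y).
  by apply: L2_rframe => i; exact: L2_affine.
have n0 (y : H) : (0 <= (nsq y)%:E :> \bar R)%E by rewrite lee_fin nsq_ge0.
pose a (y : idx * bool) : \bar R := (if below J y.1
  then L2_sqnorm (fun x => indC (unit_box 1) x * affine_system A psi y.1 x)%R else 0)%E.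
have a0 y : (0 <= a y)%E by rewrite /a; case: ifP => // _; exact: L2_sqnorm_ge0.
have Mu0 : Mu (indC (unit_box 1)) (0 : H) = 0 := adj0 (indC_adj (measurable_unit_box 1)).
have -> : (\esum_(m in S) (nsq (Mu (indC (unit_box 1)) (G m)))%:E =
    \esum_(y in [set: idx * bool]) a y)%E.
  rewrite esum_mkcond (@esum_nat_pickle _ (idx * bool)%type); last 2 first.
  - by move=> m; case: ifP.
  - move=> m hm; rewrite /G /nframe hm [oapp _ _ _]/= Mu0 nsq0; exact: if_same.
  apply: eq_esum => y _; rewrite mem_iset_pickle /a; case: ifP => // _.
  rewrite /G nframe_pickle (MuE bQ (Lr y)) (nsq_toL2E (L2_Mu bQ (Lr y))) !L2_sqnormE.
  by apply: eq_integral => x _; rewrite /rframe !csqM csq_cunit mul1r.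
rewrite esum_affine_index// esum_fin; last by move=> ?; do 3 (apply: esum_ge0 => ? _); exact: a0.
rewrite -sumEFin; apply: lee_sum => e' _.
rewrite esum_fin; last by move=> ?; do 2 (apply: esum_ge0 => ? _); exact: a0.
rewrite -sumEFin; apply: lee_sum => l _.
have pE : L2_sqnorm (psi l) = (fine (L2_sqnorm (psi l)))%:E.
  by rewrite fineK// ge0_fin_numE ?L2_sqnorm_ge0//; case: (Lpsi l).
rewrite EFinM -pE; apply: le_trans (hc psi l (Lpsi l)).
have bij : set_bij [set: int] [set: int] (fun j : int => - j).
  by split.
rewrite (reindex_esum _ _ _ _ bij).
rewrite esum_int_ge0; last 2 first.
- by move=> j; exact: esum_ge0.
- move=> j j0; rewrite esum1// => k _; rewrite /a /below /= ifF//.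
  by apply/negbTE; rewrite -leNgt; apply: le_trans J1 _; rewrite -gtz0_ge1 oppr_gt0.
apply: le_esum => i _; apply: le_esum => k _; rewrite /a; case: ifP => // _.
exact: L2_sqnorm_ge0.
Qed.

End hilbert_schmidt_finiteness.

(** * Continuity of translations *)

Section translation_continuity.
Import HBSimple HBNNSimple.
Context {R : realType} {n : nat}.
Local Notation mu := (@lebesgue_cV R n).
Local Notation fct := ('cV[R]_n -> R[i]).
Implicit Types (f g : fct) (E : set 'cV[R]_n).

Definition tcont f := L2 f /\ forall eps : R, 0 < eps -> exists2 d : R, 0 < d &
  forall y : 'cV[R]_n, `|y| <= d -> (L2_sqnorm (fun x => translate y f x - f x)%R <= eps%:E)%E.

Lemma tcont_lim f : L2 f ->
  (forall eps : R, 0 < eps -> exists2 g, tcont g & (L2_sqnorm (fun x => f x - g x)%R <= eps%:E)%E) ->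
  tcont f.
Proof.
move=> Lf h; split => // eps eps0; have e0 : 0 < eps / 16 by rewrite divr_gt0.
have [g [Lg hg] fg] := h _ e0; have [d d0 hd] := hg _ e0; exists d => // y yd.
have LB := L2B Lf Lg; have Lt := L2_translate y LB; have Lgt := L2B (L2_translate y Lg) Lg.
have -> : (fun x => translate y f x - f x) = (fun x => translate y (fun x => f x - g x) x +
    ((translate y g x - g x) + - (f x - g x))).
  by apply/funext => x; rewrite /translate; ring.
apply: le_trans (L2_sqnormD Lt.1 (L2D Lgt (L2N LB)).1) _.
rewrite (L2_sqnorm_translate y LB.1).
apply: (@le_trans _ _ (2%:E * (eps / 16)%:E + 2%:E * (2%:E * (eps / 16)%:E + 2%:E * (eps / 16)%:E))%E).
  apply: leeD; first exact: lee_wpmul2l.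
  apply: lee_wpmul2l => //; apply: le_trans (L2_sqnormD Lgt.1 (L2N LB).1) _.
  apply: leeD; apply: lee_wpmul2l => //; first exact: hd.
  by rewrite L2_sqnormN.
by rewrite -!(EFinM, EFinD) lee_fin; lra.
Qed.

Lemma tcontD f g : tcont f -> tcont g -> tcont (fun x => f x + g x).
Proof.
move=> [Lf hf] [Lg hg]; split; first exact: L2D.
move=> eps eps0; have e0 : 0 < eps / 4 by rewrite divr_gt0.
have [d1 d10 h1] := hf _ e0; have [d2 d20 h2] := hg _ e0.
exists (Num.min d1 d2); first by rewrite lt_min d10.
move=> y; rewrite le_min => /andP[y1 y2].
have Lft := L2B (L2_translate y Lf) Lf; have Lgt := L2B (L2_translate y Lg) Lg.
have -> : (fun x => translate y (fun x => f x + g x) x - (f x + g x)) =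
    (fun x => (translate y f x - f x) + (translate y g x - g x)).
  by apply/funext => x; rewrite /translate; ring.
apply: le_trans (L2_sqnormD Lft.1 Lgt.1) _.
apply: (@le_trans _ _ (2%:E * (eps / 4)%:E + 2%:E * (eps / 4)%:E)%E).
  by apply: leeD; apply: lee_wpmul2l => //; [exact: h1|exact: h2].
by rewrite -!EFinM -EFinD lee_fin; lra.
Qed.

Lemma tcontZ c f : tcont f -> tcont (fun x => c * f x).
Proof.
move=> [Lf hf]; split; first exact: L2Z.
move=> eps eps0; have c0 : 0 < csq c + 1 by rewrite ltr_wpDl// csq_ge0.
have e0 : 0 < eps / (csq c + 1) by rewrite divr_gt0.
have [d d0 hd] := hf _ e0; exists d => // y yd.
have Lft := L2B (L2_translate y Lf) Lf.
apply: (@le_trans _ _ ((csq c + 1)%:E * (eps / (csq c + 1))%:E)%E); last first.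
  by rewrite -EFinM lee_fin mulrCA mulfV ?mulr1// gt_eqF.
apply: (@le_trans _ _ ((csq c + 1)%:E * L2_sqnorm (fun x => translate y f x - f x)%R)%E).
  apply: L2_sqnorm_le; [exact: ltW| |exact: Lft.1|].
    exact: (L2B (L2_translate y (L2Z c Lf)) (L2Z c Lf)).1.
  move=> x; rewrite /translate -mulrBr csqM; apply: ler_wpM2r; first exact: csq_ge0.
  by rewrite lerDl.
by apply: lee_wpmul2l; [rewrite lee_fin ltW|exact: hd].
Qed.

Lemma tcont0 : tcont (fun=> 0).
Proof.
split; first exact: L2_0.
move=> eps eps0; exists 1 => // y _.
rewrite /translate; under [X in L2_sqnorm X]eq_fun do rewrite subrr.
by rewrite L2_sqnormE; under eq_integral do rewrite csq0; rewrite integral0 lee_fin ltW.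
Qed.

Lemma tcont_sum I (s : seq I) (F : I -> fct) : (forall i, tcont (F i)) ->
  tcont (fun x => \sum_(i <- s) F i x).
Proof.
move=> h; elim: s => [|i s IH]; first by under eq_fun do rewrite big_nil; exact: tcont0.
by under eq_fun do rewrite big_cons; exact: tcontD.
Qed.

Lemma tcontB f g : tcont f -> tcont g -> tcont (fun x => f x - g x).
Proof.
move=> hf hg; under eq_fun do rewrite -mulN1r.
by apply: tcontD => //; exact: tcontZ.
Qed.

Lemma tcontM f g : tcont f -> tcont g -> bounded_mul f -> bounded_mul g ->
  tcont (fun x => f x * g x).
Proof.
move=> [Lf hf] [Lg hg] bf bg; split; first exact: (L2_Mu bf Lg).
move=> eps eps0; have e0 : 0 < eps / 4 by rewrite divr_gt0.
have [d1 d10 h1] := hf _ e0; have [d2 d20 h2] := hg _ e0.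
exists (Num.min d1 d2); first by rewrite lt_min d10.
move=> y; rewrite le_min => /andP[y1 y2].
have Lft := L2B (L2_translate y Lf) Lf; have Lgt := L2B (L2_translate y Lg) Lg.
have btf := bounded_mul_translate y bf.
have -> : (fun x => translate y (fun x => f x * g x) x - f x * g x) =
    (fun x => translate y f x * (translate y g x - g x) + g x * (translate y f x - f x)).
  by apply/funext => x; rewrite /translate; ring.
have L1 := L2_Mu btf Lgt; have L2' := L2_Mu bg Lft.
apply: le_trans (L2_sqnormD L1.1 L2'.1) _.
have le1 (c h : fct) : bounded_mul c -> L2 h -> (L2_sqnorm (fun x => c x * h x)%R <= L2_sqnorm h)%E.
  move=> bc Lh; rewrite -[leRHS]mul1e; apply: L2_sqnorm_le => //; [exact: (L2_Mu bc Lh).1|exact: Lh.1|].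
  by move=> x; rewrite csqM; apply: ler_wpM2r; [exact: csq_ge0|case: bc].
apply: (@le_trans _ _ (2%:E * (eps / 4)%:E + 2%:E * (eps / 4)%:E)%E).
  apply: leeD; apply: lee_wpmul2l => //.
    by apply: le_trans (le1 _ _ btf Lgt) _; exact: h2.
  by apply: le_trans (le1 _ _ bg Lft) _; exact: h1.
by rewrite -!EFinM -EFinD lee_fin; lra.
Qed.

Lemma L2_dominated (F : nat -> fct) f g : (forall m, cmeasurable (F m)) -> cmeasurable f -> L2 g ->
  (forall m x, csq (f x - F m x) <= csq (g x)) ->
  (forall x, (fun m => csq (f x - F m x)) @ \oo --> (0 : R)) ->
  forall eps : R, 0 < eps -> exists m, (L2_sqnorm (fun x => f x - F m x)%R <= eps%:E)%E.
Proof.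
move=> mF mf Lg dom cv eps eps0.
have mB m : cmeasurable (fun x => f x - F m x).
  apply: cmeasurableD => //; have := cmeasurableM (cmeasurable_cst (-1)) (mF m).
  by congr cmeasurable; apply/funext => x; rewrite mulN1r.
have := @dominated_cvg _ _ R mu setT measurableT (fun m x => (csq (f x - F m x))%:E)
  (cst 0%E) (fun x => (csq (g x))%:E) (fun m => measurable_csqE (mB m)).
move=> /(_ _ _ (L2_integrable Lg)) h.
have {}h : (\int[mu]_x (csq (f x - F m x))%:E)%E @[m --> \oo] --> (0 : \bar R)%E.
  rewrite -[X in _ --> X](integral0 mu setT); apply: h.
  - by move=> x _; apply: cvg_EFin; [exact: nearW|exact: cv].
  - by [].
  - by move=> m x _; rewrite gee0_abs ?lee_fin ?csq_ge0// ; exact: dom.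
move: h => /fine_cvgP [[N1 _ f1] /cvgrPdist_le /(_ _ eps0) [N2 _ h2]].
exists (maxn N1 N2); have := h2 _ (leq_maxr N1 N2).
rewrite /= sub0r normrN => h; rewrite L2_sqnormE -[leLHS]fineK; last exact: f1 (leq_maxl _ _).
by rewrite lee_fin; apply: le_trans (ler_norm _) h.
Qed.

Let K (r : nat) : set 'cV[R]_n := cV_ball r%:R.

Lemma L2_ind E r : measurable E -> L2 (indC (E `&` K r)).
Proof.
move=> mE; have mK : measurable (E `&` K r) by apply: measurableI => //; exact: measurable_cV_ball.
split; first by case: (bounded_indC mK).
rewrite L2_sqnormE; under eq_integral => x _ do rewrite /indC csqC.
apply: le_lt_trans (_ : mu (K r) < +oo)%E; last by rewrite lebesgue_cV_ball ?ltry.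
have -> : mu (K r) = (\int[mu]_x (\1_(K r) x : R)%:E)%E.
  by rewrite integral_indic ?setIT//; exact: measurable_cV_ball.
apply: ge0_integral_mono => x; first by rewrite lee_fin sqr_ge0.
rewrite lee_fin !indicE in_setI; case: (x \in E) => /=; last by rewrite expr0n.
by case: (x \in K r); rewrite ?expr1n ?expr0n.
Qed.

(** Truncation to a fixed ball keeps indicators in [L2] and complements manageable; for each [r]
    such sets form a sigma-algebra containing the half-spaces. *)
Definition tcont_set r E := measurable E /\ tcont (indC (E `&` K r)).

Lemma indC_I E E' : indC (E `&` E') = (fun x => indC E x * indC E' x) :> fct.
Proof. by apply/funext => x; rewrite /indC -rmorphM /= !indicE in_setI -natrM mulnb. Qed.

Lemma tcont_setI r E E' : tcont_set r E -> tcont_set r E' -> tcont_set r (E `&` E').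
Proof.
move=> [mE hE] [mE' hE']; split; first exact: measurableI.
have mK (D : set 'cV[R]_n) : measurable D -> measurable (D `&` K r).
  by move=> mD; apply: measurableI => //; exact: measurable_cV_ball.
rewrite -(setIid (K r)) setIACA indC_I.
by apply: tcontM => //; apply: bounded_indC; exact: mK.
Qed.

Lemma tcont_setC r E : tcont_set r setT -> tcont_set r E -> tcont_set r (~` E).
Proof.
move=> [_ hT] [mE hE]; split; first exact: measurableC.
have := tcontB hT hE; congr tcont; apply/funext => x.
rewrite /indC -rmorphB /= !indicE !in_setI in_setC in_setT /=.
by case: (x \in E); rewrite /= ?subrr ?subr0.
Qed.

Lemma tcont_set_bigcup r (E : nat -> set 'cV[R]_n) : tcont_set r setT ->
  (forall i, tcont_set r (E i)) -> tcont_set r (\bigcup_i E i).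
Proof.
move=> hT hE; have mU : measurable (\bigcup_i E i) by apply: bigcup_measurable => i _; case: (hE i).
have hU m : tcont_set r (\bigcup_(i in `I_m) E i).
  elim: m => [|m IH]; first by rewrite II0 bigcup_set0 -setCT; exact: tcont_setC.
  rewrite IIS bigcup_setU bigcup_set1 -[X in tcont_set r X]setCK setCU.
  apply: (tcont_setC hT); apply: tcont_setI; apply: (tcont_setC hT); [exact: IH|exact: hE].
split => //; apply: tcont_lim; first exact: L2_ind.
move=> eps eps0.
have [m hm] : exists m, (L2_sqnorm (fun x => indC ((\bigcup_i E i) `&` K r) x -
    indC ((\bigcup_(i in `I_m) E i) `&` K r) x)%R <= eps%:E)%E; last first.
  by exists (indC ((\bigcup_(i in `I_m) E i) `&` K r)) => //; case: (hU m).
apply: (@L2_dominated (fun m => indC ((\bigcup_(i in `I_m) E i) `&` K r)) _ (indC ((\bigcup_i E i) `&` K r))) => //.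
- by move=> m; case: (hU m) => _ [] [].
- by case: (L2_ind r mU).
- exact: L2_ind.
- move=> m x; rewrite /indC -rmorphB /= !csqC !indicE !in_setI.
  have [xU|xU] := boolP (x \in \bigcup_(i in `I_m) E i).
    have -> : x \in \bigcup_i E i.
      by move: xU; rewrite !inE => -[i _ Ei]; exists i.
    by rewrite subrr expr0n sqr_ge0.
  by rewrite subr0.
move=> x; apply: cvg_near_cst.
have [[i _ Ei]|nU] := pselect ((\bigcup_i E i) x).
  exists i.+1 => // m /= im; rewrite /indC -rmorphB /= csqC !indicE !in_setI.
  have -> : x \in \bigcup_i E i by rewrite inE; exists i.
  have -> : x \in \bigcup_(i in `I_m) E i by rewrite inE; exists i.
  by rewrite subrr expr0n.
apply: nearW => m; rewrite /indC -rmorphB /= csqC !indicE !in_setI.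
rewrite [x \in \bigcup_i _]memNset// [x \in \bigcup_(_ in _) _]memNset; last first.
  by move=> [i _ Ei]; apply: nU; exists i.
by rewrite subrr expr0n.
Qed.

(** A bounded neighbourhood of a hyperplane; [r.+1] leaves room for moving the ball of radius [r] by
    at most 1. *)
Definition slab (r : nat) (i : 'I_n) (c d : R) : set 'cV[R]_n :=
  cV_box (fun j => if j == i then `[c - d, c + d]%classic else `[- (r.+1%:R), r.+1%:R]%classic).

Lemma measurable_slab r i c d : measurable (slab r i c d).
Proof. by apply: measurable_cV_box => j; case: ifP => _; exact: measurable_itv. Qed.

Lemma lebesgue_slab r i : exists2 M : R, 0 <= M & forall c d, 0 < d ->
  mu (slab r i c d) = (M * d)%:E.
Proof.
pose M : R := 2 * \prod_(j < n | j != i) (r.+1%:R + r.+1%:R).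
exists M; first by rewrite mulr_ge0// prodr_ge0// => j _; rewrite addr_ge0.
move=> c d d0; rewrite lebesgue_cV_box; last by move=> j; case: ifP => _; exact: measurable_itv.
rewrite (eq_bigr (fun j => (if j == i then 2 * d else r.+1%:R + r.+1%:R)%:E)).
  rewrite prodEFin (bigD1 i)//= eqxx /M mulrAC; congr ((_ * _)%:E).
  by congr (_ * _); apply: eq_bigr => j /negPf ->.
have r0 : 0 < r.+1%:R :> R by rewrite ltr0n.
move=> j _; case: ifP => _; rewrite lebesgue_measure_itv/= lte_fin.
  by rewrite ifT -?EFinB; [congr (_%:E); ring|lra].
by rewrite ifT -?EFinB ?opprK//; lra.
Qed.

(** A point that belongs to only one of the truncated half-space and its translate is close to a
    face: [x i = c], or some [x j] equal to [r] or [- r]. The slabs around the faces have volume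
    proportional to their width. *)
Lemma tcont_halfspace r (i : 'I_n) (c : R) : tcont_set r [set x : 'cV[R]_n | x i ord0 < c].
Proof.
have mE : measurable [set x : 'cV[R]_n | x i ord0 < c].
  have -> : [set x : 'cV[R]_n | x i ord0 < c] = @cV_coord R n i @^-1` `]-oo, c[%classic.
    by apply/seteqP; split => x; rewrite /= in_itv.
  by rewrite -[X in measurable X]setTI; apply: measurable_cV_coord => //; exact: measurable_itv.
split => //; split; first exact: L2_ind.
set E := _ `&` K r; have mK : measurable E by apply: measurableI => //; exact: measurable_cV_ball.
have [M M0 hM] : exists2 M : 'I_n -> R, (forall j, 0 <= M j) & forall j c d, 0 < d ->
    mu (slab r j c d) = (M j * d)%:E.
  have /choice [M hM] : forall j, exists M : R, 0 <= M /\ forall c d, 0 < d ->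
      mu (slab r j c d) = (M * d)%:E.
    by move=> j; have [M M0 hM] := lebesgue_slab r j; exists M.
  by exists M => j; case: (hM j).
pose S := \sum_j (M j + (M j + M j)).
have S0 : 0 <= S by apply: sumr_ge0 => j _; rewrite !addr_ge0.
move=> eps eps0; exists (Num.min 1 (eps / (S + 1))).
  by rewrite lt_min ltr01 divr_gt0// ltr_wpDl.
set d := Num.min _ _ => y yd.
have d0 : 0 < d by rewrite lt_min ltr01 divr_gt0// ltr_wpDl.
have d1 : d <= 1 by rewrite ge_min lexx.
have d2 : S * d <= eps.
  apply: (@le_trans _ _ (S * (eps / (S + 1)))); first by apply: ler_wpM2l => //; rewrite ge_min lexx orbT.
  by rewrite mulrCA ger_pMr// ler_pdivrMr ?ltr_wpDl// mul1r lerDl.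
(* The slab at [c] is taken for every coordinate [j] and not just for [i]: this keeps the terms
   uniform and only enlarges the bound. *)
pose T j (x : 'cV[R]_n) : R := \1_(slab r j c d) x + (\1_(slab r j r%:R d) x + \1_(slab r j (- r%:R) d) x).
have T0 j x : 0 <= T j x by rewrite !addr_ge0 ?indicE.
have mI j c' : measurable_fun setT (fun x => (\1_(slab r j c' d) x : R)).
  by apply: measurable_indic; exact: measurable_slab.
have mT j : measurable_fun setT (T j) by apply: measurable_funD => //; exact: measurable_funD.
have iT j : (\int[mu]_x (T j x)%:E)%E = ((M j + (M j + M j)) * d)%:E.
  have iI c' : (\int[mu]_x (\1_(slab r j c' d) x : R)%:E)%E = (M j * d)%:E.
    by rewrite integral_indic ?setIT ?hM//; exact: measurable_slab.
  under eq_integral do rewrite /T !EFinD.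
  rewrite ge0_integralD//; last 3 first.
  - by apply/measurable_EFinP.
  - by move=> x _; rewrite -EFinD lee_fin addr_ge0.
  - by apply: emeasurable_funD; exact/measurable_EFinP.
  rewrite ge0_integralD//; [|exact/measurable_EFinP|exact/measurable_EFinP].
  by rewrite !iI -!EFinD !mulrDl.
apply: (@le_trans _ _ (\int[mu]_x (\sum_j T j x)%:E)%E); last first.
  under eq_integral do rewrite -sumEFin.
  rewrite (ge0_integral_sum mu measurableT (f := fun j x => (T j x)%:E)); last 2 first.
  - by move=> j; exact/measurable_EFinP.
  - by move=> j x _; rewrite lee_fin.
  under eq_bigr do rewrite iT.
  by rewrite sumEFin lee_fin -mulr_suml.
rewrite L2_sqnormE; apply: ge0_integral_mono => x; first by rewrite lee_fin csq_ge0.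
rewrite lee_fin; have sT0 : 0 <= \sum_j T j x by apply: sumr_ge0.
rewrite /translate /indC -rmorphB /= csqC !indicE.
have [xy|xy] := eqVneq (x - y \in E) (x \in E); first by rewrite xy subrr expr0n.
suff [j hj] : exists j, 1 <= T j x.
  apply: (@le_trans _ _ 1); first by case: (_ \in E); case: (_ \in E); rewrite ?subrr ?subr0 ?sub0r ?sqrrN ?expr1n ?expr0n.
  by rewrite (bigD1 j)//=; apply: le_trans hj _; rewrite lerDl; apply: sumr_ge0.
have EE (z : 'cV[R]_n) : (z \in E) = (z i ord0 < c) && [forall j, `|z j ord0| <= r%:R].
  apply/idP/andP; rewrite inE.
    by move=> [zc zr]; split => //; apply/forallP => j; have := zr j; rewrite /= in_itv /= ler_norml.
  by move=> [zc /forallP zr]; split => // j; have := zr j; rewrite /= in_itv /= ler_norml.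
have yj j : - d <= y j ord0 <= d by rewrite -ler_norml; apply: le_trans (cV_coord_le _ _) yd.
have ball j : - r.+1%:R <= x j ord0 <= r.+1%:R.
  have : (x - y \in E) || (x \in E) by move: xy; case: (_ \in E); case: (_ \in E).
  have := yj j; rewrite -natr1 => /andP[y1 y2].
  case/orP; rewrite EE => /andP[_ /forallP/(_ j)]; rewrite ?mxE ler_norml => /andP[h1 h2];
    apply/andP; split; lra.
apply: contrapT => /forallNP hn.
have far j c' : c' \in [:: c; r%:R; - r%:R] -> d < `|x j ord0 - c'|.
  move=> hc; rewrite ltNge; apply/negP => h; apply: (hn j).
  have xs : slab r j c' d x.
    move=> k; case: eqP => [->|_]; rewrite /= in_itv /=; last exact: ball.
    by move: h; rewrite ler_norml => /andP[h1 h2]; apply/andP; split; lra.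
  have I0 c'' : 0 <= \1_(slab r j c'' d) x :> R by rewrite indicE.
  have I1 : \1_(slab r j c' d) x = 1 :> R by rewrite indicE mem_set.
  have := I0 c; have := I0 r%:R; have := I0 (- r%:R); rewrite /T.
  by move: hc; rewrite !inE => /or3P[] /eqP e; rewrite -e I1; lra.
case/eqP: xy; rewrite !EE; congr andb.
  have := far i c; rewrite inE eqxx /= => /(_ isT); have := yj i => /andP[y1 y2].
  by rewrite !mxE ltr_normr => /orP[h|h]; apply/idP/idP => h'; lra.
apply: eq_forallb => j; have := yj j => /andP[y1 y2].
have := far j r%:R; have := far j (- r%:R); rewrite !inE !eqxx ?orbT => /(_ isT) h1 /(_ isT) h2.
move: h1 h2; rewrite !mxE !ltr_normr !ler_norml.
move: (x j ord0) (y j ord0) y1 y2; clear => a b y1 y2 h1 h2; apply/idP/idP => /andP[h3 h4];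
  apply/andP; split; case/orP: h1 => h1; case/orP: h2 => h2; lra.
Qed.

Lemma tcont_set_measurable r E : (0 < n)%N -> measurable E -> tcont_set r E.
Proof.
move=> n0 mE; have i0 : 'I_n := Ordinal n0.
have hT : tcont_set r setT.
  (* The half-space ending at [r + 1] contains the whole ball of radius [r], so after truncation it
     agrees with the full space. *)
  split => //; have [_] := tcont_halfspace r i0 (r%:R + 1); congr (tcont (indC _)).
  apply/seteqP; split => x [] //= _ xK; split => //.
  by have := xK i0; rewrite /= in_itv /= => /andP[_ h]; apply: le_lt_trans h _; rewrite ltrDl.
have sig : sigma_algebra setT (tcont_set r).
  split; first by rewrite -setCT; exact: tcont_setC.
  - by move=> D hD; rewrite setTD; exact: tcont_setC.
  - by move=> D hD; exact: tcont_set_bigcup.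
suff : g_sigma_preimage (@cV_coord R n) `<=` tcont_set r by apply.
apply: smallest_sub => // X; rewrite -bigcup_seq => -[i _] [Y mY <-]; rewrite setTI.
have sigY : sigma_algebra setT [set Z : set R | tcont_set r (@cV_coord R n i @^-1` Z)].
  case: sig => s0 sC sU; split => /=.
  - by rewrite preimage_set0.
  - by move=> D hD; rewrite setTD preimage_setC -setTD; exact: sC.
  - by move=> D hD; rewrite preimage_bigcup; exact: sU.
suff : @measurable _ (measurableTypeR R) `<=` [set Z : set R | tcont_set r (@cV_coord R n i @^-1` Z)] by apply.
rewrite RGenInftyO.measurableE; apply: smallest_sub => // _ [c ->] /=.
have := tcont_halfspace r i c; congr tcont_set.
Qed.

Lemma tcont_simple (h : {nnsfun 'cV[R]_n >-> R}) r : (0 < n)%N ->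
  tcont (fun x => (h x * \1_(K r) x)%:C%C).
Proof.
move=> n0; have -> : (fun x => (h x * \1_(K r) x)%:C%C) =
    (fun x => \sum_(v <- finmap.enum_fset (fset_set (range h)))
      v%:C%C * indC (h @^-1` [set v] `&` K r) x) :> fct.
  apply/funext => x; rewrite fimfunE fsbig_finite//= mulr_suml rmorph_sum /=.
  apply: eq_bigr => v _; rewrite /indC -rmorphM /=; congr (_%:C%C).
  by rewrite !indicE in_setI -mulrA -natrM mulnb.
apply: tcont_sum => v; apply: tcontZ.
by case: (@tcont_set_measurable r (h @^-1` [set v]) n0) => //; exact: measurable_sfunP.
Qed.

Lemma tcont_nonneg (f : 'cV[R]_n -> R) : (0 < n)%N -> (forall x, 0 <= f x) ->
  L2 (fun x => (f x)%:C%C) -> tcont (fun x => (f x)%:C%C).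
Proof.
move=> n0 f0 Lf; apply: tcont_lim => // eps eps0.
have mf : measurable_fun setT (EFin \o f) by apply/measurable_EFinP; case: Lf => -[].
pose h := nnsfun_approx measurableT mf.
have fe x : setT x -> (0 <= (EFin \o f) x)%E by rewrite lee_fin.
have hc x : (fun m => h m x) @ \oo --> f x.
  by have /fine_cvgP [_] := @cvg_nnsfun_approx _ _ R setT measurableT _ mf fe x I.
have hf m x : 0 <= h m x <= f x.
  apply/andP; split; first exact: fun_ge0.
  by rewrite -lee_fin /h nnsfun_approxE; exact: (le_approx m fe I).
pose F m : fct := fun x => (h m x * \1_(K m) x)%:C%C.
have [m hm] : exists m, (L2_sqnorm (fun x => (f x)%:C%C - F m x)%R <= eps%:E)%E.
  apply: (@L2_dominated F _ (fun x => (f x)%:C%C)) => //.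
  - by move=> m; case: (tcont_simple (h m) m n0) => -[].
  - by case: Lf.
  - move=> m x; rewrite /F -rmorphB /= !csqC indicE; have /andP[h0 h1] := hf m x.
    have f0x := f0 x; case: (_ \in _); rewrite ?mulr1 ?mulr0 ?subr0//.
    by rewrite lerXn2r ?nnegrE ?subr_ge0// gerBl.
  move=> x; have [N _ hN] : \forall m \near \oo, x \in K m.
    have : (\bigcup_k (@cV_ball R n k%:R)) x by rewrite cV_ball_cover.
    move=> [N _ xN]; exists N => // m /= Nm; rewrite inE => i; have := xN i.
    rewrite /= !in_itv /= => /andP[h1 h2]; have : (N%:R : R) <= m%:R by rewrite ler_nat.
    by move=> h3; apply/andP; split; lra.
  have -> : (0 : R) = (f x - f x) ^+ 2 by rewrite subrr expr0n.
  apply: (@cvg_trans _ ((fun m => (f x - h m x) ^+ 2) @ \oo)).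
    apply: near_eq_cvg; exists N => // m /= Nm.
    by rewrite /F -rmorphB /= csqC indicE hN//= mulr1.
  under eq_fun do rewrite expr2; rewrite expr2.
  have hB : (fun m => f x - h m x) @ \oo --> f x - f x by apply: cvgB; [exact: cvg_cst|exact: hc].
  exact: (cvgM hB hB).
by exists (F m) => //; exact: tcont_simple.
Qed.

Lemma tcont_L2 f : (0 < n)%N -> L2 f -> tcont f.
Proof.
move=> n0 Lf; have [[m1 m2] _] := Lf.
have part (u : 'cV[R]_n -> R) : measurable_fun setT u -> (forall x, u x ^+ 2 <= csq (f x)) ->
    tcont (fun x => (u x)%:C%C).
  move=> mu' hu.
  have Lu (v : 'cV[R]_n -> R) : measurable_fun setT v -> (forall x, v x ^+ 2 <= u x ^+ 2) -> L2 (fun x => (v x)%:C%C).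
    move=> mv hv; apply: (@L2_le _ _ _ f 1 ler01 (cmeasurable_real mv) _ Lf).
    by move=> x; rewrite mul1r csqC; apply: le_trans (hv x) (hu x).
  have -> : (fun x => (u x)%:C%C) = (fun x => (Num.max (u x) 0)%:C%C - (Num.max (- u x) 0)%:C%C) :> fct.
    apply/funext => x; rewrite -rmorphB /=; congr (_%:C%C).
    by rewrite !maxEle; case: (leP (u x) 0); case: (leP (- u x) 0); lra.
  apply: tcontB; apply: tcont_nonneg => //.
  - by move=> x; rewrite le_max lexx orbT.
  - apply: Lu; first by apply: measurable_maxr.
    by move=> x; rewrite maxEle; case: ifP; rewrite ?expr0n ?sqr_ge0.
  - by move=> x; rewrite le_max lexx orbT.
  - apply: Lu; first by apply: measurable_maxr => //; exact: measurable_funN.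
    by move=> x; rewrite maxEle; case: ifP; rewrite ?expr0n ?sqr_ge0// sqrrN.
have -> : f = (fun x => (complex.Re (f x))%:C%C + 'i%C * (complex.Im (f x))%:C%C).
  by apply/funext => x; apply: complex_ext; rewrite ?reD ?imD ?reM ?imM /=; ring.
apply: tcontD; [|apply: tcontZ]; apply: part => //.
  by move=> x; rewrite /csq lerDl sqr_ge0.
by move=> x; rewrite /csq lerDr sqr_ge0.
Qed.

Lemma Tr_continuous (x : @L2_hilbert R n) (eps : R) : (0 < n)%N -> 0 < eps ->
  exists2 d : R, 0 < d & forall y : 'cV[R]_n, `|y| <= d -> nsq (Tr y x - x) <= eps.
Proof.
move=> n0 eps0; move: x; apply: toL2_ind => f Lf.
have [_ /(_ _ eps0) [d d0 hd]] := tcont_L2 n0 Lf; exists d => // y yd.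
have LB := L2B (L2_translate y Lf) Lf.
rewrite (TrE y Lf) (toL2B (L2_translate y Lf) Lf) -lee_fin (nsq_toL2E LB).
exact: hd.
Qed.

End translation_continuity.

(** * The trace argument *)

Section trace.
Context {R : realType} {n L : nat}.
Variables (A : 'M[R]_n.+1).
Hypothesis svA : forall j : int, scales_volume (A ^ j).
Local Notation H := (@L2_hilbert R n.+1).
Local Notation idx := (int * 'cV[int]_n.+1 * 'I_L)%type.
Local Notation fct := ('cV[R]_n.+1 -> R[i]).
Local Notation lp := (@lattice_point R n.+1).
Implicit Types (phi psi : 'I_L -> fct).

Variables (phi psi : 'I_L -> fct) (b : R) (e : nat -> H).
Hypotheses (Lphi : forall l, L2 (phi l)) (Lpsi : forall l, L2 (psi l)).
Let F := nframe (affine_system A phi : idx -> fct).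
Let G := nframe (affine_system A psi : idx -> fct).
Hypothesis bi : forall i j,
  L2_inner (affine_system A phi i) (affine_system A psi j) = (i == j)%:R.
Hypothesis bio : biorthogonal F G b.
Let Q : H -> H := Mu (indC (unit_box 1)).
Hypothesis pars : forall f, (\esum_(i in [set: nat]) (ip f (e i) ^+ 2)%:E = (nsq (Q f))%:E)%E.
Let P J := bproj F G (iset (@below n L J)).
Let P' J := bproj G F (iset (@below n L J)).
Hypothesis finP : forall J, J <= 1 -> (hsn e (P J) < +oo)%E.
Hypothesis finP' : forall J, J <= 1 -> (hsn e (P' J) < +oo)%E.
Let S := iset (@below n L 1) `\` iset (@below n L 0).

Let f0 l (c : bool) : H := toL2 (rframe (affine_system A phi : idx -> fct) ((0, 0, l), c)).
Let g0 l (c : bool) : H := toL2 (rframe (affine_system A psi : idx -> fct) ((0, 0, l), c)).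

(** Polarizing the products [ip (e a) (F i) * ip (e a) (G i)] with [s = 1] and [s = -1] yields
    nonnegative terms, for which the sums over [a] and [i] may be exchanged. *)
Let comb (s : R) i : H := F i + s *: G i.
Let u s a i : R := if i \in S then ip (e a) (comb s i) ^+ 2 else 0.
Let u0 s a i : 0 <= u s a i. Proof. by rewrite /u; case: ifP => // _; exact: sqr_ge0. Qed.
Let E s a := (\esum_(i in [set: nat]) (u s a i)%:E)%E.
Let tot s : R := \sum_(c : bool) \sum_(l < L) nsq (f0 l c + s *: g0 l c).

(** Parseval turns the sum over [a] into mass on the box. The layer consists of the lattice
    translates of the vectors with [k = 0], so by tiling the masses over [k] add up to the full
    norms of these vectors. *)
Let sumE s : (\esum_(a in [set: nat]) E s a = (tot s)%:E)%E.
Proof.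
have uE a i : (0 <= (u s a i)%:E)%E by rewrite lee_fin.
rewrite /E esum_exchange//.
pose w i : \bar R := (if i \in S then (nsq (Q (comb s i)))%:E else 0)%E.
have Q0 : Q 0 = 0 := adj0 (indC_adj (measurable_unit_box 1)).
have w0 i : (0 <= w i)%E by rewrite /w; case: ifP => // _; rewrite lee_fin nsq_ge0.
transitivity (\esum_(i in [set: nat]) w i)%E.
  apply: eq_esum => i _; rewrite /u /w; case: ifP => _; last by rewrite esum1.
  by rewrite -pars; apply: eq_esum => a _; rewrite ipC.
rewrite (@esum_nat_pickle _ (idx * bool)%type)//; last first.
  by move=> m hm; rewrite /w /comb /F /G /nframe hm /= scaler0 addr0 Q0 nsq0 if_same.
rewrite esum_affine_index// esum_fin; last by move=> ?; do 3 (apply: esum_ge0 => ? _); exact: w0.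
rewrite /tot -sumEFin; apply: eq_bigr => c _.
rewrite esum_fin; last by move=> ?; do 2 (apply: esum_ge0 => ? _); exact: w0.
rewrite -sumEFin; apply: eq_bigr => l _.
rewrite (esum_eq1 (i0 := 0)); last 2 first.
- by apply: esum_ge0.
- move=> j j0; rewrite esum1// => k _; rewrite /w ifF//; apply/negbTE.
  rewrite in_setD !mem_iset_pickle /below /=; apply: contra j0.
  by rewrite -leNgt -[1]add0r ltzD1 => /andP[h1 h2]; rewrite eq_le h1 h2.
rewrite -(@tiling_L2 R n.+1 1); apply: eq_esum => k _.
rewrite /w ifT; last by rewrite in_setD !mem_iset_pickle.
congr (nsq (Q _))%:E; rewrite /comb /F /G !nframe_pickle /f0 /g0.
have tr chi : (forall l, L2 (chi l)) -> toL2 (rframe (affine_system A chi : idx -> fct) ((0, k, l), c)) =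
    Tr (lp k) (toL2 (rframe (affine_system A chi : idx -> fct) ((0, 0, l), c))) :> H.
  move=> Lc; have Lr : L2 (rframe (affine_system A chi : idx -> fct) ((0, 0, l), c)).
    by apply: L2_rframe => i; exact: L2_affine.
  rewrite (TrE _ Lr); congr toL2; apply/funext => x.
  by rewrite /rframe -[k in LHS]addr0 -affine_translate0.
have TrZ (t : R) (x : H) : Tr (lp k) (t *: x) = t *: Tr (lp k) x.
  exact: (adjS (Tr_adj (lp k))).
by rewrite TrD TrZ -!tr.
Qed.

Let Efin s a : E s a = (fine (E s a))%:E.
Proof.
have E0 a' : (0 <= E s a')%E by apply: esum_ge0 => i _; rewrite lee_fin.
rewrite fineK// ge0_fin_numE//; apply: le_lt_trans (ltry (tot s)); rewrite -sumE.
rewrite -(@esum_set1 R nat a (E s))// [leLHS]esum_mkcond.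
by apply: le_esum => i _; case: ifP.
Qed.

(** Idempotence replaces [P' J] by the identity in the pairing, so the difference is the quadratic
    form of the projection onto the single layer [S]. *)
Let layerE a : ip (P 1 (e a)) (P' 1 (e a)) - ip (P 0 (e a)) (P' 0 (e a)) =
  (fine (E 1 a) - fine (E (-1) a)) / 4.
Proof.
have red J : ip (P J (e a)) (P' J (e a)) = ip (P J (e a)) (e a).
  by rewrite -(bproj_adj (iset (@below n L J)) bio) (bproj_idem bio).
rewrite !red -ipBl (bproj_setD bio); last first.
  move=> m; rewrite /iset /below /=; case: pickle_inv => // y h.
  exact: lt_trans h _.
have h := @bproj_cvg _ _ F G b bio S (e a) (e a); apply: (cvgn_unique h).
have c1 s : (fun n => \sum_(i < n) u s a i) @ \oo --> fine (E s a).
  by apply: (esum_cvg (u0 s a)); rewrite -/(E s a) Efin ltry.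
have : (fun N => ((\sum_(i < N) u 1 a i) - (\sum_(i < N) u (-1) a i)) * 4^-1) @ \oo -->
    (fine (E 1 a) - fine (E (-1) a)) / 4 by apply: cvgMr_tmp; apply: cvgB; exact: c1.
apply: cvg_trans; apply: near_eq_cvg; apply: nearW => m /=.
rewrite -sumrB mulr_suml; apply: eq_bigr => i _; rewrite /u /comb.
case: ifP => _; last by rewrite subrr !mul0r.
by rewrite scale1r scaleN1r ipDr ipBr (ipC (F i)); field.
Qed.

(** Each generator pairs to 1 with its dual, once for each of the two real vectors it
    contributes. *)
Lemma trace_layer : hsform e (P 1) (P' 1) - hsform e (P 0) (P' 0) = (2 * L)%:R.
Proof.
have h1 := hsform_cvg (finP (lexx 1)) (finP' (lexx 1)).
have h0 := hsform_cvg (finP (ler01)) (finP' (ler01)).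
have h : (fun N => \sum_(a < N) ip (P 1 (e a)) (P' 1 (e a)) - \sum_(a < N) ip (P 0 (e a)) (P' 0 (e a)))
    @ \oo --> hsform e (P 1) (P' 1) - hsform e (P 0) (P' 0) by exact: (cvgB h1 h0).
apply: (cvgn_unique h).
have c1 s : (fun N => \sum_(a < N) fine (E s a)) @ \oo --> tot s.
  have e1 : (\esum_(a in [set: nat]) (fine (E s a))%:E = (tot s)%:E)%E.
    by rewrite -sumE; apply: eq_esum => a _; rewrite -Efin.
  have := @esum_cvg R (fun a => fine (E s a)) _ _; rewrite e1; apply; last exact: ltry.
  by move=> a; rewrite -lee_fin -Efin; apply: esum_ge0 => i _; rewrite lee_fin.
have : (fun N => ((\sum_(a < N) fine (E 1 a)) - (\sum_(a < N) fine (E (-1) a))) * 4^-1) @ \oo -->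
    (tot 1 - tot (-1)) * 4^-1 by apply: cvgMr_tmp; apply: cvgB; exact: c1.
have -> : (tot 1 - tot (-1)) * 4^-1 = (2 * L)%:R.
  rewrite /tot -sumrB mulr_suml.
  under eq_bigr => c _.
    rewrite -sumrB mulr_suml; under eq_bigr => l _.
      rewrite scale1r scaleN1r -ip_polar /f0 /g0.
      have La : L2 (rframe (affine_system A phi : idx -> fct) ((0, 0, l), c)).
        by apply: L2_rframe => i; exact: L2_affine.
      have Lb : L2 (rframe (affine_system A psi : idx -> fct) ((0, 0, l), c)).
        by apply: L2_rframe => i; exact: L2_affine.
      rewrite (ip_toL2 La Lb) (fip_rframe c c _ _ (bi (0, 0, l) (0, 0, l))) ?eqxx; last 2 first.
        by move=> i; exact: L2_affine.
        by move=> i; exact: L2_affine.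
      over.
    rewrite sumr_const card_ord; over.
  by rewrite big_bool /= -mulrnDr addnn -mul2n.
apply: cvg_trans; apply: near_eq_cvg; apply: nearW => m /=.
rewrite -!sumrB mulr_suml; apply: eq_bigr => a _; exact: esym (layerE a).
Qed.

End trace.

Section phase_multiplication.
Context {R : realType} {n : nat}.
Local Notation H := (@L2_hilbert R n).

Lemma bounded_mul_phase (z : R[i]) : csq z = 1 -> bounded_mul (fun _ : 'cV[R]_n => z).
Proof. by move=> z1; apply: bounded_mul_cst; rewrite z1. Qed.

(** A phase is not a scalar of the real space, so real linear relations between phases have to enter
    through the multipliers. *)
Lemma Mu_lin (c c1 c2 : 'cV[R]_n -> R[i]) (a b : R) (f g : H) :
  bounded_mul c -> bounded_mul c1 -> bounded_mul c2 ->
  (forall x, c x = a%:C%C * c1 x + b%:C%C * c2 x) ->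
  ip (Mu c f) g = a * ip (Mu c1 f) g + b * ip (Mu c2 f) g.
Proof.
move=> bc bc1 bc2 cE; move: f; apply: toL2_ind => f Lf; move: g; apply: toL2_ind => g Lg.
have L1 := L2_Mu bc1 Lf; have L2' := L2_Mu bc2 Lf.
rewrite (MuE bc Lf) (MuE bc1 Lf) (MuE bc2 Lf) (ip_toL2 (L2_Mu bc Lf) Lg) (ip_toL2 L1 Lg) (ip_toL2 L2' Lg).
rewrite -(fipZl a L1 Lg) -(fipZl b L2' Lg) -(fipDl (L2Z _ L1) (L2Z _ L2') Lg).
by congr fip; apply/funext => x; rewrite cE mulrDl !mulrA.
Qed.

Lemma Mu_cst_Tr (z : R[i]) y (f : H) : csq z = 1 ->
  Tr y (Mu (fun=> z) f) = Mu (fun=> z) (Tr y f).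
Proof. by move=> z1; rewrite TrMu//; exact: bounded_mul_phase. Qed.

Lemma Mu_phaseK (c e : 'cV[R]_n -> R[i]) (f : H) : bounded_mul c -> bounded_mul e ->
  (forall x, c x * e x = 1) -> Mu c (Mu e f) = f.
Proof.
move=> bc be h; rewrite MuMu// -[RHS]Mu1; congr Mu; exact/funext.
Qed.

End phase_multiplication.

Section modulated_trace.
Context {R : realType} {n L : nat}.
Variables (A : 'M[R]_n.+1) (rho : 'cV[R]_n.+1 -> R) (eta : R).
Hypotheses (hA : expansive A) (hrho : quasi_norm A rho) (eta1 : 1 < eta).
Hypothesis svA : forall j : int, scales_volume (A ^ j).
Local Notation H := (@L2_hilbert R n.+1).
Local Notation idx := (int * 'cV[int]_n.+1 * 'I_L)%type.
Local Notation fct := ('cV[R]_n.+1 -> R[i]).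
Local Notation lp := (@lattice_point R n.+1).

Variables (phi psi : 'I_L -> fct) (b : R) (e : nat -> H).
Hypotheses (Lphi : forall l, L2 (phi l)) (Lpsi : forall l, L2 (psi l)).
Hypothesis wpsi : forall l, weighted_L2 (fun x => (1 + rho x) `^ eta) (psi l).
Let F := nframe (affine_system A phi : idx -> fct).
Let G := nframe (affine_system A psi : idx -> fct).
Hypothesis bi : forall i j,
  L2_inner (affine_system A phi i) (affine_system A psi j) = (i == j)%:R.
Hypothesis bio : biorthogonal F G b.
Let Q : H -> H := Mu (indC (unit_box 1)).
Hypothesis pars : forall f, (\esum_(i in [set: nat]) (ip f (e i) ^+ 2)%:E = (nsq (Q f))%:E)%E.
Variable (J : int).
Hypotheses (J0 : 0 <= J) (J1 : J <= 1).
Let P := bproj F G (iset (@below n L J)).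
Let P' := bproj G F (iset (@below n L J)).
Hypothesis TkP : forall k f, Tr (lp k) (P f) = P (Tr (lp k) f).

Let uA : A \is a GRing.unit := expansive_unit hA.
Let hP : adj P P' := bproj_adj _ bio.
Let finP : (hsn e P < +oo)%E.
Proof. exact: (hsn_bproj_fin hA hrho svA Lpsi bio J1 pars). Qed.

(** Complex linearity of [P], which is built over the reals: a phase mixes only the two real vectors
    of one index. *)
Let phaseP z f : csq z = 1 -> Mu (fun=> z) (P f) = P (Mu (fun=> z) f).
Proof.
move=> z1; have bz := @bounded_mul_phase R n.+1 z z1.
have key i j (c d : bool) : i != j ->
    ip (Mu (fun=> z) (toL2 (rframe (affine_system A phi) (i, c))))
       (toL2 (rframe (affine_system A psi) (j, d)) : H) = 0.
  move=> ij; have La : L2 (rframe (affine_system A phi : idx -> fct) (i, c)).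
    by apply: L2_rframe => i'; exact: L2_affine.
  have Lb : L2 (rframe (affine_system A psi : idx -> fct) (j, d)).
    by apply: L2_rframe => i'; exact: L2_affine.
  rewrite (MuE bz La) (ip_toL2 (L2_Mu bz La) Lb) /rframe /=.
  under [X in fip X _]eq_fun do rewrite mulrA.
  by apply: inner0_fip; [exact: L2_affine|exact: L2_affine|rewrite bi (negPf ij)].
apply: (nframe_intertwine bio (Mu_adj bz)) => i c j d pi pj; apply: key; apply/eqP => ij;
  [by move: pi; rewrite ij (negPf pj)|by move: pi; rewrite ij pj].
Qed.

Let hsform_phase (y : 'cV[R]_n.+1) (i0 : 'I_n.+1) : y i0 ord0 != 0 ->
  (forall f, Tr y (P f) = P (Tr y f)) ->
  exists2 th : R, cos th != 1 & forall z, csq z = 1 ->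
  hsform e (fun f => Mu (fun=> z) (Tr y (P f))) P' =
  hsform e (fun f => Mu (fun=> z * cis th) (Tr y (P f))) P'.
Proof.
move=> y0 TyP; have b0 : 0 <= b := biorth_ge0 bio.
(* [P] has squared norm at most [b ^+ 2], and this value makes [b ^+ 2 * eps < 1], the condition for
   the telescoping to converge. *)
pose eps : R := (2 * (b ^+ 2 + 1))^-1.
have b21 : 0 < 2 * (b ^+ 2 + 1) by rewrite mulr_gt0// ltr_wpDl// sqr_ge0.
have eps0 : 0 < eps by rewrite invr_gt0.
have [t0 t00 leak] := modulation_leak uA svA Lpsi bio i0 hA hrho eta1 wpsi J0 eps0.
(* The second bound keeps the nonzero angle [t * y i0] within 1, hence below pi, so that its cosine
   is not 1. *)
pose t := Num.min t0 `|y i0 ord0|^-1.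
have yp : 0 < `|y i0 ord0| by rewrite normr_gt0.
have tp : 0 < t by rewrite lt_min t00 invr_gt0.
have tt0 : `|t| <= t0 by rewrite gtr0_norm// ge_min lexx.
have tt0' : `|- t| <= t0 by rewrite normrN.
have ty1 : t * `|y i0 ord0| <= 1.
  by rewrite -(mulVf (lt0r_neq0 yp)); apply: ler_wpM2r => //; rewrite ge_min lexx orbT.
exists (t * y i0 ord0).
  apply/eqP => c1; have := cos2Dsin2 (t * y i0 ord0); rewrite c1 expr1n => s0.
  have {}s0 : sin (t * y i0 ord0) = 0.
    by apply/eqP; rewrite -sqrf_eq0; apply/eqP; move: s0; lra.
  have : 0 < sin (t * `|y i0 ord0|).
    apply: sin_gt0_pi; rewrite mulr_gt0//=; apply: le_lt_trans ty1 _.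
    by apply: lt_le_trans (pi_ge2 R); rewrite ltr1n.
  case: (ger0P (y i0 ord0)) => _; first by rewrite s0 ltxx.
  by rewrite mulrN sinN s0 oppr0 ltxx.
move=> z z1; set w := cis _; have w1 : csq w = 1 := csq_cis _.
have zw1 : csq (z * w) = 1 by rewrite csqM z1 w1 mulr1.
have bph u (u1 : csq u = 1) := @bounded_mul_phase R n.+1 u u1.
have cz (u : R[i]) : csq u = 1 -> csq (conjc u) = 1 by rewrite /csq re_conj im_conj sqrrN.
have cconj (u : R[i]) : csq u = 1 -> u * conjc u = 1.
  move=> u1; apply: complex_ext; rewrite ?reM ?imM re_conj im_conj /=; last by ring.
  by rewrite mulrN opprK -!expr2; exact: u1.
pose ch k : R[i] := char i0 t (- lp k).
have ch1 k : csq (ch k) = 1 := csq_cis _.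
have bc (u : R) := bounded_char i0 u.
have charK u x : char i0 u x * char i0 (- u) x = 1 :> R[i].
  by rewrite /char -cisD mulNr subrr cis0.
have rotn u f : csq u = 1 -> nsq (Mu (fun=> u) f : H) = nsq f.
  by move=> u1; apply: Mu_nsq => //; exact: cmeasurable_cst.
have hT u : csq u = 1 -> adj (fun f : H => Mu (fun=> u) (Tr y f)) (fun f => Tr (- y) (Mu (fun=> conjc u) f)).
  by move=> u1 f g; rewrite (Mu_adj (bph u u1)) Tr_adj.
have hM : adj (Mu (char i0 t) : H -> H) (Mu (char i0 (- t))).
  have := Mu_adj (bc t); congr (adj _ (Mu _)); apply/funext => x; exact: char_conj.
(* The translation by [y] is taken once with phase [z] and once with phase [z * w], since moving the
   character past [Tr y] produces [w]; the phases [ch k] come in the same way from the lattice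
   translations. *)
apply: (@hsform_modulation R H _ e Q (fun k => Tr (lp k)) (fun k => Mu (fun=> ch k))
  (fun k => Mu (fun=> conjc (ch k))) P P' (Mu (char i0 t)) (Mu (char i0 (- t)))
  (fun f => Mu (fun=> z) (Tr y f)) (fun f => Tr (- y) (Mu (fun=> conjc z) f))
  (fun f => Mu (fun=> z * w) (Tr y f)) (fun f => Tr (- y) (Mu (fun=> conjc (z * w)) f))
  (b ^+ 2) eps pars).
- by move=> f; exact: tiling_L2.
- move=> k; have -> : lp (- k) = - lp k by rewrite /lattice_point map_mxN.
  exact: Tr_adj.
- by move=> k; exact: (Mu_adj (bph _ (ch1 k))).
- move=> k f; rewrite /Q MuC; [exact: rotn|exact: (bounded_indC (measurable_unit_box 1))|exact: bph].
- by move=> k f; apply: Mu_phaseK; [exact: bph|exact/bph/cz|move=> _; exact: cconj].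
- by move=> k f; apply: Mu_phaseK; [exact/bph/cz|exact: bph|move=> _; rewrite mulrC; exact: cconj].
- exact: hP.
- exact: hM.
- exact: hT.
- exact: hT.
- exact: (bproj_idem bio).
- by move=> f; apply: Mu_phaseK => // x; rewrite mulrC.
- by move=> f; apply: Mu_phaseK.
- by move=> f; rewrite TyP phaseP.
- by move=> f; rewrite TyP phaseP.
- move=> f; rewrite (TrMu y f (bc t)) (MuMu _ (bc t) (bph z z1)).
  rewrite (MuMu _ (bph _ zw1) (bounded_mul_translate y (bc t))).
  congr (Mu _ _); apply/funext => x; rewrite /translate mulrC -mulrA; congr (z * _).
  by rewrite /char !mxE /w -cisD; congr cis; ring.
- exact: (bproj_bound bio).
- by move=> f; rewrite rotn// Tr_nsq.
- by move=> f; rewrite rotn// Tr_nsq.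
- by move=> f; apply: Mu_nsq; [exact: cmeasurable_char|move=> x; exact: csq_cis].
- by move=> f; apply: Mu_nsq; [exact: cmeasurable_char|move=> x; exact: csq_cis].
- exact: sqr_ge0.
- exact: ltW.
- rewrite /eps ltr_pdivrMr// mul1r; have := sqr_ge0 b; lra.
- by move=> f; exact: leak.
- by move=> f; exact: leak.
- exact: TkP.
- by move=> k f; rewrite Mu_cst_Tr// !TrTr addrC.
- move=> k f; rewrite (TrMu (lp k) f (bc t)) MuMu//; last exact: bph.
  congr (Mu _ _); apply/funext => x; rewrite /translate /ch addrC; exact: charD.
- by move=> k f; rewrite phaseP.
- by move=> k f; rewrite MuC//; exact: bph.
- by move=> k f; rewrite MuC; [rewrite Mu_cst_Tr|exact: bph|exact: bph].
- exact: finP.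
Qed.

Let finP' : (hsn e P' < +oo)%E.
Proof. exact: (hsn_bproj_fin hA hrho svA Lphi (biorthogonalC bio) J1 pars). Qed.

(* With [w = cis th], the form below takes equal values at the phases [1], [w]
   and [w ^+ 2], while [w ^+ 2 = 2 * cos th * w - 1]. *)
Lemma hsform_translate (y : 'cV[R]_n.+1) : y != 0 -> (forall f, Tr y (P f) = P (Tr y f)) ->
  hsform e (fun f => Tr y (P f)) P' = 0.
Proof.
move=> y0 TyP.
have [i0 yi0] : exists i0, y i0 ord0 != 0.
  apply: contrapT => /forallNP h; case/eqP: y0; apply/colP => i; rewrite mxE.
  by apply/eqP/negPn/negP; exact: h.
have [th cth key] := hsform_phase yi0 TyP.
pose X z f := Mu (fun=> z) (Tr y (P f)).
have fX z : csq z = 1 -> (hsn e (X z) < +oo)%E.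
  move=> z1; rewrite (@hsn_eq _ _ e _ P)// => a; rewrite /X Mu_nsq ?Tr_nsq//.
have c1 : csq (1 : R[i]) = 1 by rewrite /csq /= expr1n expr0n addr0.
have cw := csq_cis th.
have cww : csq (cis th * cis th) = 1 by rewrite csqM cw mulr1.
have e1 := key 1 c1; rewrite mul1r in e1; have e2 := key _ cw.
have h : hsform e (X (cis th * cis th)) P' =
    (2 * cos th) * hsform e (X (cis th)) P' + (-1) * hsform e (X 1) P'.
  apply: (hsform_lin (fX _ cww) finP' (fX _ cw) finP' (fX _ c1) finP').
  move=> a; apply: Mu_lin; [exact: bounded_mul_phase|exact: bounded_mul_phase|exact: bounded_mul_phase|].
  move=> x; have := cos2Dsin2 th => hcs.
  by apply: complex_ext; rewrite ?reD ?imD ?reM ?imM /=; lra.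
move: h; rewrite -[hsform e (X (cis th * cis th)) P']e2 -[hsform e (X (cis th)) P']e1 -/(X 1).
have -> : (fun f => Tr y (P f)) = X 1 by apply/funext => f; rewrite /X Mu1.
move=> h; have : (2 - 2 * cos th) * hsform e (X 1) P' = 0 by move: h; lra.
move/eqP; rewrite mulf_eq0 => /orP[|/eqP//].
by rewrite -{1}[2]mulr1 -mulrBr mulf_eq0 pnatr_eq0 /= subr_eq0 eq_sym (negPf cth).
Qed.

(** [hsform_approx] with [U] a translation: one small vector works for the finitely many [P (e a)]
    at hand, although translations do not approach the identity in norm. *)
Lemma hsform_small_translates :
  (forall d : R, 0 < d -> exists y : 'cV[R]_n.+1,
     [/\ y != 0, `|y| <= d & forall f, Tr y (P f) = P (Tr y f)]) ->
  hsform e P P' = 0.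
Proof.
move=> small; apply: hsform_approx => [||m d d0]; [exact: finP|exact: finP'|].
have [r r0 hr] : exists2 r : R, 0 < r & forall a y, (a < m)%N -> `|y| <= r ->
    nsq (Tr y (P (e a)) - P (e a)) <= d.
  elim: m => [|m [r r0 IH]]; first by exists 1.
  have [r' r'0 h] := Tr_continuous (P (e m)) (ltn0Sn n) d0.
  exists (Num.min r r'); first by rewrite lt_min r0.
  move=> a y; rewrite ltnS le_min leq_eqVlt => /orP[/eqP ->|am] /andP[yr yr']; first exact: h.
  exact: IH.
have [y [y0 yr TyP]] := small r r0; exists (Tr y); split.
- by move=> f; exact: Tr_nsq.
- by move=> a am; exact: hr.
- exact: hsform_translate.
Qed.

End modulated_trace.

(** * Small vectors of the group generated by a lattice and its image *)

Section small_vectors.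
Context {R : realType} {n : nat}.
Local Notation lp := (@lattice_point R n.+1).

(* Dirichlet's pigeonhole argument, applied to the multiples of a column of [A]
   with an irrational entry. *)
Lemma small_lattice_vectors (A : 'M[R]_n.+1) : ~ rational_matrix A ->
  forall d : R, 0 < d -> exists k k' : 'cV[int]_n.+1,
    lp k + A *m lp k' != 0 /\ `|lp k + A *m lp k'| <= d.
Proof.
move=> irr d d0.
have [i0 [j0 irr0]] : exists i0 j0, forall q : rat, A i0 j0 <> ratr q.
  apply: contrapT => h; apply: irr => i j; apply: contrapT => nq; apply: h.
  by exists i, j => q e; apply: nq; exists q.
pose N := (Num.truncn d^-1).+1.
have N0 : 0 < N%:R :> R by rewrite ltr0n.
have Nd : N%:R^-1 <= d by rewrite invf_ple ?posrE//; exact/ltW/truncnS_gt.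
pose fr (m : nat) i : R := m%:R * A i j0 - (Num.floor (m%:R * A i j0))%:~R.
have fr01 m i : 0 <= fr m i < 1.
  by have := floor_itv (m%:R * A i j0); rewrite /fr intrD => /andP[h1 h2]; apply/andP; split; lra.
have frN m i : (Num.truncn (N%:R * fr m i) < N)%N.
  have /andP[h0 h1] := fr01 m i; have h : 0 <= N%:R * fr m i by rewrite mulr_ge0// ltW.
  have /andP[h2 _] := truncn_itv h; rewrite -(ltr_nat R); apply: le_lt_trans h2 _.
  by rewrite -[ltRHS]mulr1 ltr_pM2l.
(* One multiple more than there are cells of side [1 / N] in the unit cube. *)
pose cell (m : 'I_(N ^ n.+1).+1) : {ffun 'I_n.+1 -> 'I_N} := [ffun i => Ordinal (frN m i)].
have [m [m' mm' cE]] : exists m, exists2 m', m != m' & cell m = cell m'.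
  apply/injectivePn/negP => /injectiveP /leq_card.
  by rewrite card_ffun !card_ord ltnn.
have close i : `|fr m i - fr m' i| <= d.
  have /ffunP/(_ i) := cE; rewrite !ffunE => /(congr1 val) /= e.
  have /andP[a0 a1] := fr01 m i; have /andP[b0 b1] := fr01 m' i.
  have /andP[h1 h2] := truncn_itv (mulr_ge0 (ltW N0) a0).
  have /andP[h3 h4] := truncn_itv (mulr_ge0 (ltW N0) b0).
  rewrite -e in h3 h4; rewrite -natr1 in h2; rewrite -natr1 in h4.
  apply: le_trans Nd; rewrite -[leRHS]mul1r ler_pdivlMr//.
  rewrite -{1}(ger0_norm (ltW N0)) -normrM mulrBl ler_norml; apply/andP; split; lra.
pose k' : 'cV[int]_n.+1 := \col_j (if j == j0 then m%:Z - m'%:Z else 0).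
pose k : 'cV[int]_n.+1 := \col_i (Num.floor (m'%:R * A i j0) - Num.floor (m%:R * A i j0)).
have yE i : (lp k + A *m lp k') i ord0 = fr m i - fr m' i.
  rewrite !mxE (bigD1 j0)//= big1 ?addr0; last first.
    by move=> j /negPf jj; rewrite !mxE jj mulr0z mulr0.
  rewrite !mxE eqxx /fr !intrD !rmorphN /= !mulrDr.
  by rewrite -!pmulrn; ring.
exists k, k'; split; last by apply/cV_norm_le => [|i]; [exact: ltW|rewrite yE].
(* If the difference vanished at [i0], dividing by [m - m'] would express [A i0 j0] as a
   rational. *)
apply/eqP => /colP /(_ i0); rewrite yE mxE /fr => h.
set p := Num.floor (m%:R * A i0 j0) in h; set p' := Num.floor (m'%:R * A i0 j0) in h.
have mm0 : (m%:R - m'%:R : R) != 0.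
  by rewrite subr_eq0 eqr_nat; apply: contra mm' => /eqP e; apply/eqP/val_inj.
apply: (irr0 ((p - p')%:~R / (m%:Z - m'%:Z)%:~R)).
apply: (mulfI mm0); rewrite fmorph_div /= !ratr_int !intrD !rmorphN /= -!pmulrn.
by rewrite [RHS]mulrC divfK//; lra.
Qed.

End small_vectors.

(** * Rationality of the dilation matrix *)

Section rationality.
Context {R : realType}.

Lemma translate0 n (f : 'cV[R]_n -> R[i]) : translate (lattice_point 0) f = f.
Proof.
apply/funext => x; rewrite /translate (_ : lattice_point 0 = 0) ?subr0//.
by apply/colP => i; rewrite !mxE mulr0z.
Qed.

Lemma L2_innerC n (f g : 'cV[R]_n -> R[i]) : L2 f -> L2 g ->
  L2_inner g f = conjc (L2_inner f g).
Proof.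
move=> Lf Lg; rewrite !L2_innerE /= (fipC g f); congr Complex.
rewrite -fipNr//; last exact: L2Z.
have -> : (fun x => - ('i%C * g x)) = (fun x => conjc 'i%C * g x).
  by apply/funext => x; rewrite -mulNr; congr (_ * _); apply: complex_ext; rewrite /= ?oppr0.
by rewrite -fip_mul fipC.
Qed.

(** A witness that the space is not zero; it excludes an empty family of wavelets, whose trace
    [2 * L] would give no contradiction. *)
Lemma unit_box_nonzero n : (toL2 (indC (unit_box 0)) : @L2_hilbert R n) <> 0.
Proof.
have mQ := @measurable_unit_box R n 0.
move=> h; have LQ : L2 (indC (unit_box 0) : 'cV[R]_n -> R[i]).
  have := @L2_ind R n (unit_box 0) 1%N mQ; congr (L2 (indC _)).
  apply/seteqP; split => x; [by case|move=> xQ; split => // i; have := xQ i].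
  by rewrite /= !in_itv /= => /andP[h1 h2]; apply/andP; split; lra.
have : nsq (toL2 (indC (unit_box 0)) : @L2_hilbert R n) = 1.
  apply/EFin_inj; rewrite (nsq_toL2E LQ) L2_sqnormE.
  rewrite (eq_integral (fun x => (\1_(unit_box 0) x)%:E)); last first.
    by move=> x _; rewrite /indC csqC indicE; case: (_ \in _); rewrite ?expr1n ?expr0n.
  by rewrite integral_indic// setIT; exact: lebesgue_unit_box0.
by rewrite h nsq0 => /eqP; rewrite eq_sym oner_eq0.
Qed.

Lemma orthonormal_riesz_basis n (I : eqType) (phi : I -> 'cV[R]_n -> R[i]) :
  orthonormal_basis phi -> riesz_basis phi.
Proof.
move=> [cs on]; split => //; have Lp := cs.1.
exists 1, 1; split; [exact: ltr01|exact: ltr01|move=> s c us /=]; rewrite !mul1r.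
set coef := \sum_(i <- s) _; set comb := fun x => _.
have [Lc cE] := toL2_sum s (fun i => L2Z (c i) (Lp i)).
suff -> : L2_sqnorm comb = coef%:E by rewrite lexx.
rewrite -(nsq_toL2E Lc) -cE /nsq ip_suml; congr (_%:E); apply: eq_big_seq => i si.
rewrite ip_sumr (bigD1_seq i)//= (ip_toL2 (L2Z _ (Lp i)) (L2Z _ (Lp i))).
rewrite big1 ?addr0 => [|j ji]; last first.
  rewrite (ip_toL2 (L2Z _ (Lp i)) (L2Z _ (Lp j))).
  by apply: inner0_fip => //; rewrite on eq_sym (negPf ji).
rewrite csqE fip_mul.
have -> : (fun x => conjc (c i) * (c i * phi i x)) = (fun x => (csq (c i))%:C%C * phi i x).
  apply/funext => x; rewrite mulrA; congr (_ * _).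
  by apply: complex_ext; rewrite ?reM ?imM ?re_conj ?im_conj /= /csq; ring.
rewrite fipC fipZl//; have := on i i; rewrite eqxx L2_innerE => /(congr1 (@complex.Re R)) /= ->.
by rewrite mulr1.
Qed.

Lemma biorthogonal_wavelets_rational (n L : nat) (A : 'M[R]_n.+1) (rho : 'cV[R]_n.+1 -> R)
    (psi psi_dual : 'I_L -> 'cV[R]_n.+1 -> R[i]) (eta : R) :
  expansive A -> quasi_norm A rho ->
  (forall l, L2 (psi l)) -> (forall l, L2 (psi_dual l)) ->
  biorthogonal_riesz_wavelets A psi psi_dual -> 1 < eta ->
  (forall l, weighted_L2 (fun x => (1 + rho x) `^ eta) (psi_dual l)) ->
  shift_invariant (negative_dilates A psi) ->
  shift_invariant (negative_dilates A psi_dual) ->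
  rational_matrix A.
Proof.
move=> hA hrho Lpsi Lpsid [rb rbd bi] eta1 wd sh shd.
have uA := expansive_unit hA.
pose idx := (int * 'cV[int]_n.+1 * 'I_L)%type.
have [b bio] : exists b, biorthogonal (nframe (affine_system A psi : idx -> _))
    (nframe (affine_system A psi_dual : idx -> _)) b by exact: riesz_basis_biorthogonal.
have La i : L2 (affine_system A psi i) by case: rb => -[].
have Lad i : L2 (affine_system A psi_dual i) by case: rbd => -[].
have L0 : (0 < L)%N.
  rewrite lt0n; apply/eqP => L0; apply: (@unit_box_nonzero n.+1).
  apply: (biorth_totl bio) => m; rewrite /nframe; case: pickle_inv => [[[[j k] l] c]|] /=; last exact: ip0r.
  by exfalso; have := ltn_ord l; rewrite [X in (_ < X)%N]L0.
pose l0 : 'I_L := Ordinal L0.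
have fip1 i : fip (affine_system A psi i) (affine_system A psi_dual i) = 1.
  by have := bi i i; rewrite eqxx L2_innerE => /(congr1 (@complex.Re R)).
have svA j : scales_volume (A ^ j).
  have aE (chi : 'I_L -> 'cV[R]_n.+1 -> R[i]) : affine_system A chi (j, 0, l0) = dilate (A ^ j) (chi l0).
    by rewrite /affine_system translate0.
  have a0 (chi : 'I_L -> 'cV[R]_n.+1 -> R[i]) : affine_system A chi (0, 0, l0) = chi l0.
    by rewrite /affine_system translate0 expr0z dilate1.
  apply: (@biorthogonal_scales_volume _ _ _ (psi l0) (psi_dual l0)) => //.
  - by rewrite unitrXz.
  - by rewrite -!a0 fip1.
  - by rewrite -!aE fip1.
  - by rewrite -aE.
  - by rewrite -aE.
have bi' i j : L2_inner (affine_system A psi_dual i) (affine_system A psi j) = (i == j)%:R.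
  by rewrite L2_innerC// bi eq_sym conjc_nat.
pose Q : @L2_hilbert R n.+1 -> @L2_hilbert R n.+1 := Mu (indC (unit_box 1)).
have mQ := @measurable_unit_box R n.+1 1.
pose G := nframe (affine_system A psi_dual : idx -> _).
(* The truncated dual frame is total in the range of [Q], so it provides the sequence to
   orthonormalize. *)
pose e := gs (fun m => Q (G m)).
have pars f : (\esum_(i in [set: nat]) (ip f (e i) ^+ 2)%:E = (nsq (Q f))%:E)%E.
  apply: gs_parseval; first exact: indC_adj.
  - by move=> g; exact: indC_idem.
  - by move=> m; exact: indC_idem.
  move=> g Qg h; apply: (biorth_totr bio) => m; rewrite -[g]Qg.
  by rewrite (indC_adj mQ); exact: h.
apply: contrapT => irr.
pose F := nframe (affine_system A psi : idx -> _).
pose P J := bproj F G (iset (@below n L J)); pose P' J := bproj G F (iset (@below n L J)).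
have TkP J : J = 0 \/ J = 1 -> forall k f, Tr (lattice_point k) (P J f) = P J (Tr (lattice_point k) f).
  by move=> h k f; exact: (bproj_shift svA Lpsi Lpsid bi bi' bio sh shd k f h).
have small0 (d : R) : 0 < d -> exists y : 'cV[R]_n.+1,
    [/\ y != 0, `|y| <= d & forall f, Tr y (P 0 f) = P 0 (Tr y f)].
  move=> d0; have [k [k' [y0 yd]]] := small_lattice_vectors irr d0.
  exists (lattice_point k + A *m lattice_point k'); split => // f.
  exact: (bproj0_shift uA svA Lpsi Lpsid bi bi' bio sh shd k k' f).
have small1 (d : R) : 0 < d -> exists y : 'cV[R]_n.+1,
    [/\ y != 0, `|y| <= d & forall f, Tr y (P 1 f) = P 1 (Tr y f)].
  move=> d0; have [K K1 hK] := mulmx_norm_bound (invmx A).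
  have K0 : 0 < K by exact: lt_le_trans K1.
  have [y [y0 yd yP]] := small0 (d / K) (divr_gt0 d0 K0).
  exists (invmx A *m y); split.
  - by apply: contra y0 => /eqP h; rewrite -(mulKVmx uA y) h mulmx0.
  - by apply: le_trans (hK y) _; rewrite mulrC -ler_pdivlMr.
  - exact: (bproj1_shift uA svA Lpsi Lpsid bi bio yP).
have z0 : hsform e (P 0) (P' 0) = 0.
  apply: (hsform_small_translates hA hrho eta1 svA Lpsi Lpsid wd bi bio pars) => //.
  by apply: TkP; left.
have z1 : hsform e (P 1) (P' 1) = 0.
  apply: (hsform_small_translates hA hrho eta1 svA Lpsi Lpsid wd bi bio pars) => //.
  by apply: TkP; right.
have fin J : J <= 1 -> (hsn e (P J) < +oo)%E.
  by move=> J1; exact: (hsn_bproj_fin hA hrho svA Lpsid bio J1 pars).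
have fin' J : J <= 1 -> (hsn e (P' J) < +oo)%E.
  by move=> J1; exact: (hsn_bproj_fin hA hrho svA Lpsi (biorthogonalC bio) J1 pars).
have := trace_layer svA Lpsi Lpsid bi bio pars fin fin'.
rewrite -/F -/G -/(P 0) -/(P 1) -/(P' 0) -/(P' 1) z0 z1 subrr => /eqP.
by rewrite eq_sym pnatr_eq0 muln_eq0 /= -leqn0 leqNgt L0.
Qed.

End rationality.

Theorem theorem7p5 (R : realType) (n : nat) (A : 'M[R]_n.+1)
    (rho : 'cV[R]_n.+1 -> R) :
  expansive A -> quasi_norm A rho ->
  (forall (L : nat) (psi psi_dual : 'I_L -> 'cV[R]_n.+1 -> R[i]),
     (forall l, L2 (psi l)) -> (forall l, L2 (psi_dual l)) ->
     biorthogonal_riesz_wavelets A psi psi_dual ->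
     (exists eta : R, 1 < eta /\ forall l,
        weighted_L2 (fun x => (1 + rho x) `^ eta) (psi l) /\
        weighted_L2 (fun x => (1 + rho x) `^ eta) (psi_dual l)) ->
     shift_invariant (negative_dilates A psi) ->
     shift_invariant (negative_dilates A psi_dual) ->
     rational_matrix A)
  /\
  (forall (L : nat) (psi : 'I_L -> 'cV[R]_n.+1 -> R[i]),
     (forall l, L2 (psi l)) ->
     orthonormal_wavelet A psi ->
     (exists eta : R, 1 < eta /\ forall l,
        weighted_L2 (fun x => (1 + rho x) `^ eta) (psi l)) ->
     shift_invariant (negative_dilates A psi) ->
     biorthogonal_riesz_wavelets A psi psi /\ rational_matrix A).
Proof.
move=> hA hrho; split.
  move=> L psi psi_dual Lpsi Lpsid bi [eta [eta1 hw]] sh shd.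
  have wd l : weighted_L2 (fun x => (1 + rho x) `^ eta) (psi_dual l) by case: (hw l).
  exact: (biorthogonal_wavelets_rational hA hrho Lpsi Lpsid bi eta1 wd sh shd).
move=> L psi Lpsi on [eta [eta1 hw]] sh.
have bi : biorthogonal_riesz_wavelets A psi psi.
  by split; [exact: orthonormal_riesz_basis|exact: orthonormal_riesz_basis|case: on].
split => //; exact: (biorthogonal_wavelets_rational hA hrho Lpsi Lpsi bi eta1 hw sh sh).
Qed.
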